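(* For every $N\ge2$ and $q>0$, the Cuntz--Pimsner algebra $\mathcal O_{N,q}$ is a universal unital C$^*$-algebra with generators $s_1,\dots,s_N$ satisfying the following relations: (1) if $q\ge1$, then $$\sum^N_{i=1}s_is_i^*=1,\qquad s_is_j=qs_js_i\quad (i<j),\qquad s_i^*s_j=q^{-1}s_js_i^*\quad (i\ne j),$$ $$s_{i}^{*}s_{i}=s_{i}s_{i}^{*}+(1-q^{-2})\sum^N_{j=i+1}s_{j}s_{j}^{*};$$ (2) if $q\le 1$, then $$\sum^N_{i=1}s_is_i^*=1,\qquad s_is_j=qs_js_i\quad (i<j),\qquad s_i^*s_j=qs_js_i^*\quad (i\ne j),$$ $$s_{i}^{*}s_{i}=s_{i}s_{i}^{*}+(1-q^2)\sum^{i-1}_{j=1}s_{j}s_{j}^{*}.$$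
   Context: Let $H=\mathbb C^N$ with its standard orthonormal basis, and identify the tensor algebra $T(H)=\bigoplus_nH^{\otimes n}$ with the algebra $\mathbb C\langle X_1,\dots,X_N\rangle$ of noncommutative polynomials, so that the noncommutative monomials are orthonormal. Let $I$ be the two-sided ideal generated by $X_iX_j-qX_jX_i$ for $i<j$, $I_n$ its degree $n$ homogeneous component, and $H_n=I_n^\perp\subset H^{\otimes n}$. Then $H_{k+l}\subset H_k\otimes H_l$. Let $H^2_{N,q}=\bigoplus_{n\ge0}H_n$ be the Fock space, and let $S_i$ be the creation operator $S_i\zeta=$ the orthogonal projection of $X_i\otimes\zeta\in H^{\otimes(n+1)}$ onto $H_{n+1}$, for $\zeta\in H_n$. (Equivalently, identifying $\bigoplus_nH_n$ algebraically with $\mathbb C_q[e_1,\dots,e_N]=\mathbb C\langle X_1,\dots,X_N\rangle/I$, where $e_i$ is the image of $X_i$, $S_i$ is left multiplication by $e_i$.) $\mathcal T_{N,q}\subset B(H^2_{N,q})$ is the unital C$^*$-algebra generated by $S_1,\dots,S_N$; it contains the compact operators, and $\mathcal O_{N,q}=\mathcal T_{N,q}/\mathcal K(H^2_{N,q})$. The element $s_i$ is the image of $S_i$ in $\mathcal O_{N,q}$. *)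

(* Defs.v *)
From HB Require Import structures.
From mathcomp Require Import all_boot all_order all_algebra.
From mathcomp Require Import complex.
From mathcomp Require Import all_classical all_reals all_analysis.
From mathcomp Require Import ring.

Set Implicit Arguments.
Unset Strict Implicit.
Unset Printing Implicit Defensive.

Import Order.TTheory GRing.Theory Num.Theory numFieldNormedType.Exports.
Local Open Scope classical_set_scope.
Local Open Scope ring_scope.
Local Open Scope complex_scope.

(* The norm is real valued and completeness is stated sequentially because
   the library's hierarchy admits no join of [algType] and [normedModType]. *)
HB.mixin Record isCStar (R : realType) (A : Type) of GRing.Algebra R[i] A := {
  star : A -> A ;
  starK : involutive star ;
  starD : {morph star : x y / x + y} ;
  starZ : forall (a : R[i]) (x : A), star (a *: x) = a^* *: star x ;
  starM : forall x y : A, star (x * y) = star y * star x ;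
  cnorm : A -> R ;
  cnorm_eq0 : forall x : A, cnorm x = 0 -> x = 0 ;
  cnormD : forall x y : A, cnorm (x + y) <= cnorm x + cnorm y ;
  cnormZ : forall (a : R[i]) (x : A),
    cnorm (a *: x) = Normc.normc a * cnorm x ;
  cnormM : forall x y : A, cnorm (x * y) <= cnorm x * cnorm y ;
  cnorm_starM : forall x : A, cnorm (star x * x) = cnorm x ^+ 2 ;
  cnorm_complete : forall u : nat -> A,
    (forall e : R, 0 < e -> exists n0 : nat, forall m n : nat,
       (n0 <= m)%N -> (n0 <= n)%N -> cnorm (u m - u n) <= e) ->
    exists l : A, (fun n => cnorm (u n - l)) @ \oo --> (0 : R)
}.

#[short(type="cstarAlgType")]
HB.structure Definition CStarAlgebra (R : realType) :=
  {A of isCStar R A & GRing.Algebra R[i] A}.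

Definition is_star_hom (R : realType) (A B : cstarAlgType R) (f : A -> B) :=
  forall x : A, f (star x) = star (f x).

Definition is_cstar_subalg (R : realType) (A : cstarAlgType R) (M : set A) :=
  [/\ M 1,
      forall (a : R[i]) x y, M x -> M y -> M (a *: x + y),
      forall x y, M x -> M y -> M (x * y),
      forall x, M x -> M (star x) &
      forall x, (forall e : R, 0 < e -> exists2 y, M y & cnorm (x - y) <= e) ->
        M x].

Definition cstar_generated (R : realType) (A : cstarAlgType R) (G : set A) :=
  smallest (@is_cstar_subalg R A) G.

Definition is_universal_cstar (R : realType) (I : Type)
    (rel : forall A : cstarAlgType R, (I -> A) -> Prop)
    (A : cstarAlgType R) (s : I -> A) :=
  [/\ rel A s,
      cstar_generated (range s) = [set: A] &
      forall (B : cstarAlgType R) (b : I -> B), rel B b ->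
        exists2 f : {lrmorphism A -> B},
          is_star_hom f /\ (forall i, f (s i) = b i) &
          forall g : {lrmorphism A -> B},
            is_star_hom g -> (forall i, g (s i) = b i) -> g =1 f].

Section TensorAlgebra.
Variables (R : realType) (N : nat).

(* [seq 'I_N] indexes the noncommutative monomials, i.e., the standard basis of
   T(C^N); the elements of T(C^N) are the coefficient families of finite
   degree. *)
Definition word := seq 'I_N.
Definition coefs := word -> R[i].

Definition monom (w : word) : coefs := fun v => (v == w)%:R.

Definition in_tensor_algebra (f : coefs) :=
  exists d : nat, forall w : word, (d < size w)%N -> f w = 0.

Definition homogeneous (n : nat) (f : coefs) :=
  forall w : word, size w != n -> f w = 0.

Definition component (n : nat) (f : coefs) : coefs :=
  fun w => if size w == n then f w else 0.

Definition tensor (f g : coefs) : coefs :=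
  fun w => \sum_(k < (size w).+1) f (take k w) * g (drop k w).

Definition hdot (n : nat) (f g : coefs) : R[i] :=
  \sum_(w : n.-tuple 'I_N) f w * (g w)^*.

Definition hnormsq (n : nat) (f : coefs) : R :=
  \sum_(w : n.-tuple 'I_N) Normc.normc (f w) ^+ 2.

Definition two_sided_ideal (J : set coefs) :=
  [/\ J `<=` in_tensor_algebra,
      J (fun=> 0),
      forall f g, J f -> J g -> J (fun w => f w + g w) &
      forall a p b, in_tensor_algebra a -> J p -> in_tensor_algebra b ->
        J (tensor (tensor a p) b)].

Variable q : R.

Definition qrelator (i j : 'I_N) : coefs :=
  fun w => monom [:: i; j] w - q%:C * monom [:: j; i] w.

Definition qideal : set coefs :=
  smallest two_sided_ideal
    [set p | exists i j : 'I_N, (i < j)%N /\ p = qrelator i j].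

(* The ideal is graded, so its degree [n] component consists of its homogeneous
   elements of degree [n]. *)
Definition Hsub (n : nat) : set coefs :=
  [set f | homogeneous n f /\
     forall p, qideal p -> homogeneous n p -> hdot n f p = 0].

(* For homogeneous [f] of degree [n] exactly one [g] qualifies, the ambient
   space C^(N^n) being finite dimensional; the default value is never used. *)
Definition Hproj (n : nat) (f : coefs) : coefs :=
  xget (fun=> 0) [set g | Hsub n g /\
    forall h, Hsub n h -> hdot n (fun w => f w - g w) h = 0].

End TensorAlgebra.

Section FiniteSums.
Variable R : realType.

Lemma sqrt_minkowski2 (a b c d : R) :
  Num.sqrt ((a + c) ^+ 2 + (b + d) ^+ 2) <=
  Num.sqrt (a ^+ 2 + b ^+ 2) + Num.sqrt (c ^+ 2 + d ^+ 2).
Proof. exact: (le_normcD (a +i* b) (c +i* d)). Qed.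

Lemma sqrt_minkowski (I : Type) (r : seq I) (f g h : I -> R) :
    (forall i, 0 <= h i) -> (forall i, 0 <= f i) -> (forall i, 0 <= g i) ->
    (forall i, h i <= f i + g i) ->
  Num.sqrt (\sum_(i <- r) h i ^+ 2) <=
  Num.sqrt (\sum_(i <- r) f i ^+ 2) + Num.sqrt (\sum_(i <- r) g i ^+ 2).
Proof.
move=> h0 f0 g0 hfg; elim: r => [|i r IHr].
  by rewrite !big_nil sqrtr0 addr0.
rewrite !big_cons.
set H := \sum_(j <- r) _ in IHr *; set F := \sum_(j <- r) _ in IHr *.
set G := \sum_(j <- r) _ in IHr *.
have [H0 F0 G0] : [/\ 0 <= H, 0 <= F & 0 <= G].
  by split; apply: sumr_ge0 => j _; apply: sqr_ge0.
have := sqrt_minkowski2 (f i) (Num.sqrt F) (g i) (Num.sqrt G).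
rewrite !sqr_sqrtr//; apply: le_trans; apply: ler_wsqrtr.
apply: lerD; first by rewrite ler_sqr ?nnegrE// addr_ge0.
by rewrite -[leLHS]sqr_sqrtr// ler_sqr ?nnegrE ?addr_ge0 ?sqrtr_ge0.
Qed.

End FiniteSums.

Section SquareSummable.
Variables (R : realType) (N : nat).
Implicit Types f g : coefs R N.

Lemma normc_ge0 (z : R[i]) : 0 <= Normc.normc z.
Proof. by case: z => x y; rewrite sqrtr_ge0. Qed.

Lemma hnormsq_ge0 n f : 0 <= hnormsq n f.
Proof. by apply: sumr_ge0 => w _; apply: sqr_ge0. Qed.

Definition square_summable f := cvgn (series (fun n => hnormsq n f)).

Definition l2norm f : R := Num.sqrt (limn (series (fun n => hnormsq n f))).

Lemma series_hnormsq_nd f : nondecreasing_seq (series (fun n => hnormsq n f)).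
Proof.
by apply/nondecreasing_seqP => n; rewrite seriesSr lerDl hnormsq_ge0.
Qed.

Lemma square_summableP f (M : R) :
  (forall n, series (fun n => hnormsq n f) n <= M) -> square_summable f.
Proof.
move=> fM; apply: nondecreasing_is_cvgn; first exact: series_hnormsq_nd.
by exists M => _ [n _ <-].
Qed.

Lemma series_le_l2norm f n : square_summable f ->
  Num.sqrt (series (fun n => hnormsq n f) n) <= l2norm f.
Proof.
move=> sf; apply: ler_wsqrtr.
exact: nondecreasing_cvgn_le (@series_hnormsq_nd f) sf n.
Qed.

Lemma lim_hnormsq_ge0 f : square_summable f ->
  0 <= limn (series (fun n => hnormsq n f)).
Proof.
move=> sf; apply: limr_ge => //; apply: nearW => n.
by apply: sumr_ge0 => k _; apply: hnormsq_ge0.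
Qed.

Lemma l2norm_le f (M : R) : 0 <= M ->
  (forall n, Num.sqrt (series (fun n => hnormsq n f) n) <= M) ->
  square_summable f /\ l2norm f <= M.
Proof.
move=> M0 fM.
have fM2 n : series (fun n => hnormsq n f) n <= M ^+ 2.
  have s0 : 0 <= series (fun n => hnormsq n f) n.
    by apply: sumr_ge0 => k _; apply: hnormsq_ge0.
  by rewrite -[leLHS]sqr_sqrtr// ler_sqr ?nnegrE ?sqrtr_ge0.
have sf := square_summableP fM2; split => //.
rewrite -[leRHS]ger0_norm// -sqrtr_sqr; apply: ler_wsqrtr.
by apply: limr_le => //; apply: nearW.
Qed.

Lemma series_hnormsqD f g n :
  Num.sqrt (series (fun n => hnormsq n (fun w => f w + g w)) n) <=
  Num.sqrt (series (fun n => hnormsq n f) n) +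
  Num.sqrt (series (fun n => hnormsq n g) n).
Proof.
have sq (h : coefs R N) k : hnormsq k h = Num.sqrt (hnormsq k h) ^+ 2.
  by rewrite sqr_sqrtr // hnormsq_ge0.
rewrite /series /=.
under eq_bigr do rewrite sq.
under [in leRHS]eq_bigr do rewrite sq.
under [X in _ + Num.sqrt X]eq_bigr do rewrite sq.
apply: sqrt_minkowski => [k|k|k|k]; rewrite ?sqrtr_ge0//.
by apply: sqrt_minkowski => w; rewrite ?normc_ge0// le_normcD.
Qed.

Lemma hnormsqZ n (a : R[i]) f :
  hnormsq n (fun w => a * f w) = Normc.normc a ^+ 2 * hnormsq n f.
Proof.
by rewrite /hnormsq mulr_sumr; apply: eq_bigr => w _; rewrite Normc.normcM exprMn.
Qed.

End SquareSummable.

Section Fock.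
Variables (R : realType) (N : nat) (q : R).

(* H^2_{N,q}, the Hilbert direct sum of the H_n: a vector is the family of all
   the coefficients of its components. *)
Definition fock_pred (f : coefs R N) :=
  (forall n, Hsub q n (component n f)) /\ square_summable f.

Record fock := Fock { fock_val :> coefs R N ; fockP : fock_pred fock_val }.

Lemma fock_inj (u v : fock) : (fock_val u = fock_val v) -> u = v.
Proof.
by case: u v => [u up] [v vp] /= uv; case: _ / uv vp => vp; congr Fock.
Qed.

Lemma hdotD n (f g p : coefs R N) :
  hdot n (fun w => f w + g w) p = hdot n f p + hdot n g p.
Proof. by rewrite -big_split; apply: eq_bigr => w _; rewrite mulrDl. Qed.

Lemma hdotZ n a (f p : coefs R N) :
  hdot n (fun w => a * f w) p = a * hdot n f p.
Proof. by rewrite mulr_sumr; apply: eq_bigr => w _; rewrite mulrA. Qed.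

Lemma eq_hdot n (f f' p : coefs R N) :
  (forall w : word N, size w = n -> f w = f' w) -> hdot n f p = hdot n f' p.
Proof. by move=> ff; apply: eq_bigr => w _; rewrite ff// size_tuple. Qed.

Lemma Hsub0 n : @Hsub R N q n (fun=> 0).
Proof.
split=> // p _ _; rewrite -[RHS](mul0r (hdot n p p)) -hdotZ.
by apply: eq_hdot => w _; rewrite mul0r.
Qed.

Lemma HsubD n (f g : coefs R N) : Hsub q n f -> Hsub q n g ->
  Hsub q n (fun w => f w + g w).
Proof.
move=> [f0 fp] [g0 gp]; split=> [w nw|p Ip hp].
  by rewrite f0// g0// addr0.
by rewrite hdotD fp// gp// addr0.
Qed.

Lemma HsubZ n a (f : coefs R N) : Hsub q n f -> Hsub q n (fun w => a * f w).
Proof.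
move=> [f0 fp]; split=> [w nw|p Ip hp]; first by rewrite f0// mulr0.
by rewrite hdotZ fp// mulr0.
Qed.

Fact fock_pred0 : fock_pred (fun=> 0).
Proof.
split=> [n|].
  rewrite (_ : component _ _ = fun=> 0); first exact: Hsub0.
  by apply/funext => w; rewrite /component; case: ifP.
apply: (@square_summableP _ _ _ 0) => n; rewrite /series /= big1// => k _.
by rewrite /hnormsq big1// => w _; rewrite Normc.normc0 expr0n.
Qed.

Fact fock_predD f g : fock_pred f -> fock_pred g ->
  fock_pred (fun w => f w + g w).
Proof.
move=> [fH fs] [gH gs]; split=> [n|].
  rewrite (_ : component _ _ =
    (fun w => component n f w + component n g w)); first exact: HsubD.
  by apply/funext => w; rewrite /component; case: ifP; rewrite ?addr0.
apply: (proj1 (@l2norm_le _ _ _ (l2norm f + l2norm g) _ _)).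
  by rewrite addr_ge0 ?sqrtr_ge0.
move=> n; apply: (le_trans (series_hnormsqD _ _ _)).
by apply: lerD; apply: series_le_l2norm.
Qed.

Fact series_hnormsqZ (a : R[i]) (f : coefs R N) :
  series (fun n => hnormsq n (fun w => a * f w)) =
  (fun n => Normc.normc a ^+ 2 * series (fun n => hnormsq n f) n).
Proof.
apply/funext => n; rewrite /series /= mulr_sumr.
by apply: eq_bigr => k _; rewrite hnormsqZ.
Qed.

Fact fock_predZ a f : fock_pred f -> fock_pred (fun w => a * f w).
Proof.
move=> [fH fs]; split=> [n|].
  rewrite (_ : component _ _ = (fun w => a * component n f w)).
    exact: HsubZ.
  by apply/funext => w; rewrite /component; case: ifP; rewrite ?mulr0.
by rewrite /square_summable series_hnormsqZ; apply: is_cvgMr.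
Qed.

Definition fock0 := Fock fock_pred0.
Definition fockD (u v : fock) := Fock (fock_predD (fockP u) (fockP v)).
Definition fockZ a (u : fock) := Fock (fock_predZ a (fockP u)).
Definition fockN (u : fock) := fockZ (- 1) u.

Fact fockDA : associative fockD.
Proof. by move=> u v w; apply/fock_inj/funext => x /=; rewrite addrA. Qed.

Fact fockDC : commutative fockD.
Proof. by move=> u v; apply/fock_inj/funext => x /=; rewrite addrC. Qed.

Fact fock0D : left_id fock0 fockD.
Proof. by move=> u; apply/fock_inj/funext => x /=; rewrite add0r. Qed.

Fact fockND : left_inverse fock0 fockN fockD.
Proof. by move=> u; apply/fock_inj/funext => x /=; rewrite mulN1r addNr. Qed.

HB.instance Definition _ := gen_eqMixin fock.
HB.instance Definition _ := gen_choiceMixin fock.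
HB.instance Definition _ := GRing.isZmodule.Build fock fockDA fockDC fock0D fockND.

Fact fockZA a b (u : fock) : fockZ a (fockZ b u) = fockZ (a * b) u.
Proof. by apply/fock_inj/funext => x /=; rewrite mulrA. Qed.

Fact fock1Z : left_id 1 fockZ.
Proof. by move=> u; apply/fock_inj/funext => x /=; rewrite mul1r. Qed.

Fact fockZDr : right_distributive fockZ +%R.
Proof. by move=> a u v; apply/fock_inj/funext => x /=; rewrite mulrDr. Qed.

Fact fockZDl (u : fock) : {morph fockZ^~ u : a b / a + b}.
Proof. by move=> a b; apply/fock_inj/funext => x /=; rewrite mulrDl. Qed.

HB.instance Definition _ :=
  GRing.Zmodule_isLmodule.Build R[i] fock fockZA fock1Z fockZDr fockZDl.

Definition fnorm (u : fock) : R := l2norm u.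

Fact fnormD (u v : fock) : (fnorm (u + v))%:C <= (fnorm u)%:C + (fnorm v)%:C.
Proof.
rewrite -rmorphD lecR.
case: (fockP u) (fockP v) => [_ us] [_ vs].
apply: (proj2 (@l2norm_le _ _ _ (l2norm u + l2norm v) _ _)).
  by rewrite addr_ge0 ?sqrtr_ge0.
move=> n; apply: (le_trans (series_hnormsqD _ _ _)).
by apply: lerD; apply: series_le_l2norm.
Qed.

Fact fnormZ (a : R[i]) (u : fock) :
  (fnorm (a *: u))%:C = `|a| * (fnorm u)%:C.
Proof.
case: (fockP u) => _ us.
have -> : `|a| = (Normc.normc a)%:C by case: a => x y; rewrite normc_def.
rewrite -rmorphM; congr (_%:C); rewrite /fnorm /l2norm.
rewrite series_hnormsqZ limM//; last exact: is_cvg_cst.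
by rewrite lim_cst// sqrtrM ?sqr_ge0// sqrtr_sqr ger0_norm ?normc_ge0.
Qed.

Fact fnorm_eq0 (u : fock) : (fnorm u)%:C = 0 :> R[i] -> u = 0.
Proof.
case: (fockP u) => _ us [u0]; apply/fock_inj/funext => w /=.
apply: Normc.eq0_normc; apply/eqP; rewrite -sqrf_eq0; apply/eqP.
have := series_le_l2norm (size w).+1 us.
rewrite [l2norm u]u0 => s0.
have {s0} : series (fun n => hnormsq n u) (size w).+1 <= 0.
  by rewrite leNgt -sqrtr_gt0 -leNgt.
rewrite seriesSr => s0.
have h0 : hnormsq (size w) u <= 0.
  apply: le_trans s0; rewrite lerDr; apply: sumr_ge0 => k _.
  exact: hnormsq_ge0.
have : Normc.normc (fock_val u w) ^+ 2 <= hnormsq (size w) u.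
  rewrite /hnormsq (bigD1 (in_tuple w))//= lerDl.
  by apply: sumr_ge0 => v _; apply: sqr_ge0.
by move=> /le_trans/(_ h0) ?; apply/eqP; rewrite eq_le sqr_ge0 andbT.
Qed.

HB.instance Definition _ :=
  Lmodule_isNormed.Build R[i] fock fnormD fnormZ fnorm_eq0.

Definition fdot (u v : fock) : R[i] :=
  limn (series (fun n => complex.Re (hdot n u v))) +i*
  limn (series (fun n => complex.Im (hdot n u v))).

Definition creation_coefs (i : 'I_N) (f : coefs R N) : coefs R N :=
  fun w => Hproj q (size w) (component (size w) (tensor (monom R [:: i]) f)) w.

Lemma Hproj_Hsub n (f : coefs R N) : Hsub q n (Hproj q n f).
Proof. by rewrite /Hproj; case: xgetP => [g _ []//|_]; apply: Hsub0. Qed.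

Lemma component_creation i f n : component n (creation_coefs i f) =
  Hproj q n (component n (tensor (monom R [:: i]) f)).
Proof.
apply/funext => w; rewrite /component /creation_coefs.
case: eqP => [->//|/eqP nw].
by have [/(_ _ nw)->] := Hproj_Hsub n (component n (tensor (monom R [:: i]) f)).
Qed.

Lemma hnormsq_hdot n f : (@hnormsq R N n f)%:C = hdot n f f.
Proof.
rewrite /hnormsq rmorph_sum /=; apply: eq_bigr => w _.
by rewrite -sqr_normc normc_def rmorphXn; case: (f w).
Qed.

Lemma hnormsq_Hproj n (f : coefs R N) : hnormsq n (Hproj q n f) <= hnormsq n f.
Proof.
rewrite /Hproj; case: xgetP => [g _ [gH gf]|_]; last first.
  by rewrite {1}/hnormsq big1 ?hnormsq_ge0// => w _; rewrite Normc.normc0 expr0n.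
set h := (fun w => f w - g w) in gf.
suff -> : hnormsq n f = hnormsq n g + hnormsq n h.
  by rewrite lerDl hnormsq_ge0.
have hg : hdot n h g = 0 by exact: gf.
have gh : hdot n g h = 0.
  rewrite -[RHS]conjc0 -hg /hdot rmorph_sum /=; apply: eq_bigr => w _.
  by rewrite rmorphM /= conjcK mulrC.
apply: (@complexI R); rewrite rmorphD /= !hnormsq_hdot.
have -> : hdot n f f = hdot n g g + hdot n h h + (hdot n g h + hdot n h g).
  rewrite /hdot -!big_split /=; apply: eq_bigr => w _.
  by rewrite /h rmorphB /=; ring.
by rewrite gh hg !addr0.
Qed.

Lemma tensor_monom1 (i : 'I_N) (f : coefs R N) (w : word N) :
  tensor (monom R [:: i]) f w =
  if w is j :: v then (j == i)%:R * f v else 0.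
Proof.
rewrite /tensor; case: w => [|j v] /=.
  by rewrite big_ord1 /monom /= mul0r.
rewrite big_ord_recl /= {1}/monom /= mul0r add0r.
rewrite big_ord_recl /= take0 drop0 big1 ?addr0; last first.
  move=> k _; rewrite /monom /= eqseq_cons.
  case: v k => [|a v] k; first by case: k.
  by rewrite /= andbF mul0r.
by rewrite /monom /= eqseq_cons andbT.
Qed.

Lemma hnormsq_tensor (i : 'I_N) (f : coefs R N) n :
  hnormsq n.+1 (tensor (monom R [:: i]) f) = hnormsq n f.
Proof.
rewrite /hnormsq.
rewrite (bigID (fun w : n.+1.-tuple 'I_N => thead w == i)) /= addrC big1.
  rewrite add0r.
  rewrite (reindex (fun v : n.-tuple 'I_N => [tuple of i :: v])) /=; last first.
    exists (fun w : n.+1.-tuple 'I_N => [tuple of behead w] : n.-tuple 'I_N) => [v _|w].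
      by apply: val_inj.
    rewrite inE => /eqP <-; case/tupleP: w => j v; apply: val_inj.
    by rewrite /= theadE.
  apply: eq_big => [v|v _]; first by rewrite theadE eqxx.
  by rewrite tensor_monom1 /= eqxx mul1r.
move=> w; case/tupleP: w => j v; rewrite theadE => ji.
by rewrite tensor_monom1 /= (negbTE ji) mul0r Normc.normc0 expr0n.
Qed.

Lemma eq_hnormsq n (f g : coefs R N) :
  (forall w : word N, size w = n -> f w = g w) -> hnormsq n f = hnormsq n g.
Proof. by move=> fg; apply: eq_bigr => w _; rewrite fg// size_tuple. Qed.

Fact creation_fock i (u : fock) : fock_pred (creation_coefs i u).
Proof.
split=> [n|]; first by rewrite component_creation; apply: Hproj_Hsub.
have [_ us] := fockP u.
have le n : hnormsq n (creation_coefs i u) <=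
            hnormsq n (tensor (monom R [:: i]) u).
  rewrite (@eq_hnormsq _ _ (component n (creation_coefs i u))); last first.
    by move=> w <-; rewrite /component eqxx.
  rewrite component_creation (le_trans (hnormsq_Hproj _ _))//.
  rewrite le_eqVlt (@eq_hnormsq _ _ (tensor (monom R [:: i]) u)) ?eqxx//.
  by move=> w <-; rewrite /component eqxx.
apply: (@square_summableP _ _ _ (limn (series (fun n => hnormsq n u)))) => n.
apply: (@le_trans _ _
  (series (fun n => hnormsq n (tensor (monom R [:: i]) u)) n.+1)).
  apply: (le_trans (ler_sum _ (fun k _ => le k))).
  by rewrite seriesSr lerDl hnormsq_ge0.
rewrite /series /= big_nat_recl//= {1}/hnormsq big1 ?add0r; last first.
  by move=> w _; rewrite tuple0 tensor_monom1 Normc.normc0 expr0n.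
under eq_bigr do rewrite hnormsq_tensor.
exact: nondecreasing_cvgn_le (@series_hnormsq_nd _ _ u) us n.
Qed.

Definition creation (i : 'I_N) (u : fock) : fock := Fock (creation_fock i u).

Definition op := fock -> fock.

Definition bounded_op (x : op) :=
  linear x /\ exists M : R, forall u, fnorm (x u) <= M * fnorm u.

Definition op_norm (x : op) : R :=
  inf [set M | 0 <= M /\ forall u, fnorm (x u) <= M * fnorm u].

Definition compact_op (x : op) :=
  linear x /\ precompact (x @` [set u | fnorm u <= 1]).

Definition adjoint (x y : op) := forall u v, fdot (x u) v = fdot u (y v).

(* Bounded operators have adjoints by Riesz' theorem, so the closure condition
   [M x -> adjoint x y -> M y] does apply to every element of [M]. *)
Definition is_cstar_op_subalg (M : set op) :=
  [/\ M `<=` bounded_op,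
      M idfun,
      forall (a : R[i]) x y, M x -> M y -> M ((a \*: x) \+ y),
      forall x y, M x -> M y -> M (x \o y) &
      (forall x y, M x -> adjoint x y -> M y) /\
      (forall x, bounded_op x ->
        (forall e : R, 0 < e -> exists2 y, M y & op_norm (x \- y) <= e) ->
        M x)].

Definition toeplitz : set op :=
  smallest is_cstar_op_subalg (range creation).

(* [O] is the quotient of [toeplitz] by the ideal of compact operators, with the
   quotient norm, and [quo] is the quotient map; the values of [quo] outside of
   [toeplitz] are irrelevant. *)
Definition is_cuntz_pimsner (O : cstarAlgType R) (quo : op -> O) :=
  [/\ quo idfun = 1,
      [/\ forall (a : R[i]) x y, toeplitz x -> toeplitz y ->
            quo ((a \*: x) \+ y) = a *: quo x + quo y,
          forall x y, toeplitz x -> toeplitz y ->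
            quo (x \o y) = quo x * quo y &
          forall x y, toeplitz x -> adjoint x y -> quo y = star (quo x)],
      quo @` toeplitz = [set: O],
      forall x, toeplitz x -> (quo x = 0 <-> compact_op x) &
      forall x, toeplitz x -> cnorm (quo x) =
        inf [set op_norm (x \- k) | k in toeplitz `&` compact_op]].

End Fock.

Arguments creation {R N} q i u.

Section Relations.
Variables (R : realType) (N : nat) (q : R).

Definition cp_rel_ge1 (A : cstarAlgType R) (s : 'I_N -> A) :=
  [/\ \sum_i s i * star (s i) = 1,
      forall i j : 'I_N, (i < j)%N -> s i * s j = q%:C *: (s j * s i),
      forall i j : 'I_N, i != j ->
        star (s i) * s j = (q^-1)%:C *: (s j * star (s i)) &
      forall i : 'I_N, star (s i) * s i = s i * star (s i) +
        (1 - q ^- 2)%:C *: \sum_(j < N | (i < j)%N) s j * star (s j)].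

Definition cp_rel_le1 (A : cstarAlgType R) (s : 'I_N -> A) :=
  [/\ \sum_i s i * star (s i) = 1,
      forall i j : 'I_N, (i < j)%N -> s i * s j = q%:C *: (s j * s i),
      forall i j : 'I_N, i != j ->
        star (s i) * s j = q%:C *: (s j * star (s i)) &
      forall i : 'I_N, star (s i) * s i = s i * star (s i) +
        (1 - q ^+ 2)%:C *: \sum_(j < N | (j < i)%N) s j * star (s j)].

End Relations.

(* Main.v *)
(* Let L_i be the adjoint of S_i: (L_i f)(w) = f(i w).  On degree n, with
   [n] = 1 + q^-2 + ... + q^-2(n-1), one has the exact relations
   L_i S_j = q^-1 [n]/[n+1] S_j L_i for i <> j and
   [n+1] L_j S_j = [n] (S_j L_j + (1 - q^-2) sum_(k > j) S_k L_k) + q^-2n,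
   whose coefficients converge as n grows, so that the relations hold modulo
   compact operators.  They show that the normally ordered products
   s_al s_be^* span a dense star subalgebra, on which any solution b defines a
   homomorphism as soon as |sum c_t b_al b_be^*| <= 2 |sum c_t s_al s_be^*|.
   For this, sum over the words of length in a window [M, M+L) the entries of
   the matrix of an operator T against b_w b_v^*, and divide by L.  Because
   sum_w b_w b_w^* = 1 in each degree, the result is bounded by 2 |T|; for
   T = S_al S_be^* it is b_al b_be^* up to an error O(1/L); and for compact T
   it tends to 0 as M grows.  The bound on this sum rests on the positivity of
   star x * x in C*-algebras, which is proved from the C*-identity by
   elementary norm estimates. *)

(* Everything is compared through coefficient families: on H_n the map sending f to the sum of the
   f(w) b_w turns S_i into left multiplication by b_i, by the same recursion in the first letter
   that makes S_i the adjoint of L_i. This is why the averaged matrix of S_al S_be^* returns b_al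
   b_be^*. A solution b lives in an abstract C*-algebra, where no vectors are at hand to test
   inequalities; operator bounds on the Fock side therefore enter as bounds on scalar forms, whose
   variables are then replaced by algebra elements. The constant 2 comes from treating self-adjoint
   and skew-adjoint parts separately; it is harmless, because the bound serves only to extend the
   correspondence by continuity. The coefficient q^-2n/[n+1] tends to 0 for q >= 1 and to 1 - q^2
   for q <= 1. In the second case it leaves the scalar 1 - q^2, and expanding the unit as the sum of
   the s_k s_k^* cancels the terms with k > j and creates those with k < j: hence the two
   presentations. *)
From HB Require Import structures.
Require Import Defs.
From mathcomp Require Import all_boot all_order all_algebra.
From mathcomp Require Import complex.
From mathcomp Require Import all_classical all_reals all_analysis.
From mathcomp Require Import ring lra zify.
Set Implicit Arguments.
Unset Strict Implicit.
Unset Printing Implicit Defensive.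
Import Order.TTheory GRing.Theory Num.Theory numFieldNormedType.Exports.
Local Open Scope classical_set_scope.
Local Open Scope complex_scope.
Local Open Scope ring_scope.

(** * Identities in commutative groups *)

(* Terms over a commutative group, for a reflective decision procedure: a
   noncommutative ring identity is checked on its expanded monomials. *)
Inductive zterm := ZVar of nat | ZZero | ZAdd of zterm & zterm | ZOpp of zterm.

Fixpoint zterm_eval (V : zmodType) (env : seq V) (t : zterm) : V :=
  match t with
  | ZVar n => env`_n
  | ZZero => 0
  | ZAdd a b => zterm_eval env a + zterm_eval env b
  | ZOpp a => - zterm_eval env a
  end.

Fixpoint zterm_coef (t : zterm) (n : nat) : int :=
  match t with
  | ZVar m => if m == n then 1 else 0
  | ZZero => 0
  | ZAdd a b => zterm_coef a n + zterm_coef b n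
  | ZOpp a => - zterm_coef a n
  end.

Lemma zterm_evalE (V : zmodType) (env : seq V) t :
  zterm_eval env t = \sum_(i < size env) env`_i *~ zterm_coef t i.
Proof.
elim: t => [n||a IHa b IHb|a IHa] /=.
- have [ns|sn] := ltnP n (size env).
    rewrite (bigD1 (Ordinal ns))//= eqxx mulr1z big1 ?addr0// => i ni.
    by rewrite ifN ?mulr0z//; apply: contra ni => /eqP E; apply/eqP/val_inj.
  rewrite nth_default// big1// => i _.
  by rewrite ifN ?mulr0z//; apply: contraL (ltn_ord i) => /eqP <-; rewrite -leqNgt.
- by rewrite big1.
- by rewrite IHa IHb -big_split; apply: eq_bigr => i _; rewrite mulrzDr.
- by rewrite IHa -sumrN; apply: eq_bigr => i _; rewrite mulrNz.
Qed.

Lemma zterm_eq (V : zmodType) (env : seq V) t u :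
  all (fun i => eq_op (zterm_coef t i) (zterm_coef u i)) (iota 0 (size env)) ->
  zterm_eval env t = zterm_eval env u.
Proof.
move=> /allP H; rewrite !zterm_evalE; apply: eq_bigr => i _.
by rewrite (eqP (H i _))// mem_iota /= add0n.
Qed.

(* Occurrences of one monomial may carry different instance paths. *)
Ltac zsame x y :=
  match constr:((x, y)) with
  | (?a, ?a) => idtac
  | (@GRing.mul _ ?a ?b, @GRing.mul _ ?c ?d) => zsame a c; zsame b d
  | (@GRing.scale _ _ ?a ?b, @GRing.scale _ _ ?c ?d) =>
    zsame b d; first [zsame a c | unify a c]
  | (@GRing.exp _ ?a ?n, @GRing.exp _ ?b ?n) => zsame a b
  | (@GRing.one _, @GRing.one _) => idtac
  end.
Ltac zatoms l e :=
  let rec add l x := match l with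
    | nil => constr:(cons x nil)
    | cons ?y _ => let _ := match tt with _ => zsame x y end in l
    | cons ?y ?k => let r := add k x in constr:(cons y r) end in
  match e with
  | @Algebra.add _ ?a ?b => let l1 := zatoms l a in zatoms l1 b
  | @Algebra.opp _ ?a => zatoms l a
  | @Algebra.zero _ => l
  | _ => add l e
  end.
Ltac zreify l e :=
  let rec idx l x := match l with
    | cons ?y _ => let _ := match tt with _ => zsame x y end in constr:(O)
    | cons _ ?k => let r := idx k x in constr:(S r) end in
  match e with
  | @Algebra.add _ ?a ?b =>
    let r := zreify l a in let s := zreify l b in constr:(ZAdd r s)
  | @Algebra.opp _ ?a => let r := zreify l a in constr:(ZOpp r)
  | @Algebra.zero _ => constr:(ZZero)
  | _ => let r := idx l e in constr:(ZVar r)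
  end.
Ltac zmod := intros;
  match goal with |- @eq ?V ?a ?b =>
    let l0 := zatoms (@nil V) a in let l := zatoms l0 b in
    let r := zreify l a in let s := zreify l b in
    exact (@zterm_eq _ l r s isT)
  end.

(** * C*-algebras: norm, square roots, positivity *)

Section RealGrowth.
Variable R : realType.

Lemma bernoulli_le (d : R) n : 0 <= d -> 1 + n%:R * d <= (1 + d) ^+ n.
Proof.
move=> d0; elim: n => [|n IH]; first by rewrite mul0r addr0 expr0.
rewrite exprS; apply: le_trans (ler_wpM2l _ IH); last by rewrite addr_ge0.
rewrite -natr1 -subr_ge0.
have -> : (1 + d) * (1 + n%:R * d) - (1 + (n%:R + 1) * d) = n%:R * d ^+ 2.
  by ring.
by rewrite mulr_ge0// sqr_ge0.
Qed.

(** A linear factor cannot make up for exponential growth. Only exponents that are powers of 2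
    occur, because those are the ones for which the C*-identity computes the norm of a power of a
    self-adjoint element. *)
Lemma le_of_pow2_growth (x t c : R) : 0 <= c -> 0 < t ->
  (forall k, x ^+ (2 * 2 ^ k) <= c * ((2 * 2 ^ k)%:R + 1) * t ^+ (2 * 2 ^ k)) ->
  x <= t.
Proof.
move=> c0 t0 H; rewrite leNgt; apply/negP => tx.
pose d := x / t - 1.
have d0 : 0 < d by rewrite subr_gt0 ltr_pdivlMr// mul1r.
(* With j = 2^k this gives c (2 j + 1) <= 3 c j < (j d)^2. Bernoulli is applied to the exponent j
   and then squared, since without squaring it would grow only linearly, like the left-hand side. *)
have [k Hk] : exists k : nat, 3 * c / d ^+ 2 < k%:R.
  exists (Num.truncn (3 * c / d ^+ 2)).+1; apply: truncnS_gt.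
have {}Hk : 3 * c / d ^+ 2 < (2 ^ k)%:R.
  by apply: (lt_le_trans Hk); rewrite ler_nat ltnW// ltn_expl.
set j := (2 ^ k)%N in Hk; have := H k; rewrite -/j => Hj.
have j1 : 1 <= j%:R :> R by rewrite ler1n expn_gt0.
have xE : x = t * (1 + d) by rewrite /d; field; rewrite gt_eqF.
move: Hj; rewrite xE exprMn mulrC ler_pM2r ?exprn_gt0// mulnC exprM.
apply/negP; rewrite -ltNge.
have B := bernoulli_le j (ltW d0).
have B2 : (1 + j%:R * d) ^+ 2 <= ((1 + d) ^+ j) ^+ 2.
  by rewrite ler_sqr ?nnegrE// ?(le_trans _ B)// addr_ge0// mulr_ge0// ltW.
apply: lt_le_trans B2; move: Hk; rewrite ltr_pdivrMr ?exprn_gt0// => Hk.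
rewrite natrM.
have : 3 * c * j%:R < j%:R * d ^+ 2 * j%:R by rewrite ltr_pM2r// (lt_le_trans _ j1).
have : c <= c * j%:R by rewrite ler_peMr.
have : 0 <= j%:R * d by rewrite mulr_ge0// ltW.
nra.
Qed.

End RealGrowth.

Section ComplexScalars.
Variable R : realType.
Implicit Types (a b : R[i]) (t s : R).

Lemma real_complexD t s : (t + s)%:C = t%:C + s%:C :> R[i].
Proof. exact: rmorphD. Qed.

Lemma real_complexM t s : (t * s)%:C = t%:C * s%:C :> R[i].
Proof. exact: rmorphM. Qed.

Lemma cconjD a b : (a + b)^* = a^* + b^*.
Proof. exact: rmorphD. Qed.

Lemma cconjN a : (- a)^* = - a^*.
Proof. exact: rmorphN. Qed.

Lemma cconjM a b : (a * b)^* = a^* * b^*.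
Proof. exact: rmorphM. Qed.

Lemma cconjR t : (t%:C)^* = t%:C :> R[i].
Proof. exact: conjc_real. Qed.

Lemma cconj_sum (I : Type) (r : seq I) (P : pred I) (F : I -> R[i]) :
  (\sum_(i <- r | P i) F i)^* = \sum_(i <- r | P i) (F i)^*.
Proof. exact: rmorph_sum. Qed.

Lemma normc_real t : Normc.normc t%:C = `|t|.
Proof. by rewrite /= expr0n addr0 sqrtr_sqr. Qed.

End ComplexScalars.

Section CStarBasics.
Variables (R : realType) (A : cstarAlgType R).
Implicit Types (x y h : A) (t s : R).

Lemma cnorm0 : cnorm (0 : A) = 0.
Proof. by rewrite -(scale0r (0 : A)) cnormZ Normc.normc0 mul0r. Qed.

Lemma cnormZr t x : cnorm (t%:C *: x) = `|t| * cnorm x.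
Proof. by rewrite cnormZ normc_real. Qed.

Lemma cnormN x : cnorm (- x) = cnorm x.
Proof.
by rewrite -scaleN1r -(rmorphN1 (real_complex R)) cnormZr normrN normr1 mul1r.
Qed.

Lemma cnormB x y : cnorm (x - y) <= cnorm x + cnorm y.
Proof. by rewrite -(cnormN y) cnormD. Qed.

Lemma cnormC x y : cnorm (x - y) = cnorm (y - x).
Proof. by rewrite -cnormN opprB. Qed.

Lemma cnorm_ge0 x : 0 <= cnorm x.
Proof.
have := cnormB x x; rewrite subrr cnorm0 -mulr2n pmulrn_lge0//.
Qed.

Lemma cnorm_sum (I : Type) (r : seq I) (P : pred I) (F : I -> A) :
  cnorm (\sum_(i <- r | P i) F i) <= \sum_(i <- r | P i) cnorm (F i).
Proof.
elim/big_ind2: _ => [|x a y b xa yb|//]; first by rewrite cnorm0.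
by apply: le_trans (cnormD _ _) (lerD xa yb).
Qed.

Lemma star0 : star (0 : A) = 0.
Proof. by apply: (addrI (star 0)); rewrite -starD !addr0. Qed.

Lemma starN x : star (- x) = - star x.
Proof. by apply: (addrI (star x)); rewrite -starD !subrr star0. Qed.

Lemma starB x y : star (x - y) = star x - star y.
Proof. by rewrite starD starN. Qed.

Lemma starZr t x : star (t%:C *: x) = t%:C *: star x.
Proof. by rewrite starZ; congr (_ *: _); exact: conjc_real. Qed.

Lemma star1 : star (1 : A) = 1.
Proof. by rewrite -[LHS]mul1r -[X in X * _]starK -starM mul1r starK. Qed.

Lemma star_sum (I : Type) (r : seq I) (P : pred I) (F : I -> A) :
  star (\sum_(i <- r | P i) F i) = \sum_(i <- r | P i) star (F i).
Proof. by apply: (big_morph star); [exact: starD | exact: star0]. Qed.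

Lemma starX x n : star (x ^+ n) = star x ^+ n.
Proof.
elim: n => [|n IH]; first by rewrite !expr0 star1.
by rewrite exprS exprSr starM IH.
Qed.

Lemma cnorm1 : cnorm (1 : A) = 1.
Proof.
have := cnorm_starM (1 : A); rewrite star1 mul1r => /esym/eqP.
rewrite expr2 -subr_eq0 -{3}[cnorm 1]mulr1 -mulrBr mulf_eq0 subr_eq0.
case/orP => /eqP// /cnorm_eq0 /eqP.
by rewrite oner_eq0.
Qed.

Lemma cnorm_star x : cnorm (star x) = cnorm x.
Proof.
suff le y : cnorm y <= cnorm (star y).
  by apply/eqP; rewrite eq_le le -{2}[x]starK le.
have := cnorm_ge0 y; rewrite le_eqVlt => /predU1P[<-|y0]; first exact: cnorm_ge0.
by rewrite -(ler_pM2r y0) -expr2 -cnorm_starM cnormM.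
Qed.

Lemma cnormA t : cnorm (t%:C%:A : A) = `|t|.
Proof. by rewrite cnormZr cnorm1 mulr1. Qed.

Lemma starA t : star (t%:C%:A : A) = t%:C%:A.
Proof. by rewrite starZr star1. Qed.

Lemma cnormX x n : cnorm (x ^+ n) <= cnorm x ^+ n.
Proof.
elim: n => [|n IH]; first by rewrite !expr0 cnorm1.
rewrite !exprS; apply: (le_trans (cnormM _ _)).
by apply: ler_wpM2l => //; exact: cnorm_ge0.
Qed.

Lemma cnorm_sqr h : star h = h -> cnorm (h * h) = cnorm h ^+ 2.
Proof. by move=> hh; rewrite -cnorm_starM hh. Qed.

Lemma cnorm_pow2 h k : star h = h -> cnorm (h ^+ (2 ^ k)) = cnorm h ^+ (2 ^ k).
Proof.
move=> hh; elim: k => [|k IH]; first by rewrite expn0 !expr1.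
rewrite expnS mulnC !exprM expr2 cnorm_sqr ?IH//.
by rewrite starX hh.
Qed.

Lemma cnorm_eps0 x (K : R) : (forall e, 0 < e -> cnorm x <= K * e) -> x = 0.
Proof.
move=> H; apply: cnorm_eq0; apply/eqP; rewrite eq_le cnorm_ge0 andbT.
have [K0|K0] := leP K 0.
  by apply: (le_trans (H _ ltr01)); rewrite mulr1.
apply/ler_addgt0Pl => e e0; rewrite addr0.
have := H (e / K); rewrite divr_gt0// => /(_ isT).
by rewrite mulrCA divff ?mulr1// gt_eqF.
Qed.

Lemma scale_halfD x : 2^-1%:C *: x + 2^-1%:C *: x = x.
Proof.
have E : 2^-1 + 2^-1 = 1 :> R by field.
by rewrite -scalerDl -rmorphD E scale1r.
Qed.

Lemma scalerMM (a b : R[i]) x y : (a *: x) * (b *: y) = (a * b) *: (x * y).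
Proof. by rewrite -scalerAl -scalerAr scalerA. Qed.

Lemma commA t x : GRing.comm x (t%:C%:A).
Proof. by rewrite /GRing.comm -scalerAr -scalerAl mulr1 mul1r. Qed.

Lemma cstar_geometric_limit (u : nat -> A) (C r : R) :
  0 <= r -> r < 1 -> (forall n, cnorm (u n.+1 - u n) <= C * r ^+ n) ->
  exists l, forall e, 0 < e -> exists n0, forall n, (n0 <= n)%N ->
    cnorm (u n - l) <= e.
Proof.
move=> r0 r1 H.
have C0 : 0 <= C.
  by have := H 0%N; rewrite expr0 mulr1; apply: le_trans; exact: cnorm_ge0.
(* The exact partial geometric sum is kept so that the induction closes with equality; [tele2] then
   drops the last factor. *)
have tele n k : cnorm (u (n + k)%N - u n) <= C * r ^+ n / (1 - r) * (1 - r ^+ k).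
  elim: k => [|k IH]; first by rewrite addn0 subrr cnorm0 expr0 subrr mulr0.
  rewrite addnS; have -> : u (n + k).+1 - u n = (u (n + k).+1 - u (n + k)%N) + (u (n + k)%N - u n).
    by rewrite addrA subrK.
  apply: (le_trans (cnormD _ _)); apply: (le_trans (lerD (H _) IH)).
  rewrite le_eqVlt; apply/orP; left; apply/eqP; rewrite exprD exprS.
  by field; rewrite subr_eq0 eq_sym lt_eqF.
have tele2 n k : cnorm (u (n + k)%N - u n) <= C / (1 - r) * r ^+ n.
  apply: (le_trans (tele n k)).
  have -> : C * r ^+ n / (1 - r) * (1 - r ^+ k) = C / (1 - r) * r ^+ n * (1 - r ^+ k) by ring.
  apply: ler_piMr; last by rewrite gerBl exprn_ge0.
  by rewrite mulr_ge0 ?exprn_ge0// divr_ge0// subr_ge0 ltW.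
have small e : 0 < e -> exists n0, forall n, (n0 <= n)%N ->
    C / (1 - r) * r ^+ n <= e.
  move=> e0.
  have : (fun n => C / (1 - r) * r ^+ n) @ \oo --> (0 : R).
    by rewrite -(mulr0 (C / (1 - r))); apply: cvgMr; apply: cvg_expr; rewrite ger0_norm.
  move/cvgrPdist_le => /(_ e e0)[n0 _ Hn]; exists n0 => n nn.
  by have := Hn n nn; rewrite sub0r normrN; apply: le_trans; exact: ler_norm.
have [|l ul] := cnorm_complete u.
  move=> e e0; have [n0 Hn0] := small (e / 2) (divr_gt0 e0 (ltr0Sn _ 1)).
  exists n0 => m n mn nn.
  have d k : (n0 <= k)%N -> cnorm (u k - u n0) <= e / 2.
    by move=> kn; rewrite -(subnKC kn); apply: le_trans (tele2 _ _) (Hn0 _ _).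
  have -> : u m - u n = (u m - u n0) - (u n - u n0).
    by rewrite opprB addrA subrK.
  apply: (le_trans (cnormB _ _)); rewrite [leRHS](splitr e).
  by apply: lerD; apply: d.
exists l => e e0; move/cvgrPdist_le: ul => /(_ e e0)[n0 _ Hn]; exists n0 => n nn.
by have := Hn n nn; rewrite sub0r normrN ger0_norm// cnorm_ge0.
Qed.

End CStarBasics.

Section SquareRoot.
Variables (R : realType) (A : cstarAlgType R).
Implicit Types (x y h : A) (t : R).

(* The fixed point of z |-> (g + z^2)/2 solves (1 - z)^2 = 1 - g. *)
Lemma sqrt_one_sub (g : A) (r : R) : star g = g -> cnorm g <= r -> r < 1 ->
  exists z, [/\ star z = z, (1 - z) * (1 - z) = 1 - g &
    forall x, GRing.comm x g -> GRing.comm x z].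
Proof.
move=> gg gr r1.
have r0 : 0 <= r := le_trans (cnorm_ge0 g) gr.
pose s := Num.sqrt (1 - r).
have s0 : 0 < s by rewrite sqrtr_gt0 subr_gt0.
have s2 : s * s = 1 - r by rewrite -expr2 sqr_sqrtr// subr_ge0 ltW.
have s1 : s <= 1.
  by rewrite -sqrtr1; apply: ler_wsqrtr; rewrite gerBl.
(* The smaller root of 2 rho = r + rho^2, so that [F] maps the ball of radius [rho] into itself and
   contracts it by the factor [rho] < 1. *)
pose rho := 1 - s.
have rho0 : 0 <= rho by rewrite subr_ge0.
have rho1 : rho < 1 by rewrite gtrBl.
pose F (z : A) := (2^-1)%:C *: (g + z * z).
pose u := fix u n := if n is n'.+1 then F (u n') else 0.
have h2 : `|2^-1| = 2^-1 :> R by rewrite ger0_norm// invr_ge0.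
have ub n : cnorm (u n) <= rho.
  elim: n => [|n IH]; first by rewrite cnorm0.
  rewrite /= cnormZr h2.
  have : cnorm (g + u n * u n) <= r + rho * rho.
    apply: (le_trans (cnormD _ _)); apply: lerD => //.
    apply: (le_trans (cnormM _ _)).
    by apply: ler_pM => //; exact: cnorm_ge0.
  have -> : r + rho * rho = 2 * rho by rewrite /rho; nra.
  by rewrite ler_pdivrMl.
have sqB (a b : A) : a * a - b * b = a * (a - b) + (a - b) * b.
  by rewrite mulrBr mulrBl addrA subrK.
have contr a b : cnorm a <= rho -> cnorm b <= rho ->
    cnorm (F a - F b) <= rho * cnorm (a - b).
  move=> ar br; rewrite /F -scalerBr cnormZr h2 opprD addrACA subrr add0r sqB.
  rewrite ler_pdivrMl//.
  have -> : 2 * (rho * cnorm (a - b)) = rho * cnorm (a - b) + cnorm (a - b) * rho by ring.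
  apply: (le_trans (cnormD _ _)); apply: lerD; apply: (le_trans (cnormM _ _)).
    by rewrite ler_wpM2r// cnorm_ge0.
  by rewrite ler_wpM2l// cnorm_ge0.
have [|z zu] := @cstar_geometric_limit R A u (cnorm (u 1)) rho rho0 rho1.
  elim=> [|n IH]; first by rewrite expr0 mulr1 /= subr0.
  apply: (@le_trans _ _ (rho * cnorm (u n.+1 - u n))); first exact: (contr _ _ (ub n.+1) (ub n)).
  by rewrite exprS mulrCA ler_wpM2l.
have zb : cnorm z <= rho.
  apply/ler_addgt0Pl => e e0; have [n0 /(_ n0 (leqnn _)) H] := zu _ e0.
  rewrite addrC; have -> : z = u n0 - (u n0 - z) by rewrite opprB addrC subrK.
  exact: le_trans (cnormB _ _) (lerD (ub _) H).
(* Lipschitz identities pass from the iterates to the limit; this yields both self-adjointness and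
   commutation. *)
have uz (P : A -> A) : (exists2 C, 0 <= C & forall x y, cnorm (P x - P y) <= C * cnorm (x - y)) -> (forall n, P (u n) = 0) -> P z = 0.
  move=> [C C0 PC] P0; apply: (@cnorm_eps0 _ _ _ C) => e e0.
  have [n0 /(_ n0 (leqnn _)) H] := zu _ e0.
  have -> : P z = P z - P (u n0) by rewrite P0 subr0.
  apply: (le_trans (PC _ _)); apply: ler_wpM2l => //.
  by rewrite cnormC.
exists z.
have fz : z = F z.
  apply/eqP; rewrite -subr_eq0; apply/eqP; apply: (@cnorm_eps0 _ _ _ 2) => e e0.
  have [n0 H] := zu _ e0.
  have -> : z - F z = (F (u n0) - F z) - (u n0.+1 - z) by rewrite -[u n0.+1]/(F (u n0)); zmod.
  apply: (le_trans (cnormB _ _)); rewrite mulr2n mulrDl !mul1r; apply: lerD; last first.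
    by apply: H.
  apply: (le_trans (contr _ _ (ub _) zb)); rewrite -[leRHS]mul1r.
  by apply: ler_pM => //; [exact: cnorm_ge0 | exact: ltW | exact: H].
split.
- apply/eqP; rewrite -subr_eq0; apply/eqP.
  apply: (uz (fun x => star x - x)).
    exists 2 => // x y; have -> : star x - x - (star y - y) = star (x - y) - (x - y).
      by rewrite starB; zmod.
    apply: (le_trans (cnormB _ _)).
    by rewrite cnorm_star mulr2n mulrDl !mul1r.
  elim=> [|n IH]; first by rewrite /= star0 subr0.
  move/eqP: IH; rewrite subr_eq0 => /eqP IH.
  by rewrite /= /F starZr starD starM gg IH subrr.
- have : z + z = g + z * z.
    by rewrite {1 2}fz scale_halfD.
  move=> H; rewrite mulrBl mul1r mulrBr mulr1 opprB.
  apply/eqP; rewrite -subr_eq0; apply/eqP.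
  have -> : 1 - z + (z * z - z) - (1 - g) = (g + z * z) - (z + z).
    by zmod.
  by rewrite H subrr.
- move=> x xg; apply/eqP; rewrite -subr_eq0; apply/eqP.
  apply: (uz (fun y => x * y - y * x)).
    exists (2 * cnorm x); first by rewrite mulr_ge0// cnorm_ge0.
    move=> a b; have -> : x * a - a * x - (x * b - b * x) = x * (a - b) - (a - b) * x.
      by rewrite mulrBr mulrBl; zmod.
    apply: (le_trans (cnormB _ _)).
    have -> : 2 * cnorm x * cnorm (a - b) = cnorm x * cnorm (a - b) + cnorm (a - b) * cnorm x by ring.
    by apply: lerD; apply: (le_trans (cnormM _ _)).
  elim=> [|n IH]; first by rewrite /= mulr0 mul0r subr0.
  move/eqP: IH; rewrite subr_eq0 => /eqP IH; apply/eqP; rewrite subr_eq0; apply/eqP.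
  rewrite /= /F -scalerAl -scalerAr mulrDl mulrDr; congr (_ *: (_ + _)); first by [].
  by rewrite mulrA IH -mulrA IH mulrA.
Qed.

End SquareRoot.

(** * The positive cone, described by norms *)

Section CStarPositivity.
Variables (R : realType) (A : cstarAlgType R).
Implicit Types (x y h g k l : A) (t e : R).

(* h + ik is a multiple of a unitary element. *)
Lemma cnorm_le_of_sum_sqr (h k : A) t : star h = h -> star k = k ->
  GRing.comm h k -> 0 <= t -> h * h + k * k = (t ^+ 2)%:C%:A -> cnorm h <= t.
Proof.
move=> hh kk hk t0 hkt; pose c : R[i] := 0 +i* 1.
have cc : c * c = - 1 by rewrite /c; simpc.
have cconj : c^* = - c by rewrite /c; simpc.
pose u := h + c *: k.
have su : star u = h - c *: k 
  by rewrite /u starD starZ hh kk -scaleNr; congr (_ + _ *: _); exact: cconj.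
have uu : star u * u = (t ^+ 2)%:C%:A.
  rewrite su /u mulrDl !mulrDr !mulNr -!scalerAl -!scalerAr scalerA cc hk.
  rewrite scaleN1r opprK -hkt.
  by zmod.
have nu : cnorm u = t.
  apply/eqP; rewrite -(@eqrXn2 _ 2)// ?cnorm_ge0// -cnorm_starM uu cnormA.
  by rewrite ger0_norm// sqr_ge0.
have : cnorm (h + h) <= t + t.
  have -> : h + h = star u + u by rewrite su /u; zmod.
  by apply: (le_trans (cnormD _ _)); rewrite cnorm_star nu.
rewrite -[X in _ -> cnorm X <= _]scale_halfD -scalerDr cnormZr ger0_norm ?invr_ge0// ler_pdivrMl//; lra.
Qed.

(** Scaling by t reduces to [sqrt_one_sub]. The last clause takes the place of functional calculus:
    it is what makes square roots of commuting elements commute. The strict inequality forces h to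
    be invertible, so positive elements are later shifted by a small scalar first. *)
Lemma cstar_sqrt h t : star h = h -> cnorm (t%:C%:A - h) < t ->
  exists k, [/\ star k = k, k * k = h & forall x, GRing.comm x h -> GRing.comm x k].
Proof.
move=> hh ht; have t0 : 0 < t := le_lt_trans (cnorm_ge0 _) ht.
pose g := 1 - t^-1%:C *: h.
have ti : t^-1%:C * t%:C = 1 :> R[i] by rewrite -real_complexM mulVf ?gt_eqF.
have gE : g = t^-1%:C *: (t%:C%:A - h) by rewrite scalerBr scalerA ti scale1r.
have gg : star g = g by rewrite /g starB star1 starZr hh.
have gn : cnorm g < 1.
  by rewrite gE cnormZr ger0_norm ?invr_ge0 ?ltW// ltr_pdivrMl// mulr1.
have [z [zz z2 zc]] := sqrt_one_sub gg (lexx _) gn.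
exists ((Num.sqrt t)%:C *: (1 - z)); split.
- by rewrite starZr starB star1 zz.
- rewrite -scalerAl -scalerAr scalerA z2 -real_complexM -expr2 sqr_sqrtr ?ltW//.
  rewrite /g opprB [1 + _]addrC subrK scalerA mulrC.
  by rewrite -real_complexM mulVf ?gt_eqF// scale1r.
- move=> x xh; have xg : GRing.comm x g.
    by apply: commrB; [exact: commr1 | rewrite /GRing.comm -scalerAr -scalerAl xh].
  rewrite /GRing.comm -scalerAr -scalerAl; congr (_ *: _).
  by apply: commrB; [exact: commr1 | exact: zc].
Qed.

(** For self-adjoint h the inequality says that the spectrum lies in [0, 2t]; in this form
    positivity needs no spectral theory, and sums are immediate. *)
Definition cpos h := star h = h /\ exists t, cnorm (t%:C%:A - h) <= t.

(** If l is a square root of t - k^2, then l^2 + k^2 = t with l and k commuting, so the norm of l^2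
    is at most t. *)
Lemma cnorm_sub_sqr k t : star k = k -> cnorm k ^+ 2 <= t ->
  cnorm (t%:C%:A - k * k) <= t.
Proof.
move=> kk kt; apply/ler_addgt0Pl => e e0.
(* Half of e makes the hypothesis of [cstar_sqrt] strict; the other half pays for going back from T
   to t. *)
pose T := t + e / 2.
have e20 : 0 < e / 2 by rewrite divr_gt0.
have T0 : 0 <= T.
  by rewrite addr_ge0 ?(ltW e20)//; apply: le_trans kt; rewrite sqr_ge0.
have kkT : cnorm (T%:C%:A - (T%:C%:A - k * k)) < T.
  rewrite opprB addrC subrK cnorm_sqr//; apply: (le_lt_trans kt).
  by rewrite ltrDl.
have [|l [ll l2 lc]] := cstar_sqrt _ kkT.
  by rewrite starB starA starM kk.
have kl : GRing.comm k l.
  apply: lc; apply: commrB; first exact: commA.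
  by rewrite /GRing.comm mulrA.
have lT : cnorm l <= Num.sqrt T.
  apply: (@cnorm_le_of_sum_sqr l k) => //.
  by rewrite l2 sqr_sqrtr// subrK.
have -> : t%:C%:A - k * k = (T%:C%:A - k * k) - (e / 2)%:C%:A.
  by rewrite /T real_complexD scalerDl; zmod.
apply: (le_trans (cnormB _ _)); rewrite cnormA ger0_norm ?(ltW e20)//.
rewrite -l2 cnorm_sqr//.
have : cnorm l ^+ 2 <= T.
  rewrite -[leRHS](sqr_sqrtr T0) ler_sqr ?nnegrE ?cnorm_ge0// sqrtr_ge0//.
rewrite /T; lra.
Qed.

Lemma cpos_sqr k : star k = k -> cpos (k * k).
Proof.
move=> kk; split; first by rewrite starM kk.
by exists (cnorm k ^+ 2); apply: cnorm_sub_sqr.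
Qed.

Lemma cpos_sqrt h e : cpos h -> 0 < e ->
  exists k, [/\ star k = k, k * k = h + e%:C%:A &
    forall x, GRing.comm x h -> GRing.comm x k].
Proof.
move=> [hh [t ht]] e0.
have H : cnorm ((t + e)%:C%:A - (h + e%:C%:A)) < t + e.
  rewrite real_complexD scalerDl; have -> : t%:C%:A + e%:C%:A - (h + e%:C%:A) = t%:C%:A - h :> A by zmod.
  by apply: (le_lt_trans ht); rewrite ltrDl.
have [|k [kk k2 kc]] := cstar_sqrt _ H; first by rewrite starD starA hh.
exists k; split=> // x xh; apply: kc; apply: commrD => //; exact: commA.
Qed.

(** The witness in [cpos] may be replaced by any upper bound of the norm. This makes the witness
    uniform in limits and turns positivity into a norm estimate. It follows by writing h + e/2 as a
    square. *)
Lemma cpos_norm_sub h t : cpos h -> cnorm h <= t -> cnorm (t%:C%:A - h) <= t.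
Proof.
move=> ph ht; apply/ler_addgt0Pl => e e0.
have e20 : 0 < e / 2 by rewrite divr_gt0.
have [k [kk k2 _]] := cpos_sqrt ph e20.
have : cnorm ((t + e / 2)%:C%:A - k * k) <= t + e / 2.
  apply: cnorm_sub_sqr => //; rewrite -cnorm_sqr// k2.
  by apply: (le_trans (cnormD _ _)); rewrite cnormA ger0_norm ?(ltW e20)// lerD2r.
rewrite k2 real_complexD scalerDl.
have -> : t%:C%:A + (e / 2)%:C%:A - (h + (e / 2)%:C%:A) = t%:C%:A - h :> A by zmod.
lra.
Qed.

Lemma cposD h g : cpos h -> cpos g -> cpos (h + g).
Proof.
move=> [hh [t ht]] [gg [s gs]]; split; first by rewrite starD hh gg.
exists (t + s); rewrite real_complexD scalerDl.
have -> : t%:C%:A + s%:C%:A - (h + g) = (t%:C%:A - h) + (s%:C%:A - g) :> A by zmod.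
by apply: (le_trans (cnormD _ _)); apply: lerD.
Qed.

Lemma cposZ h t : 0 <= t -> cpos h -> cpos (t%:C *: h).
Proof.
move=> t0 [hh [s hs]]; split; first by rewrite starZr hh.
exists (t * s); rewrite real_complexM -scalerA -scalerBr cnormZr ger0_norm//.
by rewrite ler_wpM2l.
Qed.

Lemma cpos0 : cpos 0.
Proof. by split; [exact: star0 | exists 0; rewrite subr0 cnormA normr0]. Qed.

Lemma cposA t : 0 <= t -> cpos t%:C%:A.
Proof.
move=> t0; split; first exact: starA.
by exists t; rewrite subrr cnorm0.
Qed.

(** By [cpos_norm_sub] the witnesses can be taken as the norm of h plus e, so they do not blow up as
    e tends to 0. *)
Lemma cpos_lim h : star h = h -> (forall e, 0 < e -> cpos (h + e%:C%:A)) -> cpos h.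
Proof.
move=> hh H; split=> //; exists (cnorm h).
apply/ler_addgt0Pl => e e0.
have : cnorm ((cnorm h + e)%:C%:A - (h + e%:C%:A)) <= cnorm h + e.
  apply: cpos_norm_sub; first exact: H.
  by apply: (le_trans (cnormD _ _)); rewrite cnormA gtr0_norm.
rewrite real_complexD scalerDl.
have -> : (cnorm h)%:C%:A + e%:C%:A - (h + e%:C%:A) = (cnorm h)%:C%:A - h :> A by zmod.
lra.
Qed.

(** If k^2 = h + d, then y h y = (y k)^2 - d y^2 because y commutes with k, and for small d the
    remainder e - d y^2 is positive. For y not commuting with h, one would need [cpos_starM], whose
    proof rests on the present lemma. *)
Lemma cpos_conj_comm h y : cpos h -> star y = y -> GRing.comm y h ->
  cpos (y * h * y).
Proof.
move=> ph yy yh; have [hh _] := ph.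
apply: cpos_lim => [|e e0]; first by rewrite !starM yy hh mulrA.
have y0 : 0 < cnorm y ^+ 2 + 1 by rewrite ltr_wpDl// sqr_ge0.
pose d := e / (cnorm y ^+ 2 + 1).
have d0 : 0 < d by rewrite divr_gt0.
have [k [kk k2 kc]] := cpos_sqrt ph d0.
have ky : GRing.comm y k by apply: kc.
have -> : y * h * y + e%:C%:A = (y * k) * (y * k) + (e%:C%:A - d%:C *: (y * y)).
  have -> : (y * k) * (y * k) = y * (h + d%:C%:A) * y.
    by rewrite -k2 [X in _ * X = _]ky !mulrA.
  rewrite mulrDr mulrDl -scalerAr mulr1 -scalerAl.
  by zmod.
apply: cposD; first by apply: cpos_sqr; rewrite starM kk yy ky.
split; first by rewrite starB starA starZr starM yy.
exists e; rewrite opprB addrC subrK cnormZr gtr0_norm// cnorm_sqr//.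
rewrite /d mulrAC ler_pdivrMr// ler_pM2l//.
by rewrite lerDl.
Qed.

(** The square roots k and l of t + e - h and t + e + h commute with each other and with h, so that
    h^2 + (k l)^2 = (t + e)^2. *)
Lemma cnorm_le_of_cpos h t : 0 <= t -> cpos (t%:C%:A - h) -> cpos (t%:C%:A + h) ->
  cnorm h <= t.
Proof.
move=> t0 pm pp; apply/ler_addgt0Pl => e e0.
have hh : star h = h.
  by have [+ _] := pp; rewrite starD starA => /addrI.
have [k [kk k2 kc]] := cpos_sqrt pm e0.
have [l [ll l2 lc]] := cpos_sqrt pp e0.
have hl : GRing.comm h l.
  by apply: lc; apply: commrD; [exact: commA | exact: commr_refl].
have hk : GRing.comm h k.
  by apply: kc; apply: commrB; [exact: commA | exact: commr_refl].
have lk : GRing.comm l k.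
  by apply: kc; apply: commrB; [exact: commA | exact: commr_sym].
have hkl : GRing.comm h (k * l) by apply: commrM.
apply: (@cnorm_le_of_sum_sqr h (k * l)) => //.
- by rewrite starM ll kk lk.
- by rewrite addr_ge0// ltW.
have -> : k * l * (k * l) = (k * k) * (l * l) by rewrite -mulrA [l * (k * l)]mulrA lk !mulrA.
have -> : k * k = (e + t)%:C%:A - h by rewrite k2 real_complexD scalerDl; zmod.
have -> : l * l = (e + t)%:C%:A + h by rewrite l2 real_complexD scalerDl; zmod.
move: (e + t) => s.
rewrite mulrDl !mulrDr !mulNr -!scalerAl -!scalerAr !mul1r !mulr1 expr2.
by rewrite real_complexM -scalerA; zmod.
Qed.

End CStarPositivity.

(** * Positivity of [star x * x] *)

Section KelleyVaught.
Variables (R : realType) (A : cstarAlgType R).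
Implicit Types (x y h g k l d : A) (t e : R).

(* d * star d and star d * d have the same spectrum away from 0; here this is
   read off the growth of the powers of translates. *)
Lemma cpos_swap d t : 0 < t -> cpos (t%:C%:A - star d * d) ->
  cpos (t%:C%:A - d * star d).
Proof.
move=> t0 pd; set a := star d * d in pd; set b := d * star d.
pose T := cnorm (t%:C%:A - a).
have T0 : 0 <= T := cnorm_ge0 _.
pose u := T%:C%:A + a; pose v := T%:C%:A + b.
have ua : cnorm u <= T + t.
  have -> : u = (T + t)%:C%:A - (t%:C%:A - a) by rewrite real_complexD scalerDl /u; zmod.
  by apply: cpos_norm_sub => //; rewrite lerDl ltW.
(* The intertwining relation lets powers of [v] next to d be estimated by powers of [u], whose norm
   is already under control. *)
have vd m : v ^+ m * d = d * u ^+ m.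
  elim: m => [|m IH]; first by rewrite !expr0 mulr1 mul1r.
  rewrite exprSr -mulrA.
  have -> : v * d = d * u by rewrite /v /u mulrDl mulrDr -scalerAl -scalerAr mul1r mulr1 /b /a mulrA.
  by rewrite mulrA IH -mulrA -exprSr.
pose C := cnorm d ^+ 2 / t.
have C0 : 0 <= C by rewrite divr_ge0 ?sqr_ge0// ltW.
have tau0 : 0 <= T + t by rewrite addr_ge0// ltW.
(* One factor [v] is split as T + b. The summand with b ends in d^*, so [vd] bounds it without the
   factor growing in m; the bound is then linear in m, which [le_of_pow2_growth] removes. *)
have vm m : cnorm (v ^+ m) <= (1 + m%:R * C) * (T + t) ^+ m.
  elim: m => [|m IH]; first by rewrite !expr0 mul0r addr0 mulr1 cnorm1.
  have -> : v ^+ m.+1 = T%:C *: v ^+ m + v ^+ m * b.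
    by rewrite exprSr /v mulrDr -scalerAr mulr1.
  apply: (le_trans (cnormD _ _)); rewrite cnormZr ger0_norm//.
  have nb : cnorm (v ^+ m * b) <= C * t * (T + t) ^+ m.
    rewrite /b mulrA vd /C divfK ?gt_eqF//.
    apply: (le_trans (cnormM _ _)); rewrite cnorm_star.
    apply: (@le_trans _ _ (cnorm d * (T + t) ^+ m * cnorm d)); last by rewrite expr2 mulrAC.
    apply: ler_wpM2r; first exact: cnorm_ge0.
    apply: (le_trans (cnormM _ _)); apply: ler_wpM2l; first exact: cnorm_ge0.
    apply: (le_trans (cnormX _ _)); apply: lerXn2r; rewrite ?nnegrE ?cnorm_ge0//.
  apply: (le_trans (lerD (ler_wpM2l T0 IH) nb)).
  rewrite exprS -natr1; set z := (T + t) ^+ m; have z0 : 0 <= z by rewrite exprn_ge0.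
  rewrite -subr_ge0.
  have -> : (1 + (m%:R + 1) * C) * ((T + t) * z) - (T * ((1 + m%:R * C) * z) + C * t * z)
     = z * (t * (1 + m%:R * C) + C * T) by ring.
  have mC : 0 <= 1 + m%:R * C by rewrite addr_ge0// mulr_ge0.
  by apply: mulr_ge0 => //; apply: addr_ge0; apply: mulr_ge0 => //; exact: ltW.
have bb : star b = b by rewrite /b starM starK.
have vv : star v = v by rewrite /v starD starA bb.
have vt : cnorm v <= T + t.
  apply: (@le_of_pow2_growth _ _ _ (1 + C)); first by rewrite addr_ge0.
    by rewrite ltr_wpDl.
  move=> j; rewrite -expnS -cnorm_pow2//; apply: (le_trans (vm _)).
  apply: ler_wpM2r; first by rewrite exprn_ge0.
  set m := (_ %:R : R); have : 0 <= m by rewrite ler0n.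
  nra.
split; first by rewrite starB starA bb.
exists (T + t); rewrite real_complexD scalerDl.
by have -> : T%:C%:A + t%:C%:A - (t%:C%:A - b) = v by rewrite /v; zmod.
Qed.

(** With the self-adjoint elements h = d + d^* and k = i (d - d^* ), the sum equals (h^2 + k^2) /
    2. *)
Lemma cpos_star_add d : cpos (star d * d + d * star d).
Proof.
pose c : R[i] := 0 +i* 1.
have cc : c * c = - 1 by rewrite /c; simpc.
have cconj : c^* = - c by rewrite /c; simpc.
pose h := d + star d; pose k := c *: (d - star d).
have hh : star h = h by rewrite /h starD starK addrC.
have kk : star k = k.
  rewrite /k starZ starB starK -[star d - d]opprB scalerN -scaleNr.
  by congr (_ *: _); rewrite -[RHS]opprK; congr (- _); exact: cconj.
have -> : star d * d + d * star d = 2^-1%:C *: (h * h + k * k).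
  rewrite /k -scalerAl -scalerAr scalerA cc scaleN1r /h.
  rewrite -[LHS]scale_halfD -scalerDr; congr (_ *: _).
  by rewrite !(mulrDl, mulrDr, mulrN, mulNr); zmod.
apply: cposZ; first by rewrite invr_ge0.
by apply: cposD; apply: cpos_sqr.
Qed.

(* Writing a = star x * x, t = |a| and s = t - a, one has to show |s| <= t.
   The element d = x * s^n satisfies star d * d = a s^2n <= t^(2n+1), so the
   same bound holds for d * star d by cpos_swap, while
   d * star d >= - star d * d since their sum is positive; hence
   |a s^2n| <= t^(2n+1) for every n, and |s| <= t follows by growth. *)
Theorem cpos_starM x : cpos (star x * x).
Proof.
set a := star x * x.
have aa : star a = a by rewrite /a starM starK.
pose t := cnorm a.
have := cnorm_ge0 a; rewrite le_eqVlt => /predU1P[/esym/cnorm_eq0->|].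
  exact: cpos0.
rewrite -/t => t0.
pose s := t%:C%:A - a.
have ss : star s = s by rewrite /s starB starA aa.
have as_ : GRing.comm a s by apply: commrB; [exact: commA | exact: commr_refl].
have ps : cpos s by split=> //; exists t; rewrite /s opprB addrC subrK.
have asm m : GRing.comm a (s ^+ m) by apply: commrX.
(* Induction in steps of two: s^(m+2) = s s^m s is a conjugation by a commuting element. *)
have psm m : cpos (s ^+ m).
  elim/ltn_ind: m => -[|[|m]] IH; first by rewrite expr0 -[1]scale1r; apply: (cposA _ ler01).
    by rewrite expr1.
  rewrite exprS exprSr mulrA; apply: cpos_conj_comm => //; first exact: IH.
  by apply: commrX; exact: commr_refl.
(* Since s^(m+1) = t s^m - s^m a, passing from m to m + 1 multiplies by t and adds the positive
   element a s^m a. *)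
have pE m : cpos ((t ^+ m.+1)%:C%:A - a * s ^+ m).
  elim: m => [|m IH]; first by rewrite expr1 expr0 mulr1.
  have -> : (t ^+ m.+2)%:C%:A - a * s ^+ m.+1 =
      t%:C *: ((t ^+ m.+1)%:C%:A - a * s ^+ m) + a * s ^+ m * a.
    have -> : s ^+ m.+1 = t%:C *: s ^+ m - s ^+ m * a.
      by rewrite exprSr {2}/s mulrBr -scalerAr mulr1.
    rewrite scalerBr scalerA -real_complexM -exprS mulrBr -scalerAr mulrA; zmod.
  by apply: cposD; [apply: cposZ => //; exact: ltW | apply: cpos_conj_comm].
have bnd n : cnorm (a * s ^+ (2 * n)) <= t ^+ (2 * n).+1.
  pose d := x * s ^+ n; set eta := t ^+ _.
  have eta0 : 0 < eta by rewrite exprn_gt0.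
  have dd : star d * d = a * s ^+ (2 * n).
    rewrite /d starM starX ss mul2n -addnn exprD !mulrA; congr (_ * _).
    by rewrite -mulrA -/a -asm.
  have pd : cpos (eta%:C%:A - star d * d) by rewrite dd; exact: pE.
  have pd' := cpos_swap eta0 pd.
  have pd2 : cpos (eta%:C%:A + d * star d).
    have -> : eta%:C%:A + d * star d = (eta%:C%:A - star d * d) + (star d * d + d * star d) by zmod.
    by apply: cposD => //; exact: cpos_star_add.
  have := cnorm_le_of_cpos (ltW eta0) pd' pd2.
  by rewrite -{1}[d]starK cnorm_starM cnorm_star -cnorm_starM dd.
(* From s^2 = t^2 - 2 t a + a^2, each step adds at most 2 + 1 = 3 multiples of t^(2n+2), both error
   terms containing a s^2n. *)
have sb n : cnorm (s ^+ (2 * n)) <= (1 + 3 * n%:R) * t ^+ (2 * n).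
  elim: n => [|n IH]; first by rewrite muln0 !expr0 mulr0 addr0 mulr1 cnorm1.
  have -> : s ^+ (2 * n.+1) = (t ^+ 2)%:C *: s ^+ (2 * n) - (2 * t)%:C *: (a * s ^+ (2 * n)) + a * (a * s ^+ (2 * n)).
    rewrite mulnS exprD; set z := s ^+ (2 * n).
    have az : GRing.comm a z by exact: asm.
    have -> : s ^+ 2 = (t ^+ 2)%:C%:A - (2 * t)%:C *: a + a * a.
      have -> : (2 * t)%:C *: a = t%:C *: a + t%:C *: a.
        by rewrite -scalerDl -real_complexD; congr (_%:C *: _); ring.
      rewrite expr2 /s !(mulrDl, mulrDr, mulrN, mulNr) -!scalerAl -!scalerAr !mul1r !mulr1 expr2 real_complexM -scalerA.
      by zmod.
    by rewrite mulrDl mulrBl -!scalerAl mul1r mulrA.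
  apply: (le_trans (cnormD _ _)).
  have B1 := cnormB ((t ^+ 2)%:C *: s ^+ (2 * n)) ((2 * t)%:C *: (a * s ^+ (2 * n))).
  rewrite !cnormZr !ger0_norm ?sqr_ge0 ?mulr_ge0 ?(ltW t0)// in B1.
  have B2 : cnorm (a * (a * s ^+ (2 * n))) <= t * t ^+ (2 * n).+1.
    apply: (le_trans (cnormM _ _)); apply: ler_wpM2l => //; exact: ltW.
  have B3 := bnd n.
  have t2 : 0 <= t ^+ 2 by rewrite sqr_ge0.
  have B4 := ler_wpM2l t2 IH.
  have B5 : 2 * t * cnorm (a * s ^+ (2 * n)) <= 2 * t * t ^+ (2 * n).+1.
    by apply: ler_wpM2l => //; rewrite mulr_ge0// ltW.
  apply: (le_trans (lerD B1 B2)).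
  apply: (le_trans (lerD (lerD B4 B5) (lexx _))).
  rewrite le_eqVlt; apply/orP; left; apply/eqP.
  by rewrite mulnS -natr1 exprD [t ^+ (2 * n).+1]exprS; ring.
split=> //; exists t.
apply: (@le_of_pow2_growth _ _ _ 3) => // j.
rewrite -expnS -cnorm_pow2// expnS; apply: (le_trans (sb _)).
apply: ler_wpM2r; first by rewrite exprn_ge0// ltW.
have : 0 <= (2 ^ j)%:R :> R by rewrite ler0n.
rewrite natrM; lra.
Qed.

End KelleyVaught.

(** * Positive and bounded forms with C*-algebra entries *)

Section PositiveForms.
Variables (R : realType) (A : cstarAlgType R) (T : eqType).

(* Gaussian elimination of one index writes the sum as a multiple of y * star y
   plus the same expression for the Schur complement. *)
Lemma cpos_form (W : seq T) (M : T -> T -> R[i]) (c : T -> A) (dl : R) :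
  uniq W -> 0 < dl -> (forall w v, (M w v)^* = M v w) ->
  (forall a : T -> R[i], dl%:C * \sum_(w <- W) a w * (a w)^* <=
     \sum_(w <- W) \sum_(v <- W) a w * M w v * (a v)^*) ->
  cpos (\sum_(w <- W) \sum_(v <- W) M w v *: (c w * star (c v))).
Proof.
elim: W M => [|w0 W IH] M /=.
  by move=> *; rewrite big_nil; exact: cpos0.
move=> /andP[w0W uW] dl0 Mh Mp.
have notw0 w : w \in W -> (w == w0) = false.
  by move=> wW; apply: contraNF w0W => /eqP <-.
(* The test vector supported at [w0] bounds the pivot away from 0, so it can be inverted. *)
have m_gt : dl%:C <= M w0 w0.
  have := Mp (fun w => (w == w0)%:R).
  rewrite !big_cons eqxx !mul1r conjC1 !mulr1.
  rewrite big_seq big1 ?addr0; last by move=> w wW; rewrite notw0// mul0r.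
  rewrite big_seq big1 ?addr0; last by move=> w wW; rewrite notw0// conjC0 mulr0.
  rewrite big_seq big1 ?addr0 ?mulr1//; last first.
  by move=> w wW; rewrite big1// => v _; rewrite notw0// !mul0r.
have [r [r0 mE]] : exists r : R, 0 < r /\ M w0 w0 = r%:C.
  move: m_gt; case: (M w0 w0) => x y; rewrite lecE /= => /andP[/eqP-> le].
  by exists x; split => //; apply: lt_le_trans le.
pose ri : R[i] := (r^-1)%:C.
have rri : r%:C * ri = 1 by rewrite /ri -real_complexM divff ?gt_eqF.
have ric : ri^* = ri by exact: conjc_real.
pose S w v := M w v - M w w0 * M w0 v * ri.
have Sh w v : (S w v)^* = S v w.
  by rewrite /S cconjD cconjN !cconjM ric !Mh; congr (_ - _ * _); exact: mulrC.
have SE w v : M w v = S w v + M w w0 * M w0 v * ri by rewrite /S subrK.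
pose y := \sum_(w <- w0 :: W) M w w0 *: c w.
have ZE : \sum_(w <- w0 :: W) \sum_(v <- w0 :: W) M w v *: (c w * star (c v)) =
  \sum_(w <- W) \sum_(v <- W) S w v *: (c w * star (c v)) +
  ri *: (star (star y) * star y).
  rewrite starK {2}/y star_sum mulr_suml scaler_sumr.
  have -> : \sum_(w <- W) \sum_(v <- W) S w v *: (c w * star (c v)) =
     \sum_(w <- w0 :: W) \sum_(v <- w0 :: W) S w v *: (c w * star (c v)).
    have S0l v : S w0 v = 0 by rewrite /S mE mulrAC rri mul1r subrr.
    have S0r v : S v w0 = 0 by rewrite /S mE -mulrA rri mulr1 subrr.
    rewrite big_cons [X in _ = X + _]big1 ?add0r; last by move=> v _; rewrite S0l scale0r.
    by apply: eq_bigr => w _; rewrite big_cons S0r scale0r add0r.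
  rewrite -big_split; apply: eq_bigr => w _ /=.
  rewrite mulr_sumr scaler_sumr -big_split; apply: eq_bigr => v _ /=.
  rewrite {1}SE scalerDl; congr (_ + _).
  rewrite starZ scalerMM scalerA; congr (_ *: _).
  by rewrite -(Mh v w0) [RHS]mulrC.
rewrite ZE; apply: cposD; last first.
  by apply: cposZ; [rewrite invr_ge0 ltW | exact: cpos_starM].
apply: IH => // a.
pose s := \sum_(w <- W) a w * M w w0.
(* The value at [w0] that completes the square: the form of [M] at [a'] is the form of the Schur
   complement at a. The additional coordinate only increases the sum of squares, so the margin [dl]
   survives. *)
pose a' w := if w == w0 then - s * ri else a w.
have a'E w : w \in W -> a' w = a w by move=> wW; rewrite /a' notw0.
have := Mp a'; rewrite !big_cons.
have -> : a' w0 = - s * ri by rewrite /a' eqxx.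
rewrite (eq_big_seq (fun w => a w * (a w)^*)); last by move=> w wW; rewrite a'E.
rewrite [X in _ <= _ + X + _ -> _](eq_big_seq (fun v => - s * ri * (M w0 v * (a v)^*))); last first.
  by move=> v vW; rewrite a'E// mulrA.
rewrite [X in _ <= _ + X -> _](eq_big_seq (fun w => a w * M w w0 * (- s * ri)^* + \sum_(v <- W) a w * M w v * (a v)^*)); last first.
  move=> w wW; rewrite big_cons a'E// {1}/a' eqxx; congr (_ + _).
  by apply: eq_big_seq => v vW; rewrite a'E.
rewrite big_split /= -mulr_sumr -mulr_suml -/s.
have -> : \sum_(v <- W) M w0 v * (a v)^* = s^*.
  rewrite /s cconj_sum; apply: eq_bigr => v _.
  by rewrite cconjM Mh mulrC.
have -> : (- s * ri)^* = - s^* * ri by rewrite cconjM cconjN ric.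
rewrite mE => H.
have le1 : dl%:C * \sum_(w <- W) a w * (a w)^* <=
    dl%:C * ((- s * ri) * (- s^* * ri) + \sum_(w <- W) a w * (a w)^*).
  rewrite ler_wpM2l ?lecR ?(ltW dl0)// lerDr.
  have -> : - s * ri * (- s^* * ri) = (s * ri) * (s * ri)^* by rewrite cconjM ric; ring.
  exact: mul_conjC_ge0.
apply: (le_trans le1); apply: (le_trans H).
rewrite le_eqVlt; apply/orP; left; apply/eqP.
transitivity (\sum_(w <- W) \sum_(v <- W) a w * M w v * (a v)^* - s * s^* * ri).
  have -> : - s * ri * r%:C * (- s^* * ri) = s * s^* * ri * (r%:C * ri) by ring.
  by rewrite rri; ring.
have -> : s * s^* * ri = \sum_(w <- W) \sum_(v <- W) a w * (M w w0 * M w0 v * ri) * (a v)^*.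
  rewrite {1}/s -mulrA mulr_suml; apply: eq_bigr => w _.
  rewrite /s cconj_sum mulr_suml mulr_sumr; apply: eq_bigr => v _.
  by rewrite cconjM Mh; ring.
rewrite -sumrB; apply: eq_bigr => w _; rewrite -sumrB; apply: eq_bigr => v _.
by rewrite /S; ring.
Qed.

End PositiveForms.

Section BoundedForms.
Variables (R : realType).

Lemma mul_cconj (a : R[i]) : a * a^* = (Normc.normc a ^+ 2)%:C.
Proof.
case: a => x y; rewrite /= sqr_sqrtr ?addr_ge0 ?sqr_ge0//.
by simpc; congr (_ +i* _); ring.
Qed.

Lemma addr_cconj (a : R[i]) : a + a^* = (2 * complex.Re a)%:C.
Proof.
case: a => x y; apply/eqP; rewrite eq_complex /=.
by apply/andP; split; apply/eqP; ring.
Qed.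

Lemma Re_le_normc (a : R[i]) : `|complex.Re a| <= Normc.normc a.
Proof.
case: a => x y /=; rewrite -sqrtr_sqr; apply: ler_wsqrtr.
by rewrite lerDl sqr_ge0.
Qed.

Lemma Im_le_normc (a : R[i]) : `|complex.Im a| <= Normc.normc a.
Proof.
case: a => x y /=; rewrite -sqrtr_sqr; apply: ler_wsqrtr.
by rewrite lerDr sqr_ge0.
Qed.

Variables (A : cstarAlgType R) (T : eqType).

(** Adding 2 (tau + e) times the identity matrix to plus or minus X + X^* gives a hermitian matrix
    with margin 2 e, to which [cpos_form] applies; the sum of the c w c w^* turns the identity
    matrix into a scalar. Both signs together bound the norm by [cnorm_le_of_cpos]. *)
Lemma cnorm_form_addstar (W : seq T) (X : T -> T -> R[i]) (c : T -> A) (tau lam : R) :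
  uniq W -> 0 <= tau -> 0 <= lam -> \sum_(w <- W) c w * star (c w) = lam%:C%:A ->
  (forall a : T -> R[i],
    Normc.normc (\sum_(w <- W) \sum_(v <- W) a w * X w v * (a v)^*) <=
    tau * \sum_(w <- W) Normc.normc (a w) ^+ 2) ->
  forall Z, Z = \sum_(w <- W) \sum_(v <- W) X w v *: (c w * star (c v)) ->
  cnorm (Z + star Z) <= 2 * tau * lam.
Proof.
move=> uW tau0 lam0 cc XB Z ZE.
have sZ : star Z = \sum_(w <- W) \sum_(v <- W) (X v w)^* *: (c w * star (c v)).
  rewrite ZE star_sum exchange_big; apply: eq_bigr => w _ /=.
  rewrite star_sum; apply: eq_bigr => v _.
  by rewrite starZ starM starK.
have key (e sg : R) : 0 < e -> sg = 1 \/ sg = - 1 ->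
    cpos ((2 * (tau + e) * lam)%:C%:A + sg%:C *: (Z + star Z)).
  move=> e0 sg1.
  pose M w v := (2 * (tau + e))%:C * (w == v)%:R + sg%:C * (X w v + (X v w)^*).
  have -> : (2 * (tau + e) * lam)%:C%:A + sg%:C *: (Z + star Z) =
      \sum_(w <- W) \sum_(v <- W) M w v *: (c w * star (c v)).
    rewrite real_complexM -scalerA -cc sZ ZE -big_split /= !scaler_sumr -big_split.
    apply: eq_big_seq => w wW /=.
    rewrite -big_split scaler_sumr /= /M.
    under [RHS]eq_bigr do rewrite scalerDl.
    rewrite big_split /=; congr (_ + _); last first.
      by apply: eq_bigr => v _; rewrite -scalerA scalerDl.
    rewrite (bigD1_seq w)//= eqxx mulr1 big1 ?addr0// => v vw.
    by rewrite eq_sym (negbTE vw) mulr0 scale0r.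
  apply: (@cpos_form _ _ _ _ _ _ (2 * e)) => //; first by rewrite mulr_gt0.
    move=> w v; rewrite /M cconjD !cconjM !cconjR cconjD conjCK eq_sym.
    by rewrite [_^* + _]addrC; congr (_ * _ + _); case: (v == w); rewrite ?conjC1 ?conjC0.
  move=> a; set S := \sum_(w <- W) Normc.normc (a w) ^+ 2.
  have SE : \sum_(w <- W) a w * (a w)^* = S%:C.
    by rewrite /S rmorph_sum; apply: eq_bigr => w _; rewrite mul_cconj.
  pose F := \sum_(w <- W) \sum_(v <- W) a w * X w v * (a v)^*.
  have FE : F^* = \sum_(w <- W) \sum_(v <- W) a w * (X v w)^* * (a v)^*.
    rewrite /F cconj_sum exchange_big; apply: eq_bigr => w _ /=.
    rewrite cconj_sum; apply: eq_bigr => v _.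
    by rewrite !cconjM conjCK; ring.
  have -> : \sum_(w <- W) \sum_(v <- W) a w * M w v * (a v)^* =
     (2 * (tau + e))%:C * S%:C + sg%:C * (F + F^*).
    rewrite -SE FE /F -big_split /= !mulr_sumr -big_split.
    apply: eq_big_seq => w wW /=.
    rewrite -big_split mulr_sumr /= /M.
    transitivity (\sum_(v <- W) ((2 * (tau + e))%:C * (w == v)%:R * (a w * (a v)^*)
       + sg%:C * (a w * X w v * (a v)^* + a w * (X v w)^* * (a v)^*))).
      by apply: eq_bigr => v _; ring.
    rewrite big_split /=; congr (_ + _).
    rewrite (bigD1_seq w)//= eqxx mulr1 big1 ?addr0// => v vw.
    by rewrite eq_sym (negbTE vw) mulr0 mul0r.
  rewrite SE addr_cconj -!real_complexM -real_complexD lecR.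
  have := le_trans (Re_le_normc F) (XB a); rewrite -/S ler_norml => /andP[].
  by case: sg1 => ->; lra.
apply/ler_addgt0Pl => e e0.
pose d := e / (2 * (lam + 1)).
have d0 : 0 < d by rewrite divr_gt0// mulr_gt0// ltr_wpDl.
apply: (@le_trans _ _ (2 * (tau + d) * lam)).
  apply: cnorm_le_of_cpos.
  - by rewrite mulr_ge0// mulr_ge0// addr_ge0// ltW.
  - have := key d (-1) d0 (or_intror erefl).
    have -> : (-1)%:C = -1 :> R[i] by exact: rmorphN1.
    by rewrite scaleN1r.
  - by have := key d 1 d0 (or_introl erefl); rewrite scale1r.
have dE : d * (2 * (lam + 1)) = e by rewrite divfK// gt_eqF// mulr_gt0// ltr_wpDl.
nra.
Qed.

(** Z is half of the difference of Z + Z^* and i (i Z + (i Z)^* ). Both X and i X satisfy the same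
    bound, so each part is at most 2 tau lam; two parts and the factor 1/2 leave the constant 2. *)
Lemma cnorm_form_le (W : seq T) (X : T -> T -> R[i]) (c : T -> A) (tau lam : R) :
  uniq W -> 0 <= tau -> 0 <= lam -> \sum_(w <- W) c w * star (c w) = lam%:C%:A ->
  (forall a : T -> R[i],
    Normc.normc (\sum_(w <- W) \sum_(v <- W) a w * X w v * (a v)^*) <=
    tau * \sum_(w <- W) Normc.normc (a w) ^+ 2) ->
  cnorm (\sum_(w <- W) \sum_(v <- W) X w v *: (c w * star (c v))) <= 2 * tau * lam.
Proof.
move=> uW tau0 lam0 cc XB; set Z := \sum_(w <- W) _.
pose c' : R[i] := 0 +i* 1.
have c'c : c' * c' = - 1 by rewrite /c'; simpc.
have cconj : c'^* = - c' by rewrite /c'; simpc.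
have n1 : Normc.normc c' = 1 by rewrite /= expr0n add0r expr1n sqrtr1.
have H1 := cnorm_form_addstar uW tau0 lam0 cc XB (erefl Z).
have : cnorm (c' *: Z + star (c' *: Z)) <= 2 * tau * lam.
  apply: (@cnorm_form_addstar W (fun w v => c' * X w v) c) => //; last first.
    rewrite scaler_sumr; apply: eq_bigr => w _; rewrite scaler_sumr.
    by apply: eq_bigr => v _; rewrite scalerA.
  move=> a; apply: le_trans (XB a).
  have -> : \sum_(w <- W) \sum_(v <- W) a w * (c' * X w v) * (a v)^* =
      c' * \sum_(w <- W) \sum_(v <- W) a w * X w v * (a v)^*.
    rewrite mulr_sumr; apply: eq_bigr => w _; rewrite mulr_sumr.
    by apply: eq_bigr => v _; ring.
  by rewrite Normc.normcM n1 mul1r.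
move=> H2.
have ZE : Z = 2^-1%:C *: ((Z + star Z) - c' *: (c' *: Z + star (c' *: Z))).
  have -> : star (c' *: Z) = - (c' *: star Z) by rewrite starZ -scaleNr; congr (_ *: _); exact: cconj.
  have -> : c' *: (c' *: Z - c' *: star Z) = - Z + star Z.
    by rewrite scalerBr !scalerA c'c !scaleN1r opprK.
  by rewrite -[LHS]scale_halfD -scalerDr; congr (_ *: _); zmod.
rewrite {1}ZE cnormZr ger0_norm ?invr_ge0// ler_pdivrMl//.
apply: (le_trans (cnormB _ _)); rewrite cnormZ n1 mul1r.
by apply: (le_trans (lerD H1 H2)); move: (2 * tau * lam) => z; lra.
Qed.

End BoundedForms.

(** * Star homomorphisms *)

Lemma cnorm_sub_mul (R : realType) (D : cstarAlgType R) (x u x' u' : D) (e : R) : 0 < e -> e <= 1 ->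
  cnorm (x - x') <= e -> cnorm (u - u') <= e ->
  cnorm (x * u - x' * u') <= (cnorm x + cnorm u + 1) * e.
Proof.
move=> e0 e1 hx hu.
have -> : x * u - x' * u' = x * (u - u') + (x - x') * u - (x - x') * (u - u').
  by rewrite !(mulrBr, mulrBl); zmod.
apply: (le_trans (cnormB _ _)).
have H1 := cnormD (x * (u - u')) ((x - x') * u).
have H2 : cnorm (x * (u - u')) <= cnorm x * e.
  by apply: (le_trans (cnormM _ _)); rewrite ler_wpM2l// cnorm_ge0.
have H3 : cnorm ((x - x') * u) <= e * cnorm u.
  by apply: (le_trans (cnormM _ _)); rewrite ler_wpM2r// cnorm_ge0.
have H4 : cnorm ((x - x') * (u - u')) <= e * 1.
  apply: (le_trans (cnormM _ _)); apply: ler_pM; rewrite ?cnorm_ge0//.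
  exact: le_trans hu e1.
lra.
Qed.

Section StarHomomorphisms.
Variables (R : realType) (A B : cstarAlgType R).

Lemma lrmorph_scalar (f : {lrmorphism A -> B}) (a : R[i]) : f a%:A = a%:A.
Proof. by rewrite linearZ rmorph1. Qed.

(* For self-adjoint a with norm below t, write t^2 - a^2 as a square l^2; then
   f a and f l satisfy the same identity in B. *)
Lemma star_hom_contractive (f : {lrmorphism A -> B}) x :
  is_star_hom f -> cnorm (f x) <= cnorm x.
Proof.
move=> fs.
have sa a : star a = a -> cnorm (f a) <= cnorm a.
  move=> aa; apply/ler_addgt0Pl => e e0; set t := e + cnorm a.
  have t0 : 0 <= t by rewrite addr_ge0 ?cnorm_ge0// ltW.
  have H : cnorm ((t ^+ 2)%:C%:A - ((t ^+ 2)%:C%:A - a * a)) < t ^+ 2.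
    rewrite opprB addrC subrK cnorm_sqr// ltr_sqr ?nnegrE ?cnorm_ge0//.
    by rewrite /t ltrDr.
  have [|l [ll l2 lc]] := cstar_sqrt _ H; first by rewrite starB starA starM aa.
  have al : GRing.comm a l.
    by apply: lc; apply: commrB; [exact: commA | apply: commrM].
  apply: (@cnorm_le_of_sum_sqr _ _ (f a) (f l)) => //.
  - by rewrite -fs aa.
  - by rewrite -fs ll.
  - by rewrite /GRing.comm -!rmorphM al.
  rewrite -!rmorphM l2 -rmorphD addrC subrK; exact: lrmorph_scalar.
rewrite -ler_sqr ?nnegrE ?cnorm_ge0// -!cnorm_starM -fs -rmorphM.
by apply: sa; rewrite starM starK.
Qed.

(** The set where f and g agree is a C*-subalgebra; it is closed because both maps are
    contractive. *)
Lemma star_hom_eq (f g : {lrmorphism A -> B}) (I : Type) (s : I -> A) :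
  is_star_hom f -> is_star_hom g -> cstar_generated (range s) = [set: A] ->
  (forall i, g (s i) = f (s i)) -> g =1 f.
Proof.
move=> fs gs gen fg x.
have : cstar_generated (range s) x by rewrite gen.
move/(_ [set y | g y = f y]); apply; split=> [|_ [i _ <-]]; last exact: fg.
split=> [|a u v|u v|u|u H]; rewrite /= ?rmorph1//.
- by move=> uv vv; rewrite !linearP /= uv vv.
- by move=> uv vv; rewrite !rmorphM /= uv vv.
- by move=> uv; rewrite fs gs uv.
apply/eqP; rewrite -subr_eq0; apply/eqP; apply: (@cnorm_eps0 _ _ _ 2) => e e0.
have [v vv ve] := H e e0.
have -> : g u - f u = g (u - v) - f (u - v).
  by have vv' : g v = f v by []; rewrite (raddfB g) (raddfB f) /= vv' opprB addrA subrK.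
apply: (le_trans (cnormB _ _)).
have := star_hom_contractive (u - v) gs; have := star_hom_contractive (u - v) fs.
lra.
Qed.

Section Extension.
Variables (G : A -> B -> Prop) (C : R).
Hypothesis C0 : 0 <= C.
Hypothesis G1 : G 1 1.
Hypothesis GL : forall a x y u v, G x y -> G u v -> G (a *: x + u) (a *: y + v).
Hypothesis GM : forall x y u v, G x y -> G u v -> G (x * u) (y * v).
Hypothesis GS : forall x y, G x y -> G (star x) (star y).
Hypothesis GC : forall x y, G x y -> cnorm y <= C * cnorm x.
Hypothesis GD : forall x e, 0 < e -> exists u v, G u v /\ cnorm (x - u) <= e.

(** The closure of the graph. [G] is a relation and not a map, since one element of A may have
    several presentations: the bound [GC] makes the closure single-valued, and the density [GD]
    makes it total. *)
Let clos x y := forall e, 0 < e ->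
  exists u v, [/\ G u v, cnorm (x - u) <= e & cnorm (y - v) <= e].

Let closI x y (K : R) : (forall e, 0 < e -> e <= 1 ->
  exists u v, [/\ G u v, cnorm (x - u) <= K * e & cnorm (y - v) <= K * e]) ->
  clos x y.
Proof.
move=> H e e0.
have K1 : 0 < `|K| + 1 by rewrite ltr_wpDl.
pose d := Num.min 1 (e / (`|K| + 1)).
have d0 : 0 < d by rewrite lt_min ltr01 divr_gt0.
have d1 : d <= 1 by rewrite ge_min lexx.
have [u [v [uv xu yv]]] := H d d0 d1.
have Kd : K * d <= e.
  apply: (@le_trans _ _ ((`|K| + 1) * (e / (`|K| + 1)))); last by rewrite mulrCA divff ?mulr1 ?gt_eqF.
  apply: (@le_trans _ _ ((`|K| + 1) * d)).
    by apply: ler_wpM2r; [exact: ltW | apply: (le_trans (ler_norm K)); rewrite lerDl].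
  by apply: ler_wpM2l; [exact: ltW | rewrite ge_min lexx orbT].
by exists u, v; split=> //; [exact: le_trans xu Kd | exact: le_trans yv Kd].
Qed.

Let closG x y : G x y -> clos x y.
Proof. by move=> g e e0; exists x, y; rewrite !subrr !cnorm0 ltW. Qed.

Let GB x y u v : G x y -> G u v -> cnorm (y - v) <= C * cnorm (x - u).
Proof.
move=> g h; apply: GC; have := GL (-1) h g.
by rewrite !scaleN1r [- u + _]addrC [- v + _]addrC.
Qed.

Let clos_inj x y z : clos x y -> clos x z -> y = z.
Proof.
move=> xy xz; apply/eqP; rewrite -subr_eq0; apply/eqP.
apply: (@cnorm_eps0 _ _ _ (2 + 2 * C)) => e e0.
have [u [v [uv xu yv]]] := xy e e0; have [u' [v' [uv' xu' yv']]] := xz e e0.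
have -> : y - z = (y - v) - (z - v') + (v - v') by zmod.
apply: (le_trans (cnormD _ _)); have := cnormB (y - v) (z - v').
have H := GB uv uv'.
have H2 : cnorm (u - u') <= e + e.
  have -> : u - u' = (x - u') - (x - u) by zmod.
  by apply: (le_trans (cnormB _ _)); apply: lerD.
have := ler_wpM2l C0 H2; lra.
Qed.

Let clos_total x : exists y, clos x y.
Proof.
have h n : 0 < 2^-1 ^+ n :> R by rewrite exprn_gt0// invr_gt0.
have /choice[u /choice[v uv]] n : exists u v, G u v /\ cnorm (x - u) <= 2^-1 ^+ n.
  exact: GD.
have uu n : cnorm (u n.+1 - u n) <= 2 * 2^-1 ^+ n.
  have -> : u n.+1 - u n = (x - u n) - (x - u n.+1) by zmod.
  apply: (le_trans (cnormB _ _)).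
  have [_ H1] := uv n; have [_ H2] := uv n.+1; rewrite exprS in H2.
  have := h n; lra.
have vv n : cnorm (v n.+1 - v n) <= C * 2 * 2^-1 ^+ n.
  have [g1 _] := uv n; have [g2 _] := uv n.+1.
  by apply: (le_trans (GB g2 g1)); rewrite -mulrA; apply: ler_wpM2l.
have [|| y yv] := @cstar_geometric_limit _ _ v (C * 2) 2^-1 _ _ vv.
- by rewrite invr_ge0.
- by rewrite invf_lt1// ltr1n.
exists y => e e0; have [n0 Hn0] := yv e e0.
have [n1 Hn1] : exists n1, forall n, (n1 <= n)%N -> 2^-1 ^+ n <= e.
  have : (fun n => 2^-1 ^+ n) @ \oo --> (0 : R).
    by apply: cvg_expr; rewrite ger0_norm ?invr_ge0// invf_lt1// ltr1n.
  move/cvgrPdist_le => /(_ e e0)[n1 _ Hn]; exists n1 => n nn.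
  by have := Hn n nn; rewrite /= sub0r normrN; apply: le_trans; exact: ler_norm.
pose n := maxn n0 n1; exists (u n), (v n); have [g xu] := uv n; split=> //.
- by apply: (le_trans xu); apply: Hn1; rewrite leq_maxr.
- by rewrite cnormC; apply: Hn0; rewrite leq_maxl.
Qed.

Let closL a x y u v : clos x y -> clos u v -> clos (a *: x + u) (a *: y + v).
Proof.
move=> xy uv; apply: (@closI _ _ (Normc.normc a + 1)) => e e0 _.
have [x' [y' [xy' hx hy]]] := xy e e0; have [u' [v' [uv' hu hv]]] := uv e e0.
exists (a *: x' + u'), (a *: y' + v'); split; first exact: GL.
  have -> : a *: x + u - (a *: x' + u') = a *: (x - x') + (u - u') by rewrite scalerBr; zmod.
  rewrite mulrDl mul1r; apply: (le_trans (cnormD _ _)); apply: lerD => //.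
  by rewrite cnormZ ler_wpM2l// normc_ge0.
have -> : a *: y + v - (a *: y' + v') = a *: (y - y') + (v - v') by rewrite scalerBr; zmod.
rewrite mulrDl mul1r; apply: (le_trans (cnormD _ _)); apply: lerD => //.
by rewrite cnormZ ler_wpM2l// normc_ge0.
Qed.

Let closM x y u v : clos x y -> clos u v -> clos (x * u) (y * v).
Proof.
move=> xy uv.
pose K1 := cnorm x + cnorm u + 1; pose K2 := cnorm y + cnorm v + 1.
have K10 : 0 <= K1 by rewrite !addr_ge0 ?cnorm_ge0.
have K20 : 0 <= K2 by rewrite !addr_ge0 ?cnorm_ge0.
apply: (@closI _ _ (K1 + K2)) => e e0 e1.
have [x' [y' [xy' hx hy]]] := xy e e0; have [u' [v' [uv' hu hv]]] := uv e e0.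
exists (x' * u'), (y' * v'); split; first exact: GM.
  apply: (le_trans (cnorm_sub_mul e0 e1 hx hu)).
  by apply: ler_wpM2r; [exact: ltW | rewrite lerDl].
apply: (le_trans (cnorm_sub_mul e0 e1 hy hv)).
by apply: ler_wpM2r; [exact: ltW | rewrite lerDr].
Qed.

Let closS x y : clos x y -> clos (star x) (star y).
Proof.
move=> xy e e0; have [u [v [uv hx hy]]] := xy e e0.
exists (star u), (star v); split; first exact: GS.
  by rewrite -starB cnorm_star.
by rewrite -starB cnorm_star.
Qed.

Let ext x := sval (cid (clos_total x)).
Let extP x : clos x (ext x). Proof. exact: svalP (cid (clos_total x)). Qed.
Let ext_eq x y : clos x y -> ext x = y. Proof. exact: clos_inj (extP x). Qed.

Let ext_linear : linear ext.
Proof. by move=> a x y; apply: ext_eq; apply: closL; exact: extP. Qed.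

Let ext_monoid : monoid_morphism ext.
Proof.
split; first by apply: ext_eq; apply: closG.
by move=> x y; apply: ext_eq; apply: closM; exact: extP.
Qed.

HB.instance Definition _ := GRing.isLinear.Build R[i] A B _ ext ext_linear.
HB.instance Definition _ := GRing.isMonoidMorphism.Build A B ext ext_monoid.

Lemma star_hom_extension : exists2 f : {lrmorphism A -> B},
  is_star_hom f & forall x y, G x y -> f x = y.
Proof.
exists (ext : {lrmorphism A -> B}) => [x|x y g].
  by apply: ext_eq; apply: closS; exact: extP.
by apply: ext_eq; apply: closG.
Qed.

End Extension.
End StarHomomorphisms.

(** * The q-symmetric tensors *)

Section Words.
Variables (R : realType) (N : nat).
Implicit Types (f g h : coefs R N) (u v w x : word N) (i j k : 'I_N).

Definition annih i f : coefs R N := fun w => f (i :: w).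

Lemma sum_tupleS (V : nmodType) n (F : word N -> V) :
  \sum_(w : n.+1.-tuple 'I_N) F w = \sum_i \sum_(w : n.-tuple 'I_N) F (i :: w).
Proof.
rewrite pair_big /=.
rewrite (reindex (fun z : 'I_N * n.-tuple 'I_N => [tuple of z.1 :: z.2])) /=; last first.
  exists (fun w : n.+1.-tuple 'I_N => (thead w, [tuple of behead w] : n.-tuple 'I_N)).
    by move=> [i w] _ /=; rewrite theadE; congr pair; apply: val_inj.
  by move=> w _; case/tupleP: w => i w; apply: val_inj; rewrite /= theadE.
by [].
Qed.

Lemma sum_tuple_rcons (V : nmodType) n (F : word N -> V) :
  \sum_(w : n.+1.-tuple 'I_N) F w = \sum_i \sum_(w : n.-tuple 'I_N) F (rcons w i).
Proof.
elim: n F => [|n IH] F.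
  rewrite sum_tupleS; apply: eq_bigr => i _.
  by apply: eq_bigr => w _; rewrite tuple0.
rewrite sum_tupleS.
under eq_bigr do rewrite (IH (fun w => F (_ :: w))).
rewrite exchange_big; apply: eq_bigr => i _ /=.
by rewrite (sum_tupleS n (fun w => F (rcons w i))).
Qed.

Lemma sum_tuple0 (V : nmodType) (F : word N -> V) :
  \sum_(w : 0.-tuple 'I_N) F w = F [::].
Proof.
rewrite (bigD1 [tuple])//= big1 ?addr0// => w.
by rewrite (tuple0 w) => /eqP.
Qed.

Lemma hdotS n f g : hdot n.+1 f g = \sum_i hdot n (annih i f) (annih i g).
Proof. by rewrite /hdot (sum_tupleS n (fun w => f w * (g w)^*)). Qed.

Lemma hnormsqS n f : hnormsq n.+1 f = \sum_i hnormsq n (annih i f).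
Proof. by rewrite /hnormsq (sum_tupleS n (fun w => Normc.normc (f w) ^+ 2)). Qed.

Lemma hdot_suml n f (I : Type) (r : seq I) (P : pred I) (g : I -> coefs R N) :
  hdot n (fun w => \sum_(i <- r | P i) g i w) f = \sum_(i <- r | P i) hdot n (g i) f.
Proof.
by rewrite /hdot exchange_big; apply: eq_bigr => w _ /=; rewrite mulr_suml.
Qed.

Lemma hdotZr n (a : R[i]) f g : hdot n f (fun w => a * g w) = a^* * hdot n f g.
Proof.
by rewrite mulr_sumr; apply: eq_bigr => w _; rewrite cconjM mulrCA.
Qed.

Lemma hdotDr n f g h : hdot n f (fun w => g w + h w) = hdot n f g + hdot n f h.
Proof. by rewrite -big_split; apply: eq_bigr => w _; rewrite cconjD mulrDr. Qed.

Lemma hdotBZr n (t : R) f g h : hdot n f (fun w => g w - t%:C * h w) =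
  hdot n f g - t%:C * hdot n f h.
Proof.
rewrite mulr_sumr -sumrB; apply: eq_bigr => w _.
by rewrite cconjD cconjN cconjM cconjR; ring.
Qed.

Lemma eq_hdotr n f g h : (forall w, size w = n -> g w = h w) ->
  hdot n f g = hdot n f h.
Proof. by move=> gh; apply: eq_bigr => w _; rewrite gh// size_tuple. Qed.

Lemma hdotC n f g : (hdot n f g)^* = hdot n g f.
Proof.
by rewrite /hdot cconj_sum; apply: eq_bigr => w _; rewrite cconjM conjCK mulrC.
Qed.

Lemma hdot_monom n f x : hdot n f (monom R x) = if size x == n then f x else 0.
Proof.
case: eqP => [<-|xn]; last first.
  rewrite /hdot big1// => w _; rewrite /monom; case: eqP => [wx|_]; last by rewrite conjC0 mulr0.
  by case: xn; rewrite -wx size_tuple.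
rewrite /hdot (bigD1 (in_tuple x))//= /monom eqxx conjC1 mulr1 big1 ?addr0// => w wx.
have -> : (tval w == x) = false.
  by apply: contraNF wx => /eqP E; apply/eqP/val_inj.
by rewrite conjC0 mulr0.
Qed.

Lemma hdot_eq0 n f : hdot n f f = 0 -> forall w, size w = n -> f w = 0.
Proof.
move=> f0 w wn; have : hnormsq n f = 0.
  by apply: (@complexI R); rewrite hnormsq_hdot.
rewrite /hnormsq => /eqP; rewrite psumr_eq0; last by move=> *; rewrite sqr_ge0.
move=> /allP /(_ (tcast wn (in_tuple w)) (mem_index_enum _)).
by rewrite val_tcast /= sqrf_eq0 => /eqP; exact: Normc.eq0_normc.
Qed.

Lemma tensor_nil f g : tensor f g [::] = f [::] * g [::].
Proof. by rewrite /tensor big_ord1. Qed.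

Lemma tensor_cons f g i w :
  tensor f g (i :: w) = f [::] * g (i :: w) + tensor (annih i f) g w.
Proof. by rewrite /tensor big_ord_recl. Qed.

Lemma tensor_rcons f g i w :
  tensor f g (rcons w i) =
  tensor f (fun v => g (rcons v i)) w + f (rcons w i) * g [::].
Proof.
elim: w f => [|k w IH] f /=.
  by rewrite tensor_cons !tensor_nil.
by rewrite !tensor_cons IH addrA.
Qed.

Lemma in_tensor_algebraM f g :
  in_tensor_algebra f -> in_tensor_algebra g -> in_tensor_algebra (tensor f g).
Proof.
move=> [d fd] [e ge]; exists (d + e)%N => w wd; rewrite /tensor big1// => k _.
have [dk|kd] := ltnP d k.
  by rewrite fd ?mul0r// size_take_min leq_min dk /=; apply: leq_ltn_trans wd; rewrite leq_addr.
rewrite ge ?mulr0// size_drop ltn_subRL; apply: leq_ltn_trans wd.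
by rewrite leq_add2r.
Qed.

Lemma in_tensor_algebra_monom x : in_tensor_algebra (monom R x).
Proof.
exists (size x) => w; rewrite /monom; case: eqP => // ->; by rewrite ltnn.
Qed.

Lemma tensor_monom x y : tensor (monom R x) (monom R y) = monom R (x ++ y).
Proof.
apply/funext; elim: x => [|i x IH] w.
  case: w => [|i w]; first by rewrite tensor_nil /monom eqxx mul1r.
  rewrite tensor_cons {1}/monom eqxx mul1r [X in _ + X](_ : _ = 0) ?addr0//.
  by rewrite /tensor big1// => k _; rewrite /annih /monom mul0r.
case: w => [|k w]; first by rewrite tensor_nil /monom mul0r.
rewrite tensor_cons {1}/monom mul0r add0r /monom /= eqseq_cons.
case: eqP => [->|ki] /=.
  rewrite -[RHS]/(monom R (x ++ y) w) -IH; congr (tensor _ _ w).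
  by apply/funext => z; rewrite /annih eqseq_cons eqxx.
rewrite /tensor big1// => z _; rewrite /annih eqseq_cons.
by rewrite (introF eqP ki) mul0r.
Qed.

End Words.

Section QSymmetric.
Variables (R : realType) (N : nat) (q : R).
Implicit Types (f g h : coefs R N) (u v w x : word N) (i j k : 'I_N).

(** Orthogonality to the ideal in coordinates: the pairing of f with X_u (X_i X_j - q X_j X_i) X_v
    vanishes. *)
Definition qsym f := forall u v i j, (i < j)%N ->
  f (u ++ i :: j :: v) = q%:C * f (u ++ j :: i :: v).

Lemma qsym_prefix f u : qsym f -> qsym (fun w => f (u ++ w)).
Proof. by move=> fq u' v i j ij; rewrite !catA; apply: fq. Qed.

Lemma qsym_annih i f : qsym f -> qsym (annih i f).
Proof. exact: (@qsym_prefix f [:: i]). Qed.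

Lemma qsym_rcons i f : qsym f -> qsym (fun w => f (rcons w i)).
Proof. by move=> fq u v k l kl; rewrite !rcons_cat; apply: fq. Qed.

Lemma qsymZ (c : R[i]) f : qsym f -> qsym (fun w => c * f w).
Proof. by move=> fq u v i j ij; rewrite fq// mulrCA. Qed.

Lemma qsym_component n f : qsym f -> qsym (component n f).
Proof.
move=> fq u v i j ij; rewrite /component !size_cat /=.
by case: ifP; rewrite ?mulr0// fq.
Qed.

Lemma component_qsym f : (forall n, qsym (component n f)) -> qsym f.
Proof.
move=> fq u v i j ij; have := fq (size (u ++ i :: j :: v)) u v i j ij.
by rewrite /component !size_cat /= eqxx.
Qed.

(** As the ideal is a smallest set, its elements are reached only by exhibiting an ideal that
    contains the relators. All degrees n and all q-symmetric families are taken at once, since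
    multiplication by a letter on either side passes to the families with that letter removed. *)
Definition ann_qsym : set (coefs R N) := [set p | in_tensor_algebra p /\
  forall n f, qsym f -> hdot n f p = 0].

Lemma hdot_tensorl n f a p : qsym f -> ann_qsym p -> hdot n f (tensor a p) = 0.
Proof.
move=> + [_ pf]; elim: n f a => [|n IH] f a fq.
  rewrite /hdot (sum_tuple0 (fun w => f w * (tensor a p w)^*)) tensor_nil.
  have := pf 0%N f fq; rewrite /hdot (sum_tuple0 (fun w => f w * (p w)^*)).
  by rewrite cconjM mulrCA => ->; rewrite mulr0.
have E : hdot n.+1 f (tensor a p) = (a [::])^* * hdot n.+1 f p +
    \sum_i hdot n (annih i f) (tensor (annih i a) p).
  rewrite !hdotS mulr_sumr -big_split; apply: eq_bigr => i _ /=.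
  rewrite -hdotZr -hdotDr; apply: eq_hdotr => w _.
  by rewrite /annih tensor_cons.
rewrite E pf// mulr0 add0r big1// => i _; apply: IH; exact: qsym_annih.
Qed.

Lemma hdot_tensorr n f p b : qsym f -> ann_qsym p -> hdot n f (tensor p b) = 0.
Proof.
move=> + [_ pf]; elim: n f b => [|n IH] f b fq.
  rewrite /hdot (sum_tuple0 (fun w => f w * (tensor p b w)^*)) tensor_nil.
  have := pf 0%N f fq; rewrite /hdot (sum_tuple0 (fun w => f w * (p w)^*)).
  by rewrite cconjM mulrA => ->; rewrite mul0r.
have E : hdot n.+1 f (tensor p b) = (b [::])^* * hdot n.+1 f p +
    \sum_i hdot n (fun w => f (rcons w i)) (tensor p (fun w => b (rcons w i))).
  rewrite {1 2}/hdot (sum_tuple_rcons n (fun w => f w * (tensor p b w)^*)).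
  rewrite (sum_tuple_rcons n (fun w => f w * (p w)^*)) mulr_sumr -big_split.
  apply: eq_bigr => i _ /=; rewrite mulr_sumr -big_split; apply: eq_bigr => w _ /=.
  by rewrite tensor_rcons cconjD cconjM; ring.
rewrite E pf// mulr0 add0r big1// => i _; apply: IH; exact: qsym_rcons.
Qed.

Lemma ann_qsym_ideal : two_sided_ideal ann_qsym.
Proof.
split=> [p []//||f g [fT fq] [gT gq]|a p b aT pA bT].
- split=> [|n f _]; first by exists 0%N.
  by rewrite /hdot big1// => w _; rewrite conjC0 mulr0.
- split=> [|n h hq]; last by rewrite hdotDr fq// gq// addr0.
  move: fT gT => [d fd] [e ge]; exists (maxn d e) => w.
  by rewrite gtn_max => /andP[dw ew]; rewrite fd// ge// addr0.
- have apA : ann_qsym (tensor a p).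
    split=> [|n f fq]; last exact: hdot_tensorl.
    by apply: in_tensor_algebraM => //; case: pA.
  split=> [|n f fq]; last exact: hdot_tensorr.
  by apply: in_tensor_algebraM => //; case: apA.
Qed.

Lemma hdot_qrelator n f i j : hdot n f (qrelator q i j) =
  if n == 2 then f [:: i; j] - q%:C * f [:: j; i] else 0.
Proof.
by rewrite [LHS]hdotBZr !hdot_monom /= eq_sym; case: eqP => // _; rewrite mulr0 subr0.
Qed.

Lemma qideal_ann : qideal q `<=` ann_qsym.
Proof.
apply: smallest_sub; first exact: ann_qsym_ideal.
move=> _ [i [j [ij ->]]]; split=> [|n f fq].
  exists 2 => w w2; rewrite /qrelator /monom.
  by do 2 (case: eqP => [E|_]; first by move: w2; rewrite E); rewrite mulr0 subr0.
rewrite hdot_qrelator; case: eqP => // _.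
by have := fq [::] [::] i j ij => /= ->; rewrite subrr.
Qed.

Lemma qsym_Hsub n f : homogeneous n f -> qsym f -> Hsub q n f.
Proof. by move=> fn fq; split=> // p /qideal_ann[_ pf] _; apply: pf. Qed.

(** The monomial multiple X_u (X_i X_j - q X_j X_i) X_v of a relator is homogeneous and lies in the
    ideal; pairing with it reads off the swap rule. *)
Lemma Hsub_qsym n f : Hsub q n f -> qsym f.
Proof.
move=> [fn fp] u v i j ij.
pose p := tensor (tensor (monom R u) (qrelator q i j)) (monom R v).
have pE w : p w = monom R (u ++ i :: j :: v) w - q%:C * monom R (u ++ j :: i :: v) w.
  have tB (x y z : coefs R N) w' : tensor x (fun w => y w - q%:C * z w) w' = tensor x y w' - q%:C * tensor x z w'.
    rewrite /tensor mulr_sumr -sumrB; apply: eq_bigr => l _; ring.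
  have tB' (x y z : coefs R N) w' : tensor (fun w => y w - q%:C * z w) x w' = tensor y x w' - q%:C * tensor z x w'.
    rewrite /tensor mulr_sumr -sumrB; apply: eq_bigr => l _; ring.
  rewrite /p.
  have -> : tensor (monom R u) (qrelator q i j) = fun w =>
      monom R (u ++ [:: i; j]) w - q%:C * monom R (u ++ [:: j; i]) w.
    by apply/funext => w'; rewrite tB !tensor_monom.
  by rewrite tB' !tensor_monom -!catA.
(* At words of a length other than n both sides are 0. *)
have [un|un] := eqVneq (size (u ++ i :: j :: v)) n; last first.
  by rewrite fn// fn ?mulr0//; rewrite !size_cat in un *.
have pid : qideal q p.
  move=> J [[Jt J0 JD JM] Jr]; apply: JM; [exact: in_tensor_algebra_monom | | exact: in_tensor_algebra_monom].
  by apply: Jr; exists i, j.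
have ph : homogeneous n p.
  move=> w wn; rewrite pE /monom.
  case: eqP => [E|_]; first by case/eqP: wn; rewrite E.
  case: eqP => [E|_]; last by rewrite mulr0 subr0.
  by case/eqP: wn; rewrite E -un !size_cat.
have := fp p pid ph.
have -> : hdot n f p = hdot n f (monom R (u ++ i :: j :: v)) - q%:C * hdot n f (monom R (u ++ j :: i :: v)).
  by rewrite -hdotBZr; apply: eq_hdotr => w _; rewrite pE.
have un' : size (u ++ j :: i :: v) = n by rewrite -un !size_cat.
by rewrite !hdot_monom un un' eqxx => /eqP; rewrite subr_eq0 => /eqP.
Qed.

(** Two candidates differ by an element of [Hsub] that is orthogonal to itself, so the choice in
    [Hproj] is determined. *)
Lemma Hproj_eq n f g : Hsub q n g ->
  (forall h, Hsub q n h -> hdot n (fun w => f w - g w) h = 0) -> Hproj q n f = g.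
Proof.
move=> gH fg; rewrite /Hproj; case: xgetP => [g' _ [g'H fg']|/(_ g)]; last by case.
pose d w := g' w - g w.
have dH : Hsub q n d.
  have -> : d = fun w => g' w + (-1) * g w by apply/funext => w; rewrite mulN1r.
  by apply: HsubD => //; exact: HsubZ.
have d0 : hdot n d d = 0.
  have -> : hdot n d d = hdot n (fun w => f w - g w) d + (-1) * hdot n (fun w => f w - g' w) d.
    rewrite -hdotZ -hdotD; apply: eq_hdot => w _; rewrite /d; ring.
  by rewrite fg// fg'// mulr0 addr0.
apply/funext => w; have [wn|wn] := eqVneq (size w) n; last first.
  by case: g'H gH => [+ _] [+ _] => -> // ->.
by apply/eqP; rewrite -subr_eq0; apply/eqP; exact: hdot_eq0 d0 w wn.
Qed.

End QSymmetric.

(** * Creation operators in coordinates *)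

Section Creation.
Variables (R : realType) (N : nat) (q : R).
Hypothesis q0 : 0 < q.
Implicit Types (f g h : coefs R N) (u v w x : word N) (i j k a b : 'I_N).

Let Q : R[i] := q%:C.
Let Qi : R[i] := (q^-1)%:C.
Let P : R[i] := (q^-1 * q^-1)%:C.

Let QiQ : Qi * Q = 1.
Proof. by rewrite /Qi /Q -real_complexM mulVf// gt_eqF. Qed.

Let PE : P = Qi * Qi.
Proof. exact: real_complexM. Qed.

(** The factor in x_i x_j = [qswap i j] x_j x_i for arbitrary order of i and j. *)
Definition qswap i j : R[i] := if (i < j)%N then Q else if i == j then 1 else Qi.

(** The coefficient of S_k L_k in the expansion of L_j S_j, before normalization. *)
Definition qweight j k : R[i] := if k == j then 1 else if (j < k)%N then 1 - P else 0.

Definition qint n : R := \sum_(k < n) (q^-1 * q^-1) ^+ k.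

Lemma qintS n : qint n.+1 = qint n + (q^-1 * q^-1) ^+ n.
Proof. by rewrite /qint big_ord_recr. Qed.

Lemma qint0 : qint 0 = 0. Proof. by rewrite /qint big_ord0. Qed.

Lemma qint_gt0 n : 0 < qint n.+1.
Proof.
rewrite /qint big_ord_recl expr0 ltr_wpDr// sumr_ge0// => k _.
by rewrite exprn_ge0// -expr2 sqr_ge0.
Qed.

Let qintSC n : (qint n.+1)%:C = (qint n)%:C + P ^+ n.
Proof. by rewrite qintS real_complexD /P; congr (_ + _); rewrite rmorphXn. Qed.

Lemma qweight_diag j : qweight j j = 1.
Proof. by rewrite /qweight eqxx. Qed.

(** The cancellation behind both inductions on the degree: a letter i other than j contributes once
    through L_i G_j and once through the weight in L_j G_j, and the two contributions add up to
    1. *)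
Lemma qweight_swap i j : i != j -> Qi * qswap i j + qweight j i = 1.
Proof.
move=> ij; rewrite /qswap /qweight (negbTE ij).
case: ltngtP => [l|l|/val_inj e]; last by rewrite e eqxx in ij.
  by rewrite QiQ addr0.
by rewrite -PE addrCA subrr addr0.
Qed.

Lemma annih_swap f i j : qsym q f ->
  annih j (annih i f) = fun w => qswap i j * annih i (annih j f) w.
Proof.
move=> fq; apply/funext => w; rewrite /annih /qswap.
case: ltngtP => [ij|ji|/val_inj ->]; last by rewrite eqxx mul1r.
  exact: (fq [::] w i j ij).
rewrite (fq [::] w j i ji : f [:: j, i & w] = _) mulrA.
by case: eqP ji => [->|_ _]; rewrite ?ltnn// QiQ mul1r.
Qed.

(* The operator [n+1] S_j on H_n, which satisfies a recursion in the first
   letter: with L_i f = f (i :: -) the adjoint of S_i, the recursion reads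
   L_i G_j = q^-1 G_j L_i for i <> j and
   L_j G_j = G_j L_j + (1 - q^-2) sum_(k > j) G_k L_k + q^-2n on H_n. *)
Fixpoint qcreate w j f : R[i] :=
  if w is i :: w' then
    if i == j then
      \sum_k qweight j k * qcreate w' k (annih k f) + P ^+ size w' * f w'
    else Qi * qcreate w' j (annih i f)
  else 0.

Lemma qcreateZ w j (c : R[i]) f :
  qcreate w j (fun x => c * f x) = c * qcreate w j f.
Proof.
elim: w j f => [|i w IH] j f /=; first by rewrite mulr0.
case: eqP => _; last by rewrite [qcreate _ _ _]IH mulrCA.
rewrite mulrDr mulr_sumr; congr (_ + _); last by rewrite mulrCA.
by apply: eq_bigr => k _; rewrite [qcreate _ _ _]IH mulrCA.
Qed.

Lemma qcreateD w j f g :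
  qcreate w j (fun x => f x + g x) = qcreate w j f + qcreate w j g.
Proof.
elim: w j f g => [|i w IH] j f g /=; first by rewrite addr0.
case: eqP => _; last by rewrite [qcreate _ _ _]IH mulrDr.
rewrite mulrDr addrACA -big_split; congr (_ + _).
by apply: eq_bigr => k _; rewrite [qcreate _ _ _]IH mulrDr.
Qed.

(** The swap rule for the first two letters; further positions reduce to it by the recursion. In the
    case a = j the scalar terms match because P^(n+1) + (1 - P) P^n = P^n. *)
Lemma qcreate_swap v j f a b : qsym q f -> (a < b)%N ->
  qcreate (a :: b :: v) j f = Q * qcreate (b :: a :: v) j f.
Proof.
move=> fq ab.
have ab_neq : (a == b) = false by apply/eqP => e; rewrite e ltnn in ab.
have ba_neq : (b == a) = false by rewrite eq_sym.
have sab k : qcreate v k (annih b (annih a f)) = Q * qcreate v k (annih a (annih b f)).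
  by rewrite (annih_swap a b fq) qcreateZ /qswap ab.
have [aj|aj] := eqVneq a j.
  subst j; rewrite /= !eqxx ba_neq.
  rewrite mulrA [Q * Qi]mulrC QiQ mul1r.
  rewrite (bigD1 b)//= eqxx.
  have wab : qweight a b = 1 - P by rewrite /qweight ba_neq ab.
  rewrite wab.
  rewrite [\sum_(k < N | k != b) _](eq_bigr (fun k => qweight a k * (Qi * qcreate v k (annih b (annih k f))))); last first.
    by move=> k kb; rewrite eq_sym (negbTE kb).
  (* Termwise this is [qweight a k] q^-1 [qswap k b] = [qweight a k] - (1 - P) [qweight b k],
     checked for each position of k relative to a and b. The right-hand coefficient vanishes at k =
     b, which allows the full sum. *)
  have -> : \sum_(k < N | k != b) qweight a k * (Qi * qcreate v k (annih b (annih k f))) =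
     \sum_k (qweight a k - (1 - P) * qweight b k) * qcreate v k (annih k (annih b f)).
    rewrite [RHS](bigD1 b)//= wab qweight_diag mulr1 subrr mul0r add0r.
    apply: eq_bigr => k kb; rewrite (annih_swap k b fq) qcreateZ !mulrA; congr (_ * _).
    rewrite /qweight /qswap (negbTE kb).
    have [ka|ka|/val_inj ka] := ltngtP k a.
    - have kb' : (k < b)%N by apply: ltn_trans ab.
      by rewrite kb' ifF ?ifF ?mul0r ?mulr0 ?subr0//; [apply/negbTE; rewrite -leqNgt ltnW | apply/eqP => e; rewrite e ltnn in ka].
    - have -> : (k == a) = false by apply/eqP => e; rewrite e ltnn in ka.
      have [kb'|kb'|/val_inj e] := ltngtP k b; last by rewrite e eqxx in kb.
        by rewrite mulr0 subr0 -mulrA QiQ mulr1.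
      by rewrite -mulrA -PE; ring.
    - subst k; rewrite eqxx ab ltnNge (ltnW ab) /= mulr0 subr0 mul1r QiQ.
      by [].
  rewrite mulrDr mulr_sumr.
  have -> : \sum_k qweight a k * qcreate v k (annih k (annih b f)) =
     \sum_k (1 - P) * (qweight b k * qcreate v k (annih k (annih b f))) +
     \sum_k (qweight a k - (1 - P) * qweight b k) * qcreate v k (annih k (annih b f)).
    by rewrite -big_split; apply: eq_bigr => k _ /=; ring.
  by rewrite exprS /annih; ring.
have [bj|bj] := eqVneq b j.
  subst j; rewrite /= !eqxx ab_neq.
  rewrite !mulrDr !mulr_sumr; congr (_ + _); last first.
    rewrite exprS /annih; set z := P ^+ _.
    transitivity (Qi * Q * (Qi * (z * f (a :: v)))); first by rewrite QiQ mul1r.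
    by rewrite PE; ring.
  apply: eq_bigr => k _.
  rewrite /qweight; have [kb|kb] := eqVneq k b.
    subst k; rewrite ab_neq sab; ring.
  case: ifP => bk; last by rewrite !mul0r !mulr0.
  have ak : (a < k)%N by apply: ltn_trans bk.
  have -> : (a == k) = false by apply/eqP => e; rewrite e ltnn in ak.
  by rewrite (annih_swap a k fq) qcreateZ /qswap ak; ring.
rewrite /= (negbTE aj) (negbTE bj) sab; ring.
Qed.

Lemma qsym_qcreate j f : qsym q f -> qsym q (fun w => qcreate w j f).
Proof.
move=> fq u v a b ab; elim: u j f fq => [|i u IH] j f fq; first exact: qcreate_swap.
rewrite /=; case: eqP => _.
  rewrite mulrDr mulr_sumr; congr (_ + _).
    apply: eq_bigr => k _.
    by rewrite (IH k _ (qsym_annih _ fq)) [RHS]mulrCA.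
  by rewrite (fq _ _ _ _ ab) !size_cat [LHS]mulrCA.
by rewrite (IH j _ (qsym_annih _ fq)) [LHS]mulrCA.
Qed.

Lemma annih_qcreate i j f : annih i (fun w => qcreate w j f) =
  if i == j then fun w => \sum_k qweight j k * qcreate w k (annih k f) + P ^+ size w * f w
  else fun w => Qi * qcreate w j (annih i f).
Proof. by rewrite /annih /=; case: eqP. Qed.

(** The operator G_j is [n] times the adjoint of L_j. In the induction on the first letter the
    weights collapse to 1 by [qweight_swap], and the remaining term P^n f accounts for [n+1] = [n] +
    P^n. In degree 0 the predecessor [n.-1] is harmless since [0] = 0. *)
Lemma hdot_qcreate n j f h : qsym q f -> qsym q h ->
  hdot n (fun w => qcreate w j f) h = (qint n)%:C * hdot n.-1 f (annih j h).
Proof.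
elim: n j f h => [|n IH] j f h fq hq.
  rewrite qint0 mul0r /hdot (sum_tuple0 (fun w => qcreate w j f * (h w)^*)).
  by rewrite mul0r.
rewrite hdotS /=.
have dj : hdot n (annih j (fun w => qcreate w j f)) (annih j h) =
    (qint n)%:C * (\sum_k qweight j k * hdot n.-1 (annih k f) (annih k (annih j h)))
    + P ^+ n * hdot n f (annih j h).
  rewrite annih_qcreate eqxx hdotD hdot_suml; congr (_ + _).
    rewrite mulr_sumr; apply: eq_bigr => k _.
    rewrite hdotZ IH; [by rewrite mulrCA | exact: qsym_annih | exact: qsym_annih].
  by rewrite -hdotZ; apply: eq_hdot => w ->.
have di i : i != j -> hdot n (annih i (fun w => qcreate w j f)) (annih i h) =
    (qint n)%:C * (Qi * qswap i j * hdot n.-1 (annih i f) (annih i (annih j h))).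
  move=> ij; rewrite annih_qcreate (negbTE ij) hdotZ.
  rewrite IH; [|exact: qsym_annih|exact: qsym_annih].
  rewrite (annih_swap i j hq) hdotZr.
  have -> : (qswap i j)^* = qswap i j.
    by rewrite /qswap; case: ifP => _; [exact: cconjR | case: ifP => _; [exact: conjC1 | exact: cconjR]].
  by rewrite mulrCA !mulrA.
rewrite (bigD1 j)//= dj (eq_bigr _ di) -mulr_sumr addrAC -mulrDr.
rewrite (bigD1 j)//= qweight_diag mul1r -addrA -big_split /=.
rewrite qintSC mulrDl; congr (_ + _).
transitivity ((qint n)%:C * \sum_k hdot n.-1 (annih k f) (annih k (annih j h))).
  congr (_ * _); rewrite [RHS](bigD1 j)//=; congr (_ + _).
  by apply: eq_bigr => k kj; rewrite -mulrDl addrC qweight_swap// mul1r.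
case: n {IH dj di} => [|n]; first by rewrite qint0 !mul0r.
by rewrite -hdotS.
Qed.

Section Evaluation.
Variables (A : algType R[i]) (b : 'I_N -> A).
Hypothesis bq : forall i j, (i < j)%N -> b i * b j = q%:C *: (b j * b i).

Definition monom_eval w : A := foldr (fun i (y : A) => b i * y) 1 w.
Definition coefs_eval n f : A := \sum_(w : n.-tuple 'I_N) f w *: monom_eval w.

Lemma monom_eval_cat v w : monom_eval (v ++ w) = monom_eval v * monom_eval w.
Proof. by elim: v => [|i v IH] /=; rewrite ?mul1r// IH mulrA. Qed.

Lemma coefs_evalS n f : coefs_eval n.+1 f = \sum_i b i * coefs_eval n (annih i f).
Proof.
rewrite /coefs_eval (sum_tupleS n (fun w => f w *: monom_eval w)).
apply: eq_bigr => i _; rewrite mulr_sumr; apply: eq_bigr => w _ /=.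
by rewrite -scalerAr.
Qed.

Lemma coefs_evalD n f g :
  coefs_eval n (fun w => f w + g w) = coefs_eval n f + coefs_eval n g.
Proof. by rewrite -big_split; apply: eq_bigr => w _; rewrite scalerDl. Qed.

Lemma coefs_evalZ n c f : coefs_eval n (fun w => c * f w) = c *: coefs_eval n f.
Proof. by rewrite scaler_sumr; apply: eq_bigr => w _; rewrite scalerA. Qed.

Lemma coefs_eval_sum n (I : Type) (r : seq I) (F : I -> coefs R N) :
  coefs_eval n (fun w => \sum_(i <- r) F i w) = \sum_(i <- r) coefs_eval n (F i).
Proof.
by rewrite /coefs_eval exchange_big; apply: eq_bigr => w _ /=; rewrite scaler_suml.
Qed.

Lemma eq_coefs_eval n f g : (forall w, size w = n -> f w = g w) ->
  coefs_eval n f = coefs_eval n g.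
Proof. by move=> fg; apply: eq_bigr => w _; rewrite fg// size_tuple. Qed.

Let b_swap i j : b i * b j = qswap i j *: (b j * b i).
Proof.
rewrite /qswap; case: ltngtP => [ij|ji|/val_inj ->]; last by rewrite eqxx scale1r.
  exact: bq.
have -> : (i == j) = false by apply/eqP => e; rewrite e ltnn in ji.
by rewrite (bq ji) scalerA QiQ scale1r.
Qed.

(** The induction of [hdot_qcreate] again, with left multiplication by the b_i in place of the
    pairing with the L_i h: only the q-commutation rule is used of either. *)
Lemma coefs_eval_qcreate n j f : qsym q f ->
  coefs_eval n (fun w => qcreate w j f) =
  (qint n)%:C *: (b j * coefs_eval n.-1 f).
Proof.
elim: n j f => [|n IH] j f fq.
  rewrite qint0 scale0r /coefs_eval.
  by rewrite (sum_tuple0 (fun w => qcreate w j f *: monom_eval w)) scale0r.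
rewrite coefs_evalS /=.
have dj : b j * coefs_eval n (annih j (fun w => qcreate w j f)) =
    (qint n)%:C *: (\sum_k qweight j k *: (b j * b k * coefs_eval n.-1 (annih k f)))
    + P ^+ n *: (b j * coefs_eval n f).
  rewrite annih_qcreate eqxx coefs_evalD coefs_eval_sum mulrDr; congr (_ + _).
    rewrite mulr_sumr scaler_sumr; apply: eq_bigr => k _.
    rewrite coefs_evalZ IH; last exact: qsym_annih.
    by rewrite -!scalerAr !scalerA mulrC mulrA.
  rewrite scalerAr; congr (_ * _); rewrite -coefs_evalZ.
  by apply: eq_coefs_eval => w ->.
have di i : i != j -> b i * coefs_eval n (annih i (fun w => qcreate w j f)) =
    (qint n)%:C *: ((Qi * qswap i j) *: (b j * b i * coefs_eval n.-1 (annih i f))).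
  move=> ij; rewrite annih_qcreate (negbTE ij) coefs_evalZ.
  rewrite IH; last exact: qsym_annih.
  set E := coefs_eval _ _.
  have bE : b i * (b j * E) = qswap i j *: (b j * b i * E) by rewrite mulrA b_swap -scalerAl.
  by rewrite -2!scalerAr bE !scalerA; congr (_ *: _); ring.
rewrite (bigD1 j)//= dj (eq_bigr _ di) -scaler_sumr addrAC -scalerDr.
rewrite (bigD1 j)//= qweight_diag scale1r -addrA -big_split /=.
rewrite qintSC scalerDl; congr (_ + _).
transitivity ((qint n)%:C *: \sum_k (b j * (b k * coefs_eval n.-1 (annih k f)))).
  congr (_ *: _); rewrite [RHS](bigD1 j)//= mulrA; congr (_ + _).
  by apply: eq_bigr => k kj; rewrite -scalerDl addrC qweight_swap// scale1r mulrA.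
case: n {IH dj di} => [|n]; first by rewrite qint0 !scale0r.
by rewrite -mulr_sumr -coefs_evalS.
Qed.

End Evaluation.
End Creation.

(** * Operators on the Fock space *)

Section CauchySchwarz.
Variable R : realType.

Lemma sum_mul_sqr_le (I : Type) (r : seq I) (x y : I -> R) :
  (\sum_(i <- r) x i * y i) ^+ 2 <=
  (\sum_(i <- r) x i ^+ 2) * (\sum_(i <- r) y i ^+ 2).
Proof.
have : 0 <= \sum_(i <- r) \sum_(j <- r) (x i * y j - x j * y i) ^+ 2.
  by apply: sumr_ge0 => i _; apply: sumr_ge0 => j _; apply: sqr_ge0.
have -> : \sum_(i <- r) \sum_(j <- r) (x i * y j - x j * y i) ^+ 2 =
    \sum_(i <- r) \sum_(j <- r) x i ^+ 2 * y j ^+ 2 +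
    \sum_(i <- r) \sum_(j <- r) y i ^+ 2 * x j ^+ 2 +
    (- 2) * \sum_(i <- r) \sum_(j <- r) (x i * y i) * (x j * y j).
  rewrite mulr_sumr -!big_split; apply: eq_bigr => i _ /=.
  rewrite mulr_sumr -!big_split; apply: eq_bigr => j _ /=; ring.
rewrite -!big_distrlr /= expr2; nra.
Qed.

Lemma sum_mul_le_sqrt (I : Type) (r : seq I) (x y : I -> R) :
  \sum_(i <- r) x i * y i <=
  Num.sqrt (\sum_(i <- r) x i ^+ 2) * Num.sqrt (\sum_(i <- r) y i ^+ 2).
Proof.
have S0 (z : I -> R) : 0 <= \sum_(i <- r) z i ^+ 2.
  by apply: sumr_ge0 => i _; apply: sqr_ge0.
rewrite -sqrtrM// (le_trans (ler_norm _))// -sqrtr_sqr.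
by apply: ler_wsqrtr; exact: sum_mul_sqr_le.
Qed.

Lemma normc_sum (I : Type) (r : seq I) (F : I -> R[i]) :
  Normc.normc (\sum_(i <- r) F i) <= \sum_(i <- r) Normc.normc (F i).
Proof.
elim: r => [|i r IH]; first by rewrite !big_nil Normc.normc0.
by rewrite !big_cons; apply: (le_trans (le_normcD _ _)); rewrite lerD2l.
Qed.

Lemma normc_conj (a : R[i]) : Normc.normc a^* = Normc.normc a.
Proof. by case: a => x y; rewrite /= sqrrN. Qed.

Lemma normc_sum_mul_conj (I : Type) (r : seq I) (F G : I -> R[i]) :
  Normc.normc (\sum_(i <- r) F i * (G i)^*) <=
  Num.sqrt (\sum_(i <- r) Normc.normc (F i) ^+ 2) *
  Num.sqrt (\sum_(i <- r) Normc.normc (G i) ^+ 2).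
Proof.
apply: (le_trans (normc_sum _ _)).
under eq_bigr do rewrite Normc.normcM normc_conj.
exact: sum_mul_le_sqrt.
Qed.

Lemma normc_hdot N n (f g : coefs R N) :
  Normc.normc (hdot n f g) <= Num.sqrt (hnormsq n f) * Num.sqrt (hnormsq n g).
Proof. exact: normc_sum_mul_conj. Qed.

End CauchySchwarz.

Section FockSpace.
Variables (R : realType) (N : nat) (q : R).
Implicit Types (u v w : fock N q) (i j k : 'I_N).

Lemma fnorm_ge0 u : 0 <= fnorm u.
Proof. exact: sqrtr_ge0. Qed.

Lemma fnorm_add u v : fnorm (u + v) <= fnorm u + fnorm v.
Proof. by have := fnormD u v; rewrite -rmorphD lecR. Qed.

Lemma fnorm_scale a u : fnorm (a *: u) = Normc.normc a * fnorm u.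
Proof.
by apply: (@complexI R); rewrite [LHS]fnormZ real_complexM.
Qed.

Lemma fnorm_sqr_series u n : series (fun m => hnormsq m u) n <= fnorm u ^+ 2.
Proof.
have [_ us] := fockP u.
have s0 : 0 <= series (fun m => hnormsq m u) n.
  by apply: sumr_ge0 => k _; apply: hnormsq_ge0.
rewrite -[leLHS]sqr_sqrtr// ler_sqr ?nnegrE ?sqrtr_ge0//.
exact: series_le_l2norm.
Qed.

Lemma fnorm_le u (M : R) : 0 <= M ->
  (forall n, series (fun m => hnormsq m u) n <= M ^+ 2) -> fnorm u <= M.
Proof.
move=> M0 H; apply: (proj2 (@l2norm_le _ _ _ M M0 _)) => n.
by rewrite -[leRHS]ger0_norm// -sqrtr_sqr; apply: ler_wsqrtr.
Qed.

Lemma fock_qsym u : qsym q u.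
Proof.
by have [uH _] := fockP u; apply: component_qsym => n; exact: Hsub_qsym (uH n).
Qed.

Lemma fock_predI (f : coefs R N) : qsym q f -> square_summable f -> fock_pred q f.
Proof.
move=> fq fs; split=> // n; apply: qsym_Hsub; last exact: qsym_component.
by move=> w; rewrite /component => /negbTE ->.
Qed.

Lemma annih_fock i u : fock_pred q (annih i u).
Proof.
apply: fock_predI; first exact/qsym_annih/fock_qsym.
apply: (@square_summableP _ _ _ (fnorm u ^+ 2)) => n.
apply: le_trans (fnorm_sqr_series u n.+1).
rewrite /series /= big_nat_recl//= -[leLHS]add0r; apply: lerD; first exact: hnormsq_ge0.
apply: ler_sum => k _; rewrite hnormsqS (bigD1 i)//= lerDl.
by apply: sumr_ge0 => j _; exact: hnormsq_ge0.
Qed.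

Definition annih_op i u : fock N q := Fock (annih_fock i u).

Lemma hnormsq_creation n i u : hnormsq n.+1 (creation q i u) <= hnormsq n u.
Proof.
rewrite (@eq_hnormsq _ _ _ _ (component n.+1 (creation_coefs q i u))); last first.
  by move=> w <-; rewrite /component eqxx.
rewrite component_creation (le_trans (hnormsq_Hproj _ _ _))// -(hnormsq_tensor i u n).
rewrite le_eqVlt (@eq_hnormsq _ _ _ _ (tensor (monom R [:: i]) u)) ?eqxx//.
by move=> w <-; rewrite /component eqxx.
Qed.

Lemma creation_nil i u : fock_val (creation q i u) [::] = 0.
Proof.
have : hnormsq 0 (creation q i u) <= 0.
  rewrite (@eq_hnormsq _ _ _ _ (component 0 (creation_coefs q i u))); last first.
    by move=> w <-; rewrite /component eqxx.
  rewrite component_creation (le_trans (hnormsq_Hproj _ _ _))//.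
  rewrite /hnormsq big1// => w _; rewrite (tuple0 w) /component /= tensor_monom1.
  by rewrite Normc.normc0 expr0n.
rewrite /hnormsq (sum_tuple0 (fun w : word N => Normc.normc (fock_val (creation q i u) w) ^+ 2)) => H.
apply: Normc.eq0_normc; apply/eqP; rewrite -sqrf_eq0; apply/eqP/le_anti.
by rewrite H sqr_ge0.
Qed.

Lemma fnorm_creation i u : fnorm (creation q i u) <= fnorm u.
Proof.
apply: fnorm_le => [|n]; first exact: fnorm_ge0.
case: n => [|n]; first by rewrite /series /= big_geq// sqr_ge0.
apply: le_trans (fnorm_sqr_series u n).
rewrite /series /= big_nat_recl//= [X in X + _](_ : _ = 0) ?add0r.
  by apply: ler_sum => k _; exact: hnormsq_creation.
rewrite /hnormsq (sum_tuple0 (fun w : word N => Normc.normc (fock_val (creation q i u) w) ^+ 2)).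
by rewrite creation_nil Normc.normc0 expr0n.
Qed.

(** [fdot] is a pair of limits with a meaningless value in case of divergence, so convergence is
    carried along with the value. *)
Definition fdot_cvg_to u v (z : R[i]) :=
  series (fun n => complex.Re (hdot n u v)) @ \oo --> complex.Re z /\
  series (fun n => complex.Im (hdot n u v)) @ \oo --> complex.Im z.

Lemma fdot_eq u v z : fdot_cvg_to u v z -> fdot u v = z.
Proof.
move=> [Hr Hi]; rewrite /fdot (cvg_lim (@Rhausdorff R) Hr) (cvg_lim (@Rhausdorff R) Hi).
by case: z {Hr Hi}.
Qed.

Lemma series_normc_hdot u v n :
  series (fun m => Normc.normc (hdot m u v)) n <= fnorm u * fnorm v.
Proof.
apply: (@le_trans _ _ (\sum_(0 <= k < n) Num.sqrt (hnormsq k u) * Num.sqrt (hnormsq k v))).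
  by apply: ler_sum => k _; exact: normc_hdot.
apply: (le_trans (sum_mul_le_sqrt _ _ _)).
have E (z : fock N q) : Num.sqrt (\sum_(0 <= k < n) Num.sqrt (hnormsq k z) ^+ 2) <= fnorm z.
  rewrite -[leRHS]ger0_norm ?fnorm_ge0// -sqrtr_sqr; apply: ler_wsqrtr.
  apply: le_trans (fnorm_sqr_series z n); apply: ler_sum => k _.
  by rewrite sqr_sqrtr// hnormsq_ge0.
by apply: ler_pM; rewrite ?sqrtr_ge0.
Qed.

Lemma cvg_series_bounded (a b : nat -> R) (M : R) :
  (forall n, `|a n| <= b n) -> (forall n, series b n <= M) -> cvgn (series a).
Proof.
move=> ab bM; apply: normed_cvg.
suff : cvgn (series (fun n => `|a n|)) by [].
apply: nondecreasing_is_cvgn.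
  by apply/nondecreasing_seqP => n; rewrite /series /= big_nat_recr//= lerDl.
exists M => _ [n _ <-]; apply: le_trans (bM n).
by apply: ler_sum => k _; exact: ab.
Qed.

Lemma fdotP u v : fdot_cvg_to u v (fdot u v).
Proof.
split; rewrite /fdot /=; apply: cvg_series_bounded (series_normc_hdot u v) => n.
  exact: Re_le_normc.
exact: Im_le_normc.
Qed.

Lemma Re_fdot_le u v : complex.Re (fdot u v) <= fnorm u * fnorm v.
Proof.
have [Hr _] := fdotP u v.
rewrite -(cvg_lim (@Rhausdorff R) Hr); apply: limr_le; first by apply/cvg_ex; eexists; exact: Hr.
apply: nearW => n; apply: le_trans (series_normc_hdot u v n).
apply: ler_sum => k _; exact: le_trans (ler_norm _) (Re_le_normc _).
Qed.

Lemma Re_fdot_self u : complex.Re (fdot u u) = fnorm u ^+ 2.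
Proof.
have [_ us] := fockP u.
rewrite /fnorm /l2norm sqr_sqrtr; last exact: lim_hnormsq_ge0.
rewrite /fdot /=; congr (limn (series _)); apply/funext => n.
by rewrite -hnormsq_hdot.
Qed.

Lemma fdotDZr u a v w : fdot u (a *: v + w) = a^* * fdot u v + fdot u w.
Proof.
apply: fdot_eq; have [Hvr Hvi] := fdotP u v; have [Hwr Hwi] := fdotP u w.
have E n : hdot n u (a *: v + w) = a^* * hdot n u v + hdot n u w.
  by rewrite -hdotZr -hdotDr.
case: (fdot u v) Hvr Hvi => z1 z2 /= Hvr Hvi; case: (fdot u w) Hwr Hwi => y1 y2 /= Hwr Hwi.
case: a E => a1 a2 E.
split.
- have -> : series (fun n => complex.Re (hdot n u ((a1 +i* a2) *: v + w))) =
    (fun n => a1 * series (fun n => complex.Re (hdot n u v)) n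
     + a2 * series (fun n => complex.Im (hdot n u v)) n
     + series (fun n => complex.Re (hdot n u w)) n).
    apply/funext => n; rewrite /series /= !mulr_sumr -!big_split /=; apply: eq_bigr => k _.
    rewrite E; case: (hdot k u v) => x y; case: (hdot k u w) => x' y' /=; ring.
  have -> : complex.Re ((a1 +i* a2)^* * (z1 +i* z2) + (y1 +i* y2)) = a1 * z1 + a2 * z2 + y1 by rewrite /=; ring.
  by apply: cvgD => //; apply: cvgD; apply: cvgMl_tmp.
- have -> : series (fun n => complex.Im (hdot n u ((a1 +i* a2) *: v + w))) =
    (fun n => a1 * series (fun n => complex.Im (hdot n u v)) n
     + (- a2) * series (fun n => complex.Re (hdot n u v)) n
     + series (fun n => complex.Im (hdot n u w)) n).
    apply/funext => n; rewrite /series /= !mulr_sumr -!big_split /=; apply: eq_bigr => k _.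
    rewrite E; case: (hdot k u v) => x y; case: (hdot k u w) => x' y' /=; ring.
  have -> : complex.Im ((a1 +i* a2)^* * (z1 +i* z2) + (y1 +i* y2)) = a1 * z2 + (- a2) * z1 + y2 by rewrite /=; ring.
  by apply: cvgD => //; apply: cvgD; apply: cvgMl_tmp.
Qed.

End FockSpace.

Section FockOperators.
Variables (R : realType) (N : nat) (q : R).
Hypothesis q0 : 0 < q.
Implicit Types (u v : fock N q) (w : word N) (i j k : 'I_N) (x y z : op N q).

(** Replaces the projection, which is given by a choice, by a formula: G_i u / [n] is q-symmetric,
    and by [hdot_qcreate] it has the same pairings with H_n as the tensor product of X_i and u. *)
Lemma creation_val i u w : fock_val (creation q i u) w =
  (qint q (size w))^-1%:C * qcreate q w i u.
Proof.
rewrite /= /creation_coefs; set n := size w.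
pose g : coefs R N := component n (fun w => (qint q n)^-1%:C * qcreate q w i u).
rewrite (@Hproj_eq _ _ _ _ _ g); first by rewrite /g /component eqxx.
  apply: qsym_Hsub; first by move=> w'; rewrite /g /component => /negbTE ->.
  by apply/qsym_component/qsymZ/qsym_qcreate => //; exact: fock_qsym.
move=> h hH; have hq := Hsub_qsym hH.
have -> : hdot n (fun w0 => component n (tensor (monom R [:: i]) u) w0 - g w0) h =
   hdot n (tensor (monom R [:: i]) u) h + (- (qint q n)^-1)%:C * hdot n (fun w => qcreate q w i u) h.
  rewrite -hdotZ -hdotD; apply: eq_hdot => w' wn.
  rewrite /g /component wn eqxx; congr (_ + _); rewrite -mulNr; congr (_ * _).
  exact/esym/(rmorphN (real_complex R)).
rewrite (hdot_qcreate q0 n i (fock_qsym u) hq) mulrA -real_complexM.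
(* In degree 0 the factor [0] is not invertible, but both pairings vanish. *)
case: n {g hH} => [|n].
  rewrite qint0 mulr0 mul0r addr0 /hdot (sum_tuple0 (fun w => tensor (monom R [:: i]) u w * (h w)^*)).
  by rewrite tensor_monom1 mul0r.
have -> : - (qint q n.+1)^-1 * qint q n.+1 = -1 by rewrite mulNr mulVf// gt_eqF// qint_gt0.
rewrite hdotS (bigD1 i)//= big1 ?addr0; last first.
  move=> j ji; rewrite /hdot big1// => w' _; rewrite /annih tensor_monom1 (negbTE ji).
  by rewrite !mul0r.
have -> : hdot n (annih i (tensor (monom R [:: i]) u)) (annih i h) = hdot n u (annih i h).
  by apply: eq_hdot => w' _; rewrite /annih tensor_monom1 eqxx mul1r.
have -> : (-1)%:C = -1 :> R[i] by exact: (rmorphN1 (real_complex R)).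
by rewrite mulN1r subrr.
Qed.

Lemma hdot_creation n i u (h : coefs R N) : qsym q h ->
  hdot n.+1 (creation q i u) h = hdot n u (annih i h).
Proof.
move=> hq; transitivity ((qint q n.+1)^-1%:C * hdot n.+1 (fun w => qcreate q w i u) h).
  by rewrite -hdotZ; apply: eq_hdot => w wn; rewrite creation_val wn.
rewrite (hdot_qcreate q0 n.+1 i (fock_qsym u) hq) mulrA -real_complexM mulVf ?mul1r//.
by rewrite gt_eqF// qint_gt0.
Qed.

Lemma hdot0_creation i u (h : coefs R N) : hdot 0 (creation q i u) h = 0.
Proof.
rewrite /hdot (sum_tuple0 (fun w => fock_val (creation q i u) w * (h w)^*)).
by rewrite creation_nil mul0r.
Qed.

Lemma adjoint_creation i : adjoint (creation q i) (@annih_op R N q i).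
Proof.
move=> u v; apply: fdot_eq; have [Hr Hi] := fdotP u (annih_op i v).
have E n : hdot n.+1 (creation q i u) v = hdot n u (annih_op i v).
  by rewrite hdot_creation//; exact: fock_qsym.
split; rewrite -cvg_shiftS.
- have -> : [sequence series (fun n => complex.Re (hdot n (creation q i u) v)) n.+1]_n =
    series (fun n => complex.Re (hdot n u (annih_op i v))).
    apply/funext => n; rewrite /series /= big_nat_recl//= hdot0_creation add0r.
    by apply: eq_bigr => k _; rewrite E.
  exact: Hr.
- have -> : [sequence series (fun n => complex.Im (hdot n (creation q i u) v)) n.+1]_n =
    series (fun n => complex.Im (hdot n u (annih_op i v))).
    apply/funext => n; rewrite /series /= big_nat_recl//= hdot0_creation add0r.
    by apply: eq_bigr => k _; rewrite E.
  exact: Hi.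
Qed.

Lemma creation_linear i : linear (creation q i).
Proof.
move=> a u v; apply/fock_inj/funext => w.
rewrite creation_val.
transitivity (a * fock_val (creation q i u) w + fock_val (creation q i v) w); last by [].
rewrite !creation_val.
have -> : fock_val (a *: u + v) = fun w => a * fock_val u w + fock_val v w by [].
by rewrite qcreateD qcreateZ; ring.
Qed.

Fact vacuum_fock : fock_pred q (monom R (Nil 'I_N)).
Proof.
apply: fock_predI.
  by move=> u v i j ij; rewrite /monom; case: u => [|k u]; rewrite /= mulr0.
apply: (@square_summableP _ _ _ 1) => n.
case: n => [|n]; first by rewrite /series /= big_geq// ler01.
rewrite /series /= big_nat_recl//= big1 ?addr0; last first.
  move=> k _; rewrite /hnormsq big1// => w _; rewrite /monom.
  by case/tupleP: w => i w; rewrite mulr0n Normc.normc0 expr0n.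
rewrite /hnormsq (sum_tuple0 (fun w => Normc.normc (monom R [::] w) ^+ 2)).
by rewrite /monom eqxx Normc.normc1 expr1n.
Qed.

Definition vacuum : fock N q := Fock vacuum_fock.

(** The projection of the monomial w. By [fdot_kernel_vec] it is a reproducing kernel: pairing with
    it gives the coefficient at w. *)
Definition kernel_vec w : fock N q := foldr (fun i u => creation q i u) vacuum w.

Lemma hdot_kernel_vec n w (h : coefs R N) : qsym q h ->
  hdot n (kernel_vec w) h = if n == size w then (h w)^* else 0.
Proof.
elim: w n h => [|i w IH] [|n] h hq /=.
- by rewrite /hdot (sum_tuple0 (fun w => monom R [::] w * (h w)^*)) /monom eqxx mul1r.
- rewrite /hdot big1// => w _; rewrite /monom.
  by case/tupleP: w => i w; rewrite /= mul0r.
- exact: hdot0_creation.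
- by rewrite hdot_creation// IH ?eqSS//; exact: qsym_annih.
Qed.

Lemma cvg_series_single m (c : R) :
  series (fun n => if n == m then c else 0) @ \oo --> c.
Proof.
apply: cvg_near_cst; exists m.+1 => // n /= mn.
rewrite /series /= (bigD1_seq m) ?iota_uniq//=; last by rewrite mem_index_iota.
by rewrite eqxx big1 ?addr0// => k /negbTE ->.
Qed.

Lemma fdot_kernel_vec w v : fdot (kernel_vec w) v = (fock_val v w)^*.
Proof.
apply: fdot_eq; have E n := hdot_kernel_vec n w (fock_qsym v).
split.
- rewrite (_ : (fun n => _) = (fun n => if n == size w then complex.Re (fock_val v w)^* else 0)).
    exact: cvg_series_single.
  by apply/funext => n; rewrite E; case: eqP.
- rewrite (_ : (fun n => _) = (fun n => if n == size w then complex.Im (fock_val v w)^* else 0)).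
    exact: cvg_series_single.
  by apply/funext => n; rewrite E; case: eqP.
Qed.

(** The coefficient of y z at w is, up to conjugation, the pairing of x ([kernel_vec] w) with z. *)
Lemma adjoint_linear x y : adjoint x y -> linear y.
Proof.
move=> xy a u v; apply/fock_inj/funext => w.
have E (z : fock N q) : fock_val (y z) w = (fdot (x (kernel_vec w)) z)^*.
  by rewrite xy fdot_kernel_vec conjCK.
transitivity (a * fock_val (y u) w + fock_val (y v) w); last by [].
by rewrite !E fdotDZr cconjD cconjM conjCK.
Qed.

Lemma bounded_opP x : bounded_op x ->
  exists2 M, 0 <= M & forall u, fnorm (x u) <= M * fnorm u.
Proof.
move=> [_ [M H]]; exists `|M| => // u; apply: (le_trans (H u)).
by apply: ler_wpM2r; [exact: fnorm_ge0 | exact: ler_norm].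
Qed.

Lemma adjoint_bounded x y : bounded_op x -> adjoint x y -> bounded_op y.
Proof.
move=> xb xy; split; first exact: adjoint_linear xy.
have [M M0 xM] := bounded_opP xb; exists M => v.
have := fnorm_ge0 (y v); rewrite le_eqVlt => /predU1P[<-|y0].
  by rewrite mulr_ge0// fnorm_ge0.
rewrite -(ler_pM2r y0) -expr2 -Re_fdot_self -xy.
apply: (le_trans (Re_fdot_le _ _)); rewrite mulrAC.
by apply: ler_wpM2r; [exact: fnorm_ge0 | exact: xM].
Qed.

Lemma bounded_op_cstar : is_cstar_op_subalg (@bounded_op R N q).
Proof.
split=> //.
- by split=> //; exists 1 => u; rewrite mul1r.
- move=> a x y xb yb; split=> [c u v|].
    have [[xl _] [yl _]] := (xb, yb); rewrite /= xl yl.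
    apply/fock_inj/funext => w /=; ring.
  have [M M0 xM] := bounded_opP xb; have [K K0 yK] := bounded_opP yb.
  exists (Normc.normc a * M + K) => u /=; rewrite mulrDl.
  apply: (le_trans (fnorm_add _ _)); rewrite fnorm_scale; apply: lerD => //.
  by rewrite -mulrA ler_wpM2l// normc_ge0.
- move=> x y xb yb; split=> [c u v|].
    by have [[xl _] [yl _]] := (xb, yb); rewrite /= yl xl.
  have [M M0 xM] := bounded_opP xb; have [K K0 yK] := bounded_opP yb.
  exists (M * K) => u /=; apply: (le_trans (xM _)).
  by rewrite -mulrA ler_wpM2l.
- by split=> // x y; exact: adjoint_bounded.
Qed.

Lemma op_norm_lbound x :
  lbound [set M | 0 <= M /\ forall u, fnorm (x u) <= M * fnorm u] 0.
Proof. by move=> M []. Qed.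

Lemma op_norm_ge0 x : bounded_op x -> 0 <= op_norm x.
Proof.
move=> /bounded_opP[M M0 xM]; apply: lb_le_inf; first by exists M.
exact: op_norm_lbound.
Qed.

Lemma op_normP x u : bounded_op x -> fnorm (x u) <= op_norm x * fnorm u.
Proof.
move=> xb; have [M M0 xM] := bounded_opP xb.
have := fnorm_ge0 u; rewrite le_eqVlt => /predU1P[u0|u0].
  by have := xM u; rewrite -u0 !mulr0.
rewrite -ler_pdivrMr//; apply: lb_le_inf; first by exists M.
by move=> K [_ xK]; rewrite ler_pdivrMr.
Qed.

Lemma toeplitz_bounded x : toeplitz x -> bounded_op x.
Proof.
move=> /(_ (@bounded_op R N q)); apply; split; first exact: bounded_op_cstar.
move=> _ [i _ <-]; split; first exact: creation_linear.
by exists 1 => u; rewrite mul1r fnorm_creation.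
Qed.

Lemma toeplitz_creation i : toeplitz (creation q i).
Proof. by move=> M [_ ]; apply; exists i. Qed.

Lemma toeplitz_id : toeplitz (idfun : op N q).
Proof. by move=> M [[]]. Qed.

Lemma toeplitzL (a : R[i]) x y : toeplitz x -> toeplitz y ->
  toeplitz ((a \*: x) \+ y).
Proof. by move=> xT yT M [MC Ms]; case: (MC) => _ _ H _ _; apply: H; [exact: xT|exact: yT]. Qed.

Lemma toeplitzM x y : toeplitz x -> toeplitz y -> toeplitz (x \o y).
Proof. by move=> xT yT M [MC Ms]; case: (MC) => _ _ _ H _; apply: H; [exact: xT|exact: yT]. Qed.

Lemma toeplitz_adjoint x y : toeplitz x -> adjoint x y -> toeplitz y.
Proof. by move=> xT xy M [MC Ms]; case: (MC) => _ _ _ _ [H _]; apply: H xy; exact: xT. Qed.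

Lemma toeplitz_closed x : bounded_op x ->
  (forall e : R, 0 < e -> exists2 y, toeplitz y & op_norm (x \- y) <= e) ->
  toeplitz x.
Proof.
move=> xb H M [MC Ms]; case: (MC) => _ _ _ _ [_ cl]; apply: cl => // e e0.
by have [y yT xy] := H e e0; exists y => //; exact: yT.
Qed.

Lemma toeplitz_annih i : toeplitz (@annih_op R N q i).
Proof. exact: toeplitz_adjoint (toeplitz_creation i) (@adjoint_creation i). Qed.

End FockOperators.

(** * Compact operators *)

Section UltrafilterLimits.
Variable R : realType.

Lemma ultra_bounded_cvg (T : Type) (F : set_system T) (f : T -> R) (d : R) :
  UltraFilter F -> F [set x | `|f x| <= d] -> exists l : R, f @ F --> l.
Proof.
move=> FU Fd; have FP : ProperFilter F := ultra_proper.
have Fs : F (f @^-1` `[- d, d]%classic).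
  by move: Fd; apply: filterS => x /=; rewrite ler_norml in_itv.
have [p [_ cp]] := @segment_compact R (- d) d (f @ F) _ Fs.
exists p => A pA; have [//|FnA] := in_ultra_setVsetC (f @^-1` A) FU.
by have [y []] := cp (~` A) A FnA pA.
Qed.

Lemma cvgR_unique (T : Type) (F : set_system T) (f : T -> R) (a b : R) :
  ProperFilter F -> f @ F --> a -> f @ F --> b -> a = b.
Proof.
by move=> FP ha hb; rewrite -(cvg_lim (@Rhausdorff R) ha) (cvg_lim (@Rhausdorff R) hb).
Qed.

Lemma cvg_sum_fun (T : Type) (F : set_system T) (I : Type) (r : seq I)
    (f : I -> T -> R) (l : I -> R) : Filter F ->
  (forall i, f i @ F --> l i) ->
  (fun x => \sum_(i <- r) f i x) @ F --> \sum_(i <- r) l i.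
Proof.
move=> FF fl; elim: r => [|i r IH].
  rewrite big_nil (_ : (fun _ => _) = cst 0); first exact: cvg_cst.
  by apply/funext => x; rewrite big_nil.
rewrite big_cons (_ : (fun _ => _) = (fun x => f i x + \sum_(i <- r) f i x)).
  exact: cvgD.
by apply/funext => x; rewrite big_cons.
Qed.

Lemma normc_sqr (z : R[i]) :
  Normc.normc z ^+ 2 = complex.Re z ^+ 2 + complex.Im z ^+ 2.
Proof. by case: z => x y /=; rewrite sqr_sqrtr// addr_ge0 ?sqr_ge0. Qed.

Lemma normc_sqr_sub (z y : R[i]) : Normc.normc (z - y) ^+ 2 <=
  2 * Normc.normc z ^+ 2 + 2 * Normc.normc y ^+ 2.
Proof.
rewrite !normc_sqr; case: z y => [a b] [c d] /=.
have := sqr_ge0 (a + c); have := sqr_ge0 (b + d); nra.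
Qed.

End UltrafilterLimits.

Section CompactTails.
Variables (R : realType) (N : nat) (q : R).
Implicit Types (u v : fock N q) (w : word N).
Variable tail : nat -> R -> Prop.
Hypothesis tail_small : forall e, 0 < e -> exists n d, [/\ tail n d, 0 <= d & d <= e].
Hypothesis tail_bounded : exists2 d, 0 <= d & tail 0 d.

(** [tail n d] prescribes the bound d for the norm of the part of degree at least n. Every degree is
    finite dimensional, so uniformly small tails give a compact set. *)
Definition tail_set : set (fock N q) := [set v | forall n d, tail n d ->
  forall m, \sum_(n <= k < m) hnormsq k v <= d ^+ 2].

Section Limit.
Variable F : set_system (fock N q).
Hypothesis FU : UltraFilter F.
Hypothesis FT : F tail_set.

Let FP : ProperFilter F. Proof. exact: ultra_proper. Qed.

Let val_bound w : exists2 d, 0 <= d & F [set v | Normc.normc (fock_val v w) <= d].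
Proof.
have [d d0 td] := tail_bounded; exists d => //; apply: filterS FT => v vT /=.
rewrite -ler_sqr ?nnegrE ?normc_ge0//; apply: le_trans (vT 0%N d td (size w).+1).
rewrite big_nat_recr//= -[leLHS]add0r; apply: lerD.
  by apply: sumr_ge0 => k _; exact: hnormsq_ge0.
rewrite /hnormsq (bigD1 (in_tuple w))//= lerDl.
by apply: sumr_ge0 => *; exact: sqr_ge0.
Qed.

Let limRe_ex w : exists l : R, (fun v => complex.Re (fock_val v w)) @ F --> l.
Proof.
have [d _ Fd] := val_bound w; apply: (@ultra_bounded_cvg _ _ _ _ d) => //.
by apply: filterS Fd => v /=; apply: le_trans; exact: Re_le_normc.
Qed.

Let limIm_ex w : exists l : R, (fun v => complex.Im (fock_val v w)) @ F --> l.
Proof.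
have [d _ Fd] := val_bound w; apply: (@ultra_bounded_cvg _ _ _ _ d) => //.
by apply: filterS Fd => v /=; apply: le_trans; exact: Im_le_normc.
Qed.

Let lim : coefs R N := fun w => sval (cid (limRe_ex w)) +i* sval (cid (limIm_ex w)).

Let limRe w : (fun v => complex.Re (fock_val v w)) @ F --> complex.Re (lim w).
Proof. exact: svalP (cid (limRe_ex w)). Qed.

Let limIm w : (fun v => complex.Im (fock_val v w)) @ F --> complex.Im (lim w).
Proof. exact: svalP (cid (limIm_ex w)). Qed.

Let lim_qsym : qsym q lim.
Proof.
move=> a b i j ij; set w1 := a ++ i :: _; set w2 := a ++ j :: _.
have E v : fock_val v w1 = q%:C * fock_val v w2 by exact: fock_qsym.
have Er : complex.Re (lim w1) = q * complex.Re (lim w2).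
  apply: (cvgR_unique FP (@limRe w1)).
  rewrite (_ : (fun v => _) = (fun v => q * complex.Re (fock_val v w2))).
    exact: cvgMl_tmp (@limRe w2).
  by apply/funext => v; rewrite E; case: (fock_val v w2) => x y /=; ring.
have Ei : complex.Im (lim w1) = q * complex.Im (lim w2).
  apply: (cvgR_unique FP (@limIm w1)).
  rewrite (_ : (fun v => _) = (fun v => q * complex.Im (fock_val v w2))).
    exact: cvgMl_tmp (@limIm w2).
  by apply/funext => v; rewrite E; case: (fock_val v w2) => x y /=; ring.
case: (lim w1) (lim w2) Er Ei => [x y] [x' y'] /= -> ->.
by apply/eqP; rewrite eq_complex /=; apply/andP; split; apply/eqP; ring.
Qed.

Let lim_normsq k : (fun v => hnormsq k v) @ F --> hnormsq k lim.
Proof.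
apply: cvg_sum_fun => w; rewrite normc_sqr.
rewrite (_ : (fun v => _) = (fun v => complex.Re (fock_val v w) * complex.Re (fock_val v w) + complex.Im (fock_val v w) * complex.Im (fock_val v w))).
  by rewrite !expr2; apply: cvgD; apply: cvgM => //.
by apply/funext => v; rewrite normc_sqr !expr2.
Qed.

Let lim_tail n d m : tail n d -> \sum_(n <= k < m) hnormsq k lim <= d ^+ 2.
Proof.
move=> nd.
have H : (fun v => \sum_(n <= k < m) hnormsq k v) @ F --> \sum_(n <= k < m) hnormsq k lim.
  by apply: cvg_sum_fun => k.
rewrite -(cvg_lim (@Rhausdorff R) H); apply: limr_le.
  by apply/cvg_ex; eexists; exact: H.
by apply: filterS FT => v vT; exact: vT.
Qed.

Let lim_fock : fock_pred q lim.
Proof.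
apply: fock_predI => //; have [d d0 td] := tail_bounded.
apply: (@square_summableP _ _ _ (d ^+ 2)) => n; exact: lim_tail.
Qed.

Let limv : fock N q := Fock lim_fock.

Let lim_diff n : (fun v => \sum_(0 <= k < n) hnormsq k (fun w => lim w - fock_val v w)) @ F --> (0 : R).
Proof.
rewrite -[X in _ --> X](_ : \sum_(0 <= k < n) \sum_(w : k.-tuple 'I_N) (0 : R) = 0); last first.
  by rewrite big1// => k _; rewrite big1.
apply: cvg_sum_fun => k; apply: cvg_sum_fun => w.
rewrite (_ : (fun v => _) = (fun v => (complex.Re (lim w) - complex.Re (fock_val v w)) * (complex.Re (lim w) - complex.Re (fock_val v w))
  + (complex.Im (lim w) - complex.Im (fock_val v w)) * (complex.Im (lim w) - complex.Im (fock_val v w)))).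
  have r0 : (fun v => complex.Re (lim w) - complex.Re (fock_val v w)) @ F --> (0 : R).
    by rewrite -(subrr (complex.Re (lim w))); apply: cvgB; [exact: cvg_cst | exact: limRe].
  have i0 : (fun v => complex.Im (lim w) - complex.Im (fock_val v w)) @ F --> (0 : R).
    by rewrite -(subrr (complex.Im (lim w))); apply: cvgB; [exact: cvg_cst | exact: limIm].
  have -> : 0 = 0 * 0 + 0 * 0 :> R by rewrite mulr0 addr0.
  by apply: cvgD; apply: cvgM.
apply/funext => v; rewrite normc_sqr -!expr2.
by case: (lim w) (fock_val v w) => [a b] [c d].
Qed.

(** The limit along the ultrafilter is taken coefficient by coefficient. Convergence in norm holds
    because a head consists of finitely many coefficients, while the tail bounds hold uniformly on
    [tail_set] and pass to the limit. *)
Lemma tail_set_limit : exists2 v, tail_set v & F --> v.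
Proof.
exists limv; first by move=> n d nd m; exact: lim_tail.
apply/cvgrPdist_le => eps eps0.
(* The norm of [fock] takes values in [R[i]], where being positive includes being real. *)
have [e [e0 epsE]] : exists e : R, 0 < e /\ eps = e%:C.
  case: eps eps0 => x y; rewrite ltcE /= => /andP[/eqP -> x0]; by exists x.
rewrite epsE.
have e4 : 0 < e / 4 by rewrite divr_gt0.
(* The head costs at most e^2/4, and the tails of the limit and of v cost 4 d^2 <= e^2/4. *)
have [n [d [nd d0 de]]] := tail_small e4.
have e2 : 0 < (e / 2) ^+ 2 by rewrite exprn_gt0// divr_gt0.
have := lim_diff n; move/cvgrPdist_le => /(_ _ e2) near1.
near=> v.
have vT : tail_set v by near: v; exact: FT.
have Hn : `|0 - \sum_(0 <= k < n) hnormsq k (fun w => lim w - fock_val v w)| <= (e / 2) ^+ 2.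
  by near: v; exact: near1.
change ((fnorm (limv - v))%:C <= e%:C); rewrite lecR.
have valE w : fock_val (limv - v) w = lim w - fock_val v w.
  transitivity (lim w + (-1) * fock_val v w); first by [].
  by rewrite mulN1r.
apply: fnorm_le; first exact: ltW.
move=> m; rewrite /series /=.
have hE k : hnormsq k (limv - v) = hnormsq k (fun w => lim w - fock_val v w).
  by apply: eq_hnormsq => w _; rewrite valE.
under eq_bigr do rewrite hE.
have head : \sum_(0 <= k < n) hnormsq k (fun w => lim w - fock_val v w) <= (e / 2) ^+ 2.
  by move: Hn; rewrite sub0r normrN; apply: le_trans; exact: ler_norm.
have pos k : 0 <= hnormsq k (fun w => lim w - fock_val v w) by exact: hnormsq_ge0.
have le1 : \sum_(0 <= k < m) hnormsq k (fun w => lim w - fock_val v w) <=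
  \sum_(0 <= k < n + m) hnormsq k (fun w => lim w - fock_val v w).
  rewrite [leRHS](@big_cat_nat _ _ _ m)//= ?leq_addl// lerDl.
  by apply: sumr_ge0 => k _.
apply: (le_trans le1); rewrite (@big_cat_nat _ _ _ n)//= ?leq_addr//.
have tl : \sum_(n <= k < n + m) hnormsq k (fun w => lim w - fock_val v w) <= 2 * d ^+ 2 + 2 * d ^+ 2.
  apply: (@le_trans _ _ (2 * \sum_(n <= k < n + m) hnormsq k lim + 2 * \sum_(n <= k < n + m) hnormsq k v)).
    rewrite !mulr_sumr -big_split; apply: ler_sum => k _ /=.
    rewrite /hnormsq !mulr_sumr -big_split; apply: ler_sum => w _ /=.
    exact: normc_sqr_sub.
  by apply: lerD; rewrite ler_pM2l//; [exact: lim_tail | exact: vT].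
apply: (le_trans (lerD head tl)).
have : d ^+ 2 <= (e / 4) ^+ 2 by rewrite ler_sqr ?nnegrE// ltW.
nra.
Unshelve. all: by end_near. Qed.

End Limit.

Lemma compact_tail_set : compact tail_set.
Proof.
rewrite compact_ultra => F FU FT.
by have [v vT Fv] := tail_set_limit FU FT; exists v.
Qed.

End CompactTails.

Section CompactCriterion.
Variables (R : realType) (N : nat) (q : R).
Implicit Types (u v : fock N q) (w : word N).

(** The scalar [eps] in each degree makes the tails of x u uniformly small on the unit ball, whose
    image thus lies in a compact [tail_set]. *)
Lemma compact_op_of_decay (x y : op N q) (eps : nat -> R) (C : R) :
  linear x -> 0 <= C -> (forall u, fnorm (y u) <= C * fnorm u) ->
  (forall e, 0 < e -> exists n0, forall n, (n0 <= n)%N -> `|eps n| <= e) ->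
  (forall u w, fock_val (x u) w = (eps (size w))%:C * fock_val (y u) w) ->
  compact_op x.
Proof.
move=> xl C0 yC epsP xE; split=> //.
pose tail n d := exists e, [/\ 0 <= e, d = e * C & forall k, (n <= k)%N -> `|eps k| <= e].
have ts e : 0 < e -> exists n d, [/\ tail n d, 0 <= d & d <= e].
  move=> e0; have C1 : 0 < C + 1 by rewrite ltr_wpDl.
  have [n0 Hn] := epsP (e / (C + 1)) (divr_gt0 e0 C1).
  have e1 : 0 <= e / (C + 1) by rewrite ltW// divr_gt0.
  exists n0, (e / (C + 1) * C); split; [by exists (e / (C + 1)) | exact: mulr_ge0 |].
  rewrite mulrAC ler_pdivrMr// ler_pM2l//.
  by rewrite lerDl.
have tb : exists2 d, 0 <= d & tail 0 d.
  have [n0 Hn] := epsP 1 ltr01.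
  (* A bound for all [eps k] at once: the finitely many early values are summed, and the others are
     at most 1. *)
  have E0 : 0 <= \sum_(0 <= k < n0) `|eps k| + 1 by rewrite addr_ge0// sumr_ge0.
  exists ((\sum_(0 <= k < n0) `|eps k| + 1) * C); first exact: mulr_ge0.
  exists (\sum_(0 <= k < n0) `|eps k| + 1); split=> // k _.
  have [kn|nk] := ltnP k n0; last by apply: (le_trans (Hn k nk)); rewrite lerDr sumr_ge0.
  rewrite (bigD1_seq k) ?iota_uniq ?mem_index_iota//= -addrA lerDl.
  by rewrite addr_ge0// sumr_ge0.
exists (@tail_set R N q tail); last first.
  have cpt := @compact_tail_set R N q tail ts tb.
  by split=> //; apply: compact_closed => //; exact: norm_hausdorff.
move=> _ [u u1 <-] n d [e [e0 -> He]] m.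
apply: (@le_trans _ _ (\sum_(n <= k < m) e ^+ 2 * hnormsq k (y u))).
  rewrite !big_nat; apply: ler_sum => k /andP[nk km].
  rewrite /hnormsq mulr_sumr; apply: ler_sum => w _.
  rewrite xE size_tuple Normc.normcM exprMn normc_real.
  by apply: ler_wpM2r; [exact: sqr_ge0 | rewrite ler_sqr ?nnegrE// He].
rewrite -mulr_sumr exprMn; apply: ler_wpM2l; first exact: sqr_ge0.
have yu : fnorm (y u) <= C.
  by apply: (le_trans (yC u)); rewrite -[leRHS]mulr1; apply: ler_wpM2l.
apply: (@le_trans _ _ (fnorm (y u) ^+ 2)); last by rewrite ler_sqr ?nnegrE// fnorm_ge0.
apply: le_trans (fnorm_sqr_series (y u) (n + m)).
rewrite /series /= [leRHS](@big_cat_nat _ _ _ n)//= ?leq_addr//.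
rewrite -[leLHS]add0r; apply: lerD; first by apply: sumr_ge0 => k _; exact: hnormsq_ge0.
have [nm|mn] := leqP n m; last first.
  by rewrite big_geq ?(ltnW mn)//; apply: sumr_ge0 => k _; exact: hnormsq_ge0.
rewrite [leRHS](@big_cat_nat _ _ _ m)//= ?leq_addl// lerDl.
by apply: sumr_ge0 => k _; exact: hnormsq_ge0.
Qed.

End CompactCriterion.

(** * The relations in the quotient *)

Section DecaySequence.
Variables (R : realType) (q : R).
Hypothesis q0 : 0 < q.

Definition qdecay n : R := (q^-1 * q^-1) ^+ n / qint q n.+1.

Lemma le_inv_small (c e : R) : 0 <= c -> 0 < e ->
  exists n0, forall n, (n0 <= n)%N -> c / n.+1%:R <= e.
Proof.
move=> c0 e0; exists (Num.truncn (c / e)) => n nn.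
rewrite ler_pdivrMr ?ltr0n// mulrC -ler_pdivrMr//.
apply: (le_trans (ltW (truncnS_gt _))).
by rewrite ler_nat.
Qed.

Lemma qdecay_complement n : 1 - qdecay n = qint q n / qint q n.+1.
Proof.
have g := qint_gt0 q n; rewrite /qdecay qintS in g *.
by field; rewrite gt_eqF.
Qed.

Let p : R := q^-1 * q^-1.

Let p_gt0 : 0 < p. Proof. by rewrite mulr_gt0// invr_gt0. Qed.

Lemma qint_geometric n : (p - 1) * qint q n = p ^+ n - 1.
Proof.
elim: n => [|n IH]; first by rewrite qint0 mulr0 expr0 subrr.
by rewrite qintS mulrDr IH -/p exprS; ring.
Qed.

(** For p <= 1 each of the n + 1 summands of [n+1] is at least p^n, so [qdecay] is at most 1/(n+1).
    This rough bound includes q = 1, where there is no geometric decay. *)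
Lemma qdecay_ge1 (e : R) : 1 <= q -> 0 < e ->
  exists n0, forall n, (n0 <= n)%N -> `|qdecay n - 0| <= e.
Proof.
move=> q1 e0; have [n0 Hn] := le_inv_small ler01 e0; exists n0 => n nn.
have p1 : p <= 1.
  have qi1 : q^-1 <= 1 by rewrite invf_le1.
  by rewrite -[leRHS]mulr1; apply: ler_pM; rewrite // invr_ge0 ltW.
have i0 : 0 < q^-1 by rewrite invr_gt0.
rewrite subr0 /qdecay -/p ger0_norm; last first.
  by rewrite divr_ge0 ?exprn_ge0 ?(ltW p_gt0)// ltW// qint_gt0.
apply: le_trans (Hn n nn).
rewrite ler_pdivrMr ?qint_gt0// mulrAC ler_pdivlMr ?ltr0n// mul1r.
rewrite mulr_natr -[n.+1 in leLHS]card_ord -sumr_const.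
by apply: ler_sum => k _; apply: ler_wiXn2l; rewrite ?(ltW p_gt0)// -ltnS.
Qed.

(** The difference is exactly q^2/[n+1], and [n+1] >= n + 1 as p >= 1. *)
Lemma qdecay_le1 (e : R) : q <= 1 -> 0 < e ->
  exists n0, forall n, (n0 <= n)%N -> `|qdecay n - (1 - q ^+ 2)| <= e.
Proof.
move=> q1 e0; have [n0 Hn] := le_inv_small (sqr_ge0 q) e0; exists n0 => n nn.
have qp : q ^+ 2 * p = 1 by rewrite /p; field; rewrite gt_eqF.
have p1 : 1 <= p.
  have qi1 : 1 <= q^-1 by rewrite invf_ge1.
  by rewrite -[leLHS]mulr1; apply: ler_pM.
have g := qint_gt0 q n.
have -> : qdecay n - (1 - q ^+ 2) = q ^+ 2 / qint q n.+1.
  have G := qint_geometric n.+1.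
  have E : p ^+ n - (1 - q ^+ 2) * qint q n.+1 = q ^+ 2.
    have -> : 1 - q ^+ 2 = q ^+ 2 * (p - 1) by rewrite mulrBr qp mulr1.
    rewrite -mulrA G [p ^+ n.+1]exprS mulrBr mulr1 mulrA qp; ring.
  by rewrite -[X in _ = X / _]E mulrBl mulfK ?gt_eqF.
rewrite ger0_norm; last by rewrite divr_ge0 ?sqr_ge0// ltW.
apply: le_trans (Hn n nn); apply: ler_wpM2l; first exact: sqr_ge0.
rewrite lef_pV2 ?posrE ?ltr0n//.
rewrite /qint -{1}[n.+1]card_ord -(sumr_const 'I_n.+1 (1 : R)).
by apply: ler_sum => k _; apply: exprn_ege1.
Qed.

End DecaySequence.

Section FockRelations.
Variables (R : realType) (N : nat) (q : R).
Hypothesis q0 : 0 < q.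
Implicit Types (u v : fock N q) (w : word N) (i j k : 'I_N).

Lemma fock_eq0 u : (forall n h, qsym q h -> hdot n u h = 0) -> u = 0.
Proof.
move=> H; apply/fock_inj/funext => w.
by apply: (@hdot_eq0 R N (size w)) => //; apply: H; exact: fock_qsym.
Qed.

Lemma fock_val_subZ u v (c : R[i]) w :
  fock_val (u - c *: v) w = fock_val u w - c * fock_val v w.
Proof.
transitivity (fock_val u w + (-1) * (c * fock_val v w)); first by [].
by rewrite mulN1r.
Qed.

Lemma hdot_subZ n u v (c : R[i]) (h : coefs R N) :
  hdot n (u - c *: v) h = hdot n u h - c * hdot n v h.
Proof.
rewrite -mulNr -hdotZ -hdotD; apply: eq_hdot => w _.
by rewrite fock_val_subZ mulNr.
Qed.

Lemma hdot_creation2 n i j u (h : coefs R N) : qsym q h ->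
  hdot n (creation q i (creation q j u)) h =
  if n is n'.+2 then hdot n' u (annih j (annih i h)) else 0.
Proof.
move=> hq; have hq' := qsym_annih i hq.
case: n => [|[|n]]; first exact: hdot0_creation.
  by rewrite hdot_creation// hdot0_creation.
by rewrite hdot_creation// hdot_creation.
Qed.

Lemma creation_swap i j u : (i < j)%N ->
  creation q i (creation q j u) = q%:C *: creation q j (creation q i u).
Proof.
move=> ij.
suff E : creation q i (creation q j u) - q%:C *: creation q j (creation q i u) = 0.
  by apply: subr0_eq.
apply: fock_eq0 => n h hq; rewrite hdot_subZ.
rewrite [X in X - _]hdot_creation2// [X in _ - _ * X]hdot_creation2//.
case: n => [|[|n]]; rewrite ?mulr0 ?subrr//.
by rewrite (annih_swap q0 i j hq) hdotZr /qswap ij cconjR subrr.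
Qed.

Let qcreate_ratio w k (f : coefs R N) :
  (qint q (size w).+1)^-1%:C * qcreate q w k f =
  (1 - qdecay q (size w))%:C * ((qint q (size w))^-1%:C * qcreate q w k f).
Proof.
case: w => [|i w]; first by rewrite !mulr0.
rewrite mulrA -real_complexM qdecay_complement; congr (_%:C * _).
by rewrite mulrAC divff ?mul1r// gt_eqF// qint_gt0.
Qed.

Lemma annih_creation_neq i j u w : i != j ->
  fock_val (annih_op i (creation q j u)) w =
  (q^-1 * (1 - qdecay q (size w)))%:C * fock_val (creation q j (annih_op i u)) w.
Proof.
move=> ij; rewrite [LHS]creation_val// creation_val//= (negbTE ij).
by rewrite mulrCA qcreate_ratio real_complexM -mulrA.
Qed.

Lemma annih_creation_diag j u w :
  fock_val (annih_op j (creation q j u)) w =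
  (1 - qdecay q (size w))%:C *
    (\sum_k qweight q j k * fock_val (creation q k (annih_op k u)) w) +
  (qdecay q (size w))%:C * fock_val u w.
Proof.
rewrite [LHS]creation_val// [qcreate _ _ _ _]/= eqxx mulrDr; congr (_ + _).
  rewrite !mulr_sumr; apply: eq_bigr => k _.
  by rewrite mulrCA qcreate_ratio creation_val//; ring.
rewrite mulrA; congr (_ * _); rewrite /qdecay [RHS]real_complexM [RHS]mulrC; congr (_ * _).
exact/esym/(rmorphXn (real_complex R)).
Qed.

Lemma sum_fockE (I : finType) (F : I -> fock N q) w :
  fock_val (\sum_k F k) w = \sum_k fock_val (F k) w.
Proof. exact: (@big_morph _ _ (fun v : fock N q => fock_val v w) 0 +%R 0 +%R). Qed.

Lemma hdot_sum_fock (I : finType) (F : I -> fock N q) n h :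
  hdot n (\sum_k F k) h = \sum_k hdot n (F k) h.
Proof.
rewrite -hdot_suml; apply: eq_hdot => w _; exact: sum_fockE.
Qed.

(** In positive degree every word has a first letter, so summing the pairings of L_k u with L_k h
    over k gives the pairing of u with h. Only the vacuum component is missed. *)
Lemma sum_creation_annih u w : fock_val (u - \sum_k creation q k (annih_op k u)) w =
  (if size w == 0%N then 1 else 0)%:C * fock_val u w.
Proof.
set y := \sum_k _.
have valE w' : fock_val (u - y) w' = fock_val u w' - fock_val y w'.
  by rewrite -[y in LHS]scale1r fock_val_subZ mul1r.
case: w => [|i w].
  rewrite valE /= /y sum_fockE big1 ?subr0 ?mul1r// => k _; exact: creation_nil.
have -> : (if size (i :: w) == 0%N then 1 else 0 : R)%:C = 0 :> R[i] by [].
rewrite mul0r; have dq := fock_qsym (u - y).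
apply: (@hdot_eq0 R N (size w).+1 (u - y)) => //; move: (size w) => n.
have -> : hdot n.+1 (u - y) (u - y) = hdot n.+1 u (u - y) - hdot n.+1 y (u - y).
  by rewrite -[y in hdot _ (u - y) _]scale1r hdot_subZ mul1r.
rewrite /y hdot_sum_fock hdotS; apply/eqP; rewrite subr_eq0; apply/eqP.
by apply: eq_bigr => k _; rewrite hdot_creation.
Qed.

End FockRelations.

Section QuotientMap.
Variables (R : realType) (N : nat) (q : R).
Hypothesis q0 : 0 < q.
Variables (O : cstarAlgType R) (quo : op N q -> O).
Hypothesis hO : is_cuntz_pimsner quo.
Implicit Types (x y : op N q) (u v : fock N q) (w : word N) (i j k : 'I_N).

(** Membership and value travel together because [quo] is arbitrary outside [toeplitz]; a
    computation in [O] is thereby lifted to explicit operators. *)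
Definition represents x (a : O) := toeplitz x /\ quo x = a.

Notation s i := (quo (creation q i)).

Lemma represents_id : represents idfun 1.
Proof. by split; [exact: toeplitz_id | case: hO]. Qed.

Lemma represents_creation i : represents (creation q i) (s i).
Proof. by split; first exact: toeplitz_creation. Qed.

Lemma represents_annih i : represents (@annih_op R N q i) (star (s i)).
Proof.
split; first exact: toeplitz_annih.
case: hO => _ [_ _ H] _ _ _; apply: H; first exact: toeplitz_creation.
exact: adjoint_creation.
Qed.

Lemma representsL (c : R[i]) x y a b : represents x a -> represents y b ->
  represents (fun u => c *: x u + y u) (c *: a + b).
Proof.
move=> [xT <-] [yT <-]; split; first exact: toeplitzL.
by case: hO => _ [H _ _] _ _ _; exact: H.
Qed.

Lemma representsM x y a b : represents x a -> represents y b ->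
  represents (fun u => x (y u)) (a * b).
Proof.
move=> [xT <-] [yT <-]; split; first exact: toeplitzM.
by case: hO => _ [_ H _] _ _ _; exact: H.
Qed.

Lemma represents0 : represents (fun=> 0) 0.
Proof.
have H := representsL (-1) represents_id represents_id.
have -> : (0 : O) = (-1) *: 1 + 1 by rewrite scaleN1r addNr.
rewrite (_ : (fun _ => 0) = fun u => (-1) *: idfun u + idfun u)//.
by apply/funext => u; rewrite scaleN1r addNr.
Qed.

Lemma representsZ (c : R[i]) x a : represents x a ->
  represents (fun u => c *: x u) (c *: a).
Proof.
move=> xa; have H := representsL c xa represents0.
rewrite addr0 in H; rewrite (_ : (fun u => c *: x u) = fun u => c *: x u + 0)//.
by apply/funext => u; rewrite addr0.
Qed.

Lemma representsD x y a b : represents x a -> represents y b ->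
  represents (fun u => x u + y u) (a + b).
Proof.
move=> xa yb; have H := representsL 1 xa yb.
rewrite scale1r in H; rewrite (_ : (fun u => x u + y u) = fun u => 1 *: x u + y u)//.
by apply/funext => u; rewrite scale1r.
Qed.

Lemma representsB x y a b : represents x a -> represents y b ->
  represents (fun u => x u - y u) (a - b).
Proof.
move=> xa yb; have H := representsD xa (representsZ (-1) yb).
rewrite scaleN1r in H; rewrite (_ : (fun u => x u - y u) = fun u => x u + (-1) *: y u)//.
Qed.

Lemma represents_sum (I : Type) (r : seq I) (F : I -> op N q) (a : I -> O) :
  (forall l, represents (F l) (a l)) ->
  represents (fun u => \sum_(l <- r) F l u) (\sum_(l <- r) a l).
Proof.
move=> H; elim: r => [|l r IH].
  rewrite big_nil (_ : (fun u => _) = fun=> 0); first exact: represents0.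
  by apply/funext => u; rewrite big_nil.
rewrite big_cons (_ : (fun u => _) = fun u => F l u + \sum_(j <- r) F j u).
  exact: representsD.
by apply/funext => u; rewrite big_cons.
Qed.

Lemma represents_inj x a b : represents x a -> represents x b -> a = b.
Proof. by move=> [_ <-] [_ <-]. Qed.

Lemma represents_bounded x a : represents x a ->
  linear x /\ exists2 M, 0 <= M & forall u, fnorm (x u) <= M * fnorm u.
Proof.
move=> [/(toeplitz_bounded q0) xb _]; split; first by case: xb.
exact: bounded_opP xb.
Qed.

(** The source of the relations that hold only modulo compact operators: the difference of two lifts
    is a bounded operator damped degree by degree. *)
Lemma represents_decay x a y b (eps : nat -> R) : represents x a -> represents y b ->
  (forall e, 0 < e -> exists n0, forall n, (n0 <= n)%N -> `|eps n| <= e) ->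
  (forall u w, fock_val (x u) w = (eps (size w))%:C * fock_val (y u) w) -> a = 0.
Proof.
move=> xa yb epsP xE; have [xl _] := represents_bounded xa.
have [_ [C C0 yC]] := represents_bounded yb.
have xc := compact_op_of_decay xl C0 yC epsP xE.
by case: xa => xT <-; case: hO => _ _ _ H _; apply/(H x xT).
Qed.

Let X k u := creation q k (annih_op k u).

Let represents_X k : represents (X k) (s k * star (s k)).
Proof. exact: representsM (represents_creation k) (represents_annih k). Qed.

Lemma quo_creation_sum : \sum_i s i * star (s i) = 1.
Proof.
have H := representsB represents_id (represents_sum (index_enum _) represents_X).
suff : 1 - \sum_i s i * star (s i) = 0 by move/subr0_eq.
apply: (@represents_decay _ _ _ _ (fun n => if n == 0%N then 1 else 0) H represents_id).
  by move=> e e0; exists 1%N => -[|n] // _; rewrite normr0 ltW.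
by move=> u w; exact: sum_creation_annih.
Qed.

Lemma quo_creation_swap i j : (i < j)%N -> s i * s j = q%:C *: (s j * s i).
Proof.
move=> ij.
have H1 := representsM (represents_creation i) (represents_creation j).
have H2 := representsZ q%:C (representsM (represents_creation j) (represents_creation i)).
apply: (represents_inj H1).
rewrite (_ : (fun u => _) = (fun u => q%:C *: creation q j (creation q i u)))//.
by apply/funext => u; exact: creation_swap.
Qed.

Section Limit.
Variable e : R.
Hypothesis eP : forall d, 0 < d -> exists n0, forall n, (n0 <= n)%N ->
  `|qdecay q n - e| <= d.

Lemma quo_annih_creation_neq i j : i != j ->
  star (s i) * s j = (q^-1 * (1 - e))%:C *: (s j * star (s i)).
Proof.
move=> ij.
have H1 := representsM (represents_annih i) (represents_creation j).
have H2 := representsM (represents_creation j) (represents_annih i).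
apply: subr0_eq.
apply: (@represents_decay _ _ _ _ (fun n => q^-1 * (e - qdecay q n))
  (representsB H1 (representsZ (q^-1 * (1 - e))%:C H2)) H2).
  move=> d d0; have [n0 Hn] := eP (mulr_gt0 q0 d0); exists n0 => n nn.
  rewrite normrM ger0_norm ?invr_ge0 ?(ltW q0)// distrC.
  by rewrite ler_pdivrMl// Hn.
move=> u w; rewrite fock_val_subZ annih_creation_neq//.
rewrite -mulrBl; congr (_ * _); rewrite -[X in _ - X]mul1r.
have -> : q^-1 * (e - qdecay q (size w)) = q^-1 * (1 - qdecay q (size w)) + - (q^-1 * (1 - e)) by ring.
by rewrite real_complexD mul1r; congr (_ + _); exact/esym/(rmorphN (real_complex R)).
Qed.

(** With Y the weighted sum of the S_k L_k, the lifts of the two sides differ on degree n by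
    ([qdecay] n - e)(1 - Y). Keeping the limit e as a parameter covers both ranges of q. *)
Lemma quo_annih_creation_diag j : star (s j) * s j =
  (1 - e)%:C *: (\sum_k qweight q j k *: (s k * star (s k))) + e%:C%:A.
Proof.
have H1 := representsM (represents_annih j) (represents_creation j).
have HY := represents_sum (index_enum _) (fun k => representsZ (qweight q j k) (represents_X k)).
have H2 := representsD (representsZ (1 - e)%:C HY) (representsZ e%:C represents_id).
apply: subr0_eq.
apply: (@represents_decay _ _ _ _ (fun n => qdecay q n - e) (representsB H1 H2)
  (representsB represents_id HY)) => //.
move=> u w; set Y := \sum_k _.
have YE : fock_val Y w = \sum_k qweight q j k * fock_val (X k u) w by rewrite sum_fockE.
have subE (a b : fock N q) : fock_val (a - b) w = fock_val a w - fock_val b w.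
  by rewrite -[b in LHS]scale1r fock_val_subZ mul1r.
rewrite !subE annih_creation_diag// -YE.
have -> : fock_val ((1 - e)%:C *: Y + e%:C *: idfun u) w =
   (1 - e)%:C * fock_val Y w + e%:C * fock_val u w by [].
have RB (a b : R) : (a - b)%:C = a%:C - b%:C :> R[i] by exact: rmorphB.
rewrite !RB [idfun u]/=; move: (fock_val Y w) (fock_val u w) => A B; ring.
Qed.

End Limit.

(** The preimage of a C*-subalgebra under [quo] is again closed, since the quotient norm is at most
    the operator norm, so it contains all of [toeplitz]. *)
Lemma quo_generated : cstar_generated (range (fun i => s i)) = [set: O].
Proof.
apply/seteqP; split=> // a _ M [MC Ms].
case: hO => quo1 [quoL quoM quoS] qsurj qker qnorm.
have : [set: O] a by [].
rewrite -qsurj => -[x xT <-] {a}.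
have [M1 ML MM MS Mcl] := MC.
pose T := [set y | toeplitz y /\ M (quo y)].
suff : T x by case.
apply: xT; split; last first.
  by move=> _ [i _ <-]; split; [exact: toeplitz_creation | apply: Ms; exists i].
have Tb y : T y -> bounded_op y by move=> [/(toeplitz_bounded q0)].
split=> //.
- by split; [exact: toeplitz_id | rewrite quo1].
- move=> a y z [yT My] [zT Mz]; split; first exact: toeplitzL.
  by rewrite quoL//; exact: ML.
- move=> y z [yT My] [zT Mz]; split; first exact: toeplitzM.
  by rewrite quoM//; exact: MM.
split=> [y z [yT My] yz|y yb H].
  split; first exact: toeplitz_adjoint yT yz.
  by rewrite (quoS y z)//; exact: MS.
have yT : toeplitz y.
  by apply: toeplitz_closed => // e e0; have [z [zT _] yz] := H e e0; exists z.
split=> //; apply: Mcl => e e0; have [z [zT Mz] yz] := H e e0.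
exists (quo z) => //.
have [dT dE] : represents (fun u => y u - z u) (quo y - quo z) by apply: representsB.
rewrite -dE qnorm//; apply: le_trans yz.
apply: ge_inf; first by exists 0 => _ [k [kT _] <-]; apply: op_norm_ge0;
  exact: toeplitz_bounded q0 _ (proj1 (representsB (conj dT erefl) (conj kT erefl))).
(* The compact perturbation 0 already gives the upper bound for the quotient norm. *)
exists (fun=> 0); last by congr op_norm; apply/funext => u /=; rewrite subr0.
split; first by case: represents0.
by apply/(qker _ (proj1 represents0)); case: represents0.
Qed.

End QuotientMap.

(** * Norm bounds for normally ordered polynomials *)

Section WordOperators.
Variables (R : realType) (N : nat) (q : R).
Hypothesis q0 : 0 < q.
Implicit Types (u f g : fock N q) (v w al be : word N) (i j k : 'I_N).

Definition creations al u : fock N q := foldr (fun i u => creation q i u) u al.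
(** Letters are removed from the left, which makes this the adjoint of [creations be]. *)
Definition annihs be u : fock N q := foldl (fun u i => annih_op i u) u be.

Lemma annihs_val be u w : fock_val (annihs be u) w = fock_val u (be ++ w).
Proof. by elim: be u => [|i be IH] u //=; rewrite IH. Qed.

Lemma hdot_fock_kernel n u w : hdot n u (kernel_vec q w) =
  if n == size w then fock_val u w else 0.
Proof.
rewrite -hdotC (hdot_kernel_vec q0 n w (fock_qsym u)).
by case: eqP => _; [exact: conjCK | exact: conjC0].
Qed.

Lemma kernel_vec_degree v w : size w != size v -> fock_val (kernel_vec q v) w = 0.
Proof.
move=> wv; apply: (@hdot_eq0 R N (size w) (kernel_vec q v)) => //.
by rewrite (hdot_kernel_vec q0 _ _ (fock_qsym _)) (negbTE wv).
Qed.

Lemma kernel_vec_sym v w :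
  fock_val (kernel_vec q v) w = (fock_val (kernel_vec q w) v)^*.
Proof.
have [wv|wv] := eqVneq (size w) (size v); last first.
  by rewrite !kernel_vec_degree ?conjC0// eq_sym.
have E := hdot_kernel_vec q0 (size w) w (fock_qsym (kernel_vec q v)).
rewrite eqxx hdot_fock_kernel wv eqxx in E.
by rewrite E conjCK.
Qed.

End WordOperators.

(** * Words with length in a window *)

Section Windows.
Variables (R : realType) (N : nat).
Implicit Types (v w al be : word N).

Definition words_of n : seq (word N) := map (@tval n 'I_N) (enum {: n.-tuple 'I_N}).
Definition window M L : seq (word N) := flatten [seq words_of n | n <- iota M L].

Lemma mem_words_of n w : (w \in words_of n) = (size w == n).
Proof.
apply/mapP/eqP => [[v _ ->]|wn]; first by rewrite size_tuple.
by exists (tcast wn (in_tuple w)); rewrite ?mem_enum// val_tcast.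
Qed.

Lemma uniq_window M L : uniq (window M L).
Proof.
elim: L M => [|L IH] M //; rewrite /window /= cat_uniq -/(window M.+1 L) IH andbT.
apply/andP; split; first by rewrite map_inj_uniq ?enum_uniq//; exact: val_inj.
apply/hasPn => w /flattenP[_ /mapP[n nM ->]]; rewrite !mem_words_of => /eqP ->.
by move: nM; rewrite mem_iota => /andP[Mn _]; rewrite gtn_eqF.
Qed.

Lemma sum_window (V : nmodType) M L (F : word N -> V) :
  \sum_(w <- window M L) F w = \sum_(n <- iota M L) \sum_(w : n.-tuple 'I_N) F w.
Proof.
rewrite big_flatten big_map; apply: eq_bigr => n _.
by rewrite big_map big_enum.
Qed.

(** S_al S_be^* maps degree |be| + m - |al| to degree m; counted are the m for which both degrees
    lie in the window. *)
Definition window_count M L al be : R := \sum_(m <- iota M L)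
  ((size al <= m)%N && ((size be + (m - size al))%N \in iota M L))%:R.

Lemma window_count_le M L al be : window_count M L al be <= L%:R.
Proof.
rewrite /window_count (@le_trans _ _ (\sum_(m <- iota M L) 1))//.
  by apply: ler_sum => m _; case: (_ && _); rewrite ?ler01.
by rewrite big_const_seq count_predT size_iota iter_addr addr0.
Qed.

Lemma window_bounds (M L a c m : nat) : (a + c < L)%N -> (M + a <= m)%N ->
  (m < M + a + (L - a - c))%N ->
  [&& (a <= m)%N, (M <= c + (m - a))%N & (c + (m - a) < M + L)%N].
Proof. lia. Qed.

(** Only the first |al| and the last |be| values of m can be lost at the ends of the window. *)
Lemma window_count_ge M L al be :
  L%:R - (size al + size be)%:R <= window_count M L al be.
Proof.
have [Ls|sL] := leqP L (size al + size be).
  rewrite (@le_trans _ _ 0)//; first by rewrite subr_le0 ler_nat.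
  by apply: sumr_ge0 => m _; rewrite ler0n.
set a := size al in sL *; set c := size be in sL *.
have E : iota M L = iota M a ++ iota (M + a) (L - a - c) ++ iota (M + a + (L - a - c)) c.
  rewrite -iotaD -iotaD; congr (iota _ _).
  by rewrite subnK ?subnKC//; [exact: leq_trans (leq_addr c a) (ltnW sL) | rewrite leq_subRL ?(ltnW sL)// (leq_trans (leq_addr c a) (ltnW sL))].
rewrite /window_count {1}E !big_cat /=.
have P1 : 0 <= \sum_(m <- iota M a) ((a <= m)%N && ((c + (m - a))%N \in iota M L))%:R :> R.
  by apply: sumr_ge0 => m _; rewrite ler0n.
have P3 : 0 <= \sum_(m <- iota (M + a + (L - a - c)) c) ((a <= m)%N && ((c + (m - a))%N \in iota M L))%:R :> R.
  by apply: sumr_ge0 => m _; rewrite ler0n.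
have P2 : \sum_(m <- iota (M + a) (L - a - c)) ((a <= m)%N && ((c + (m - a))%N \in iota M L))%:R = L%:R - (a + c)%:R :> R.
  rewrite (eq_big_seq (fun=> 1)); last first.
    move=> m; rewrite mem_iota => /andP[m1 m2].
    have /and3P[h1 h2 h3] := window_bounds sL m1 m2.
    by rewrite mem_iota h1 h2 h3.
  rewrite big_const_seq count_predT size_iota iter_addr addr0 -subnDA natrB//.
  exact: ltnW.
by rewrite P2; lra.
Qed.

End Windows.

Section WindowForm.
Variables (R : realType) (N : nat) (q : R).
Hypothesis q0 : 0 < q.
Variables (B : cstarAlgType R) (b : 'I_N -> B).
Hypothesis bq : forall i j : 'I_N, (i < j)%N -> b i * b j = q%:C *: (b j * b i).
Hypothesis b1 : \sum_i b i * star (b i) = 1.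
Implicit Types (u f g : fock N q) (v w al be : word N) (i j k : 'I_N).

Notation bm := (monom_eval b).

(** The factor [n+1] in [coefs_eval_qcreate] cancels the normalization of S_i, so evaluation turns
    S_i into left multiplication by b_i. *)
Lemma coefs_eval_creation n i f :
  coefs_eval b n.+1 (creation q i f) = b i * coefs_eval b n f.
Proof.
transitivity ((qint q n.+1)^-1%:C *: coefs_eval b n.+1 (fun w => qcreate q w i f)).
  rewrite -coefs_evalZ; apply: eq_coefs_eval => w wn.
  by rewrite creation_val// wn.
rewrite (coefs_eval_qcreate q0 bq n.+1 i (fock_qsym f)) scalerA -real_complexM.
by rewrite mulVf ?scale1r// gt_eqF// qint_gt0.
Qed.

Lemma coefs_eval0_creation i f : coefs_eval b 0 (creation q i f) = 0.
Proof.
rewrite /coefs_eval (sum_tuple0 (fun w => fock_val (creation q i f) w *: bm w)).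
by rewrite creation_nil scale0r.
Qed.

Lemma coefs_eval_creations n al f : coefs_eval b n (creations al f) =
  if (size al <= n)%N then bm al * coefs_eval b (n - size al) f else 0.
Proof.
elim: al n => [|i al IH] [|n].
- by rewrite /= mul1r.
- by rewrite /= mul1r subn0.
- by rewrite coefs_eval0_creation.
rewrite [creations _ _]/= coefs_eval_creation IH [size _]/= ltnS subSS.
by case: ifP => _; [rewrite /= mulrA | rewrite mulr0].
Qed.

Lemma coefs_eval_kernel w : coefs_eval b (size w) (kernel_vec q w) = bm w.
Proof.
rewrite [LHS](coefs_eval_creations (size w) w (vacuum N q)) leqnn subnn.
rewrite /coefs_eval (sum_tuple0 (fun w => monom R [::] w *: bm w)) /monom eqxx.
by rewrite scale1r mulr1.
Qed.

Lemma sum_monom_eval n : \sum_(w : n.-tuple 'I_N) bm w * star (bm w) = 1.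
Proof.
elim: n => [|n IH].
  by rewrite (sum_tuple0 (fun w => bm w * star (bm w))) /= star1 mulr1.
rewrite (sum_tupleS n (fun w => bm w * star (bm w))) -[RHS]b1.
apply: eq_bigr => i _ /=; rewrite -[star (b i)]mul1r -IH mulr_suml mulr_sumr.
by apply: eq_bigr => w _; rewrite starM !mulrA.
Qed.

(** By the hermitian symmetry of the kernel, the sum over v evaluates the kernel vector of
    [be ++ w], giving the adjoint of b_be b_w; then b_w meets its adjoint, and the sum over w is
    1. *)
Lemma sum_annihs_kernel be (k n : nat) :
  \sum_(v : n.-tuple 'I_N) coefs_eval b k (annihs be (kernel_vec q v)) * star (bm v) =
  if n == (size be + k)%N then star (bm be) else 0.
Proof.
transitivity (\sum_(w : k.-tuple 'I_N) bm w *
    star (\sum_(v : n.-tuple 'I_N) fock_val (kernel_vec q (be ++ w)) v *: bm v)).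
  rewrite [RHS](eq_bigr (fun w : k.-tuple 'I_N => \sum_(v : n.-tuple 'I_N)
      fock_val (kernel_vec q v) (be ++ w) *: (bm w * star (bm v)))); last first.
    move=> w _; rewrite star_sum mulr_sumr; apply: eq_bigr => v _.
    by rewrite starZ -scalerAr (kernel_vec_sym q0 v).
  rewrite exchange_big; apply: eq_bigr => v _ /=.
  rewrite /coefs_eval mulr_suml; apply: eq_bigr => w _.
  by rewrite annihs_val scalerAl.
case: eqP => [nk|/eqP nk]; last first.
  rewrite big1// => w _; rewrite [X in star X]big1 ?star0 ?mulr0// => v _.
  by rewrite kernel_vec_degree ?scale0r// size_tuple size_cat size_tuple.
rewrite -[RHS]mul1r -(sum_monom_eval k) mulr_suml; apply: eq_bigr => w _.
rewrite -mulrA -starM -monom_eval_cat; congr (_ * star _).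
by rewrite -coefs_eval_kernel size_cat size_tuple nk.
Qed.

Lemma block_form m n al be :
  \sum_(w : m.-tuple 'I_N) \sum_(v : n.-tuple 'I_N)
    fock_val (creations al (annihs be (kernel_vec q v))) w *: (bm w * star (bm v)) =
  if (size al <= m)%N && (n == size be + (m - size al))%N then bm al * star (bm be) else 0.
Proof.
transitivity (\sum_(v : n.-tuple 'I_N)
   coefs_eval b m (creations al (annihs be (kernel_vec q v))) * star (bm v)).
  rewrite exchange_big; apply: eq_bigr => v _ /=; rewrite mulr_suml.
  by apply: eq_bigr => w _; rewrite scalerAl.
case: leqP => alm /=; last first.
  rewrite big1// => v _; rewrite coefs_eval_creations.
  by rewrite leqNgt alm mul0r.
transitivity (bm al * \sum_(v : n.-tuple 'I_N)
    coefs_eval b (m - size al) (annihs be (kernel_vec q v)) * star (bm v)).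
  rewrite mulr_sumr; apply: eq_bigr => v _.
  by rewrite coefs_eval_creations alm mulrA.
by rewrite sum_annihs_kernel; case: eqP; rewrite ?mulr0.
Qed.

Lemma sum_window_monom_eval M L :
  \sum_(w <- window N M L) bm w * star (bm w) = L%:R%:C%:A.
Proof.
rewrite sum_window; under eq_bigr do rewrite sum_monom_eval.
rewrite big_const_seq count_predT size_iota iter_addr addr0.
by rewrite (rmorph_nat (real_complex R)) scaler_nat.
Qed.

Lemma window_form M L al be :
  \sum_(w <- window N M L) \sum_(v <- window N M L)
    fock_val (creations al (annihs be (kernel_vec q v))) w *: (bm w * star (bm v)) =
  (window_count R M L al be)%:C *: (bm al * star (bm be)).
Proof.
rewrite sum_window /window_count rmorph_sum scaler_suml.
apply: eq_bigr => m _.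
transitivity (\sum_(n <- iota M L) \sum_(w : m.-tuple 'I_N) \sum_(v : n.-tuple 'I_N)
    fock_val (creations al (annihs be (kernel_vec q v))) w *: (bm w * star (bm v))).
  by rewrite [RHS]exchange_big; apply: eq_bigr => w _; rewrite sum_window.
under eq_bigr do rewrite block_form.
set k := (size be + (m - size al))%N; case: leqP => alm /=; last first.
  by rewrite big1// scale0r.
case: (boolP (k \in iota M L)) => kM; last first.
  rewrite big_seq big1 ?scale0r// => n nM; case: eqP => // nk.
  by rewrite -nk nM in kM.
rewrite (bigD1_seq k) ?iota_uniq//= eqxx big1 ?addr0 ?scale1r//.
by move=> n /negbTE ->.
Qed.

End WindowForm.

(** * Tails of the images of compact operators *)

Section CompactTail.
Variables (R : realType) (N : nat) (q : R).
Implicit Types (u v : fock N q).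

Lemma fock_tail v (e : R) : 0 < e ->
  exists M, forall m, \sum_(M <= k < m) hnormsq k v <= e.
Proof.
move=> e0; have [_ vs] := fockP v.
move/cvgrPdist_le: (vs) => /(_ e e0)[M _ HM]; exists M => m.
have [mM|Mm] := leqP m M; first by rewrite big_geq// ltW.
set l := limn _ in HM.
have HM' := HM M (leqnn M).
have lm : series (fun k => hnormsq k v) m <= l.
  exact: nondecreasing_cvgn_le (@series_hnormsq_nd _ _ v) vs m.
have : series (fun k => hnormsq k v) m = series (fun k => hnormsq k v) M + \sum_(M <= k < m) hnormsq k v.
  by rewrite /series /= -big_cat_nat//= ltnW.
move: HM'; rewrite ler_norml => /andP[_]; lra.
Qed.

(** Otherwise every M admits a vector of the unit ball whose image has mass above e from degree M
    on. These images have a cluster point v; its tail is small, and some image with large M is close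
    to v, a contradiction. *)
Lemma compact_op_unit_tail (x : op N q) (e : R) : compact_op x -> 0 < e ->
  exists M, forall u, fnorm u <= 1 -> forall m, \sum_(M <= k < m) hnormsq k (x u) <= e.
Proof.
move=> [_ [U xU [cU _]]] e0; apply: contrapT => nH.
have /choice[u uP] M : exists u, fnorm u <= 1 /\
    exists m, e < \sum_(M <= k < m) hnormsq k (x u).
  apply: contrapT => nu; apply: nH; exists M => u u1 m; rewrite leNgt; apply/negP => lt.
  by apply: nu; exists u; split=> //; exists m.
pose y M := x (u M).
have [|v [_ cv]] := cU (y @ \oo) _.
  by exists 0%N => // M _; apply: xU; exists (u M) => //; case: (uP M).
(* The tail of v and the distance to v enter with a factor 2 each: 2 e/8 + 2 e/8 <= e. *)
have e8 : 0 < e / 8 by rewrite divr_gt0.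
have [M1 HM1] := fock_tail v e8.
pose r := Num.sqrt (e / 8); have r0 : 0 < r by rewrite sqrtr_gt0.
have rC : 0 < r%:C by rewrite ltcR.
have [|_ [[M MM1 <-] vy]] := cv [set y M | M in [set M | (M1 <= M)%N]] _ _ (nbhsx_ballx v r%:C rC).
  by exists M1 => // M MM1; exists M.
rewrite -ball_normE /= in vy.
have {}vy : fnorm (v - y M) < r by rewrite -ltcR.
have [_ [m]] := uP M; rewrite -/(y M) ltNge => /negP; apply.
apply: (@le_trans _ _ (2 * \sum_(M <= k < m) hnormsq k v + 2 * \sum_(M <= k < m) hnormsq k (v - y M))).
  rewrite !mulr_sumr -big_split; apply: ler_sum => k _ /=.
  rewrite /hnormsq !mulr_sumr -big_split; apply: ler_sum => w _ /=.
  have E : fock_val v w - fock_val (v - y M) w = fock_val (y M) w.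
    rewrite -{1}[y M]scale1r fock_val_subZ mul1r.
    by rewrite opprB addrCA subrr addr0.
  by have := normc_sqr_sub (fock_val v w) (fock_val (v - y M) w); rewrite E.
have tv : \sum_(M <= k < m) hnormsq k v <= e / 8.
  have [mM|Mm] := leqP m M; first by rewrite big_geq// ltW.
  apply: le_trans (HM1 m); rewrite [leRHS](@big_cat_nat _ _ _ M)//= ?(ltnW Mm)// lerDr.
  by apply: sumr_ge0 => k _; exact: hnormsq_ge0.
have td : \sum_(M <= k < m) hnormsq k (v - y M) <= e / 8.
  have r2 : fnorm (v - y M) ^+ 2 <= e / 8.
    rewrite -[leRHS](sqr_sqrtr (ltW e8)) -/r ler_sqr ?nnegrE ?fnorm_ge0 ?(ltW r0)//.
    exact: ltW.
  have [mM|Mm] := leqP m M; first by rewrite big_geq// ltW.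
  apply: le_trans r2; apply: le_trans (fnorm_sqr_series (v - y M) m).
  rewrite /series /= [leRHS](@big_cat_nat _ _ _ M)//= ?(ltnW Mm)// lerDr.
  by apply: sumr_ge0 => k _; exact: hnormsq_ge0.
lra.
Qed.

Lemma compact_op_tail (x : op N q) (e : R) : compact_op x -> 0 < e ->
  exists M, forall u m, \sum_(M <= k < m) hnormsq k (x u) <= (e * fnorm u) ^+ 2.
Proof.
move=> xc e0; have [xl _] := xc.
have [M HM] := compact_op_unit_tail xc (exprn_gt0 2 e0); exists M => u m.
have := fnorm_ge0 u; rewrite le_eqVlt => /predU1P[u0|u0].
  have -> : u = 0.
    by apply: fnorm_eq0; rewrite -u0.
  have x0 : x 0 = 0.
    by have := xl (-1) 0 0; rewrite scaleN1r addNr scaleN1r addNr.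
  rewrite x0 big1 ?sqr_ge0// => k _.
  by rewrite /hnormsq big1// => w _; rewrite Normc.normc0 expr0n.
pose u' := (fnorm u)^-1%:C *: u.
have u'1 : fnorm u' <= 1.
  by rewrite fnorm_scale normc_real ger0_norm ?invr_ge0 ?(ltW u0)// mulVf ?gt_eqF.
have xZ c v : x (c *: v) = c *: x v.
  have := xl c v 0; rewrite addr0 => ->.
  have x0 : x 0 = 0 by have := xl (-1) 0 0; rewrite scaleN1r addNr scaleN1r addNr.
  by rewrite x0 addr0.
have uE : u = (fnorm u)%:C *: u'.
  by rewrite /u' scalerA -real_complexM divff ?gt_eqF// scale1r.
rewrite {1}uE xZ.
have hE k : hnormsq k ((fnorm u)%:C *: x u') = fnorm u ^+ 2 * hnormsq k (x u').
  transitivity (hnormsq k (fun w => (fnorm u)%:C * fock_val (x u') w)); first by [].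
  by rewrite hnormsqZ normc_real ger0_norm// (ltW u0).
under eq_bigr do rewrite hE.
rewrite -mulr_sumr exprMn mulrC; apply: ler_wpM2r; first exact: sqr_ge0.
exact: HM.
Qed.

End CompactTail.

Section NormalOrdered.
Variables (R : realType) (N : nat) (q : R).
Hypothesis q0 : 0 < q.
Implicit Types (u v g : fock N q) (w al be : word N) (i j : 'I_N).

Lemma fdotC u v : fdot u v = (fdot v u)^*.
Proof.
apply: fdot_eq; have [Hr Hi] := fdotP v u.
have E n : hdot n u v = (hdot n v u)^* by rewrite hdotC.
case: (fdot v u) Hr Hi => a b /= Hr Hi; split.
- rewrite (_ : series _ = series (fun n => complex.Re (hdot n v u))) => //.
  by congr series; apply/funext => n; rewrite E; case: (hdot n v u).
- rewrite (_ : series _ = - series (fun n => complex.Im (hdot n v u))); first exact: cvgN.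
  apply/funext => n; rewrite /series /= fctE -sumrN; apply: eq_bigr => k _.
  by rewrite E; case: (hdot k v u).
Qed.

Lemma sum_window_normsq_le M L u :
  \sum_(w <- window N M L) Normc.normc (fock_val u w) ^+ 2 <= fnorm u ^+ 2.
Proof.
rewrite sum_window; apply: le_trans (fnorm_sqr_series u (M + L)).
have E : iota 0 (M + L) = iota 0 M ++ iota M L by rewrite iotaD.
rewrite /series /= /index_iota subn0 E big_cat /= lerDr.
by apply: sumr_ge0 => k _; exact: hnormsq_ge0.
Qed.

Definition kernel_comb (W : seq (word N)) (a : word N -> R[i]) : fock N q :=
  \sum_(v <- W) (a v)^* *: kernel_vec q v.

Lemma fdot_kernel_comb u W a :
  fdot u (kernel_comb W a) = \sum_(v <- W) a v * fock_val u v.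
Proof.
rewrite /kernel_comb; elim: W => [|v W IH].
  rewrite !big_nil.
  have := fdotDZr u (-1) 0 0; rewrite scaleN1r addNr.
  have -> : (-1 : R[i])^* = -1 by rewrite cconjN conjC1.
  by rewrite mulN1r addNr.
by rewrite !big_cons fdotDZr IH conjCK fdotC fdot_kernel_vec// conjCK.
Qed.

(** By [fdot_kernel_comb] this combination is dual to restricting coefficients to the window, and
    restriction is a contraction. *)
Lemma fnorm_kernel_comb M L a : fnorm (kernel_comb (window N M L) a) <=
  Num.sqrt (\sum_(w <- window N M L) Normc.normc (a w) ^+ 2).
Proof.
set W := window N M L; set g := kernel_comb W a.
have := fnorm_ge0 g; rewrite le_eqVlt => /predU1P[<-|g0]; first exact: sqrtr_ge0.
rewrite -(ler_pM2r g0) -expr2 -Re_fdot_self fdot_kernel_comb.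
apply: (le_trans (ler_norm _)); apply: (le_trans (Re_le_normc _)).
have -> : \sum_(v <- W) a v * fock_val g v = \sum_(v <- W) a v * ((fock_val g v)^*)^*.
  by apply: eq_bigr => v _; rewrite conjCK.
apply: (le_trans (normc_sum_mul_conj _ _ _)).
apply: ler_wpM2l; first exact: sqrtr_ge0.
rewrite -[leRHS](ger0_norm (ltW g0)) -sqrtr_sqr; apply: ler_wsqrtr.
under eq_bigr do rewrite normc_conj.
exact: sum_window_normsq_le.
Qed.

(** The triple (c, al, be) stands for c s_al s_be^* . Polynomials are formal so that one and the
    same p is evaluated in the quotient, in B and on the Fock space. *)
Definition npoly := seq (R[i] * word N * word N).

Definition npoly_eval (A : cstarAlgType R) (s : 'I_N -> A) (p : npoly) : A :=
  \sum_(t <- p) t.1.1 *: (monom_eval s t.1.2 * star (monom_eval s t.2)).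

Definition npoly_op (p : npoly) u : fock N q :=
  \sum_(t <- p) t.1.1 *: creations t.1.2 (annihs t.2 u).

Section Bound.
Variables (O : cstarAlgType R) (quo : op N q -> O).
Hypothesis hO : is_cuntz_pimsner quo.
Variables (B : cstarAlgType R) (b : 'I_N -> B).
Hypothesis bq : forall i j, (i < j)%N -> b i * b j = q%:C *: (b j * b i).
Hypothesis b1 : \sum_i b i * star (b i) = 1.

Notation s := (fun i => quo (creation q i)).

Lemma represents_creations al : represents quo (creations al) (monom_eval s al).
Proof.
elim: al => [|i al IH]; first exact: represents_id.
exact: representsM (represents_creation quo i) IH.
Qed.

Lemma represents_annihs be : represents quo (annihs be) (star (monom_eval s be)).
Proof.
elim: be => [|i be IH]; first by rewrite /= star1; exact: represents_id.
by rewrite /= starM; apply: representsM IH (represents_annih _ _ i).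
Qed.

Lemma represents_npoly p : represents quo (npoly_op p) (npoly_eval s p).
Proof.
apply: represents_sum => // t; apply: representsZ => //.
by apply: representsM => //; [exact: represents_creations | exact: represents_annihs].
Qed.

Lemma npoly_op_linear p : linear (npoly_op p).
Proof. by have [] := represents_bounded q0 (represents_npoly p). Qed.

(** The quotient norm supplies a compact k such that x - k has norm within e/2 of it, and k
    contributes at most another e/2 from degree M on. As M is fixed before L, it serves windows of
    every length. *)
Lemma window_op_bound p e : 0 < e -> exists M, forall L (a : word N -> R[i]),
  Normc.normc (\sum_(w <- window N M L) \sum_(v <- window N M L)
    a w * fock_val (npoly_op p (kernel_vec q v)) w * (a v)^*) <=
  (cnorm (npoly_eval s p) + e) * \sum_(w <- window N M L) Normc.normc (a w) ^+ 2.
Proof.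
move=> e0; have e2 : 0 < e / 2 by rewrite divr_gt0.
have [pT pE] := represents_npoly p.
case: (hO) => _ _ _ _ qnorm.
set x := npoly_op p in pT pE *.
have [|_ [k [kT kc] <-] kn] := @inf_adherent R [set op_norm (x \- k) | k in toeplitz (q:=q) `&` @compact_op R N q] _ e2.
  split; last first.
    exists 0 => _ [k [kT _] <-]; apply: op_norm_ge0.
    exact: toeplitz_bounded q0 _ (proj1 (representsB hO (conj pT erefl) (conj kT erefl))).
  exists (op_norm (x \- (fun=> 0))), (fun=> 0) => //; split.
    by case: (represents0 hO).
  case: (hO) => _ _ _ qker _.
  by apply/(qker _ (proj1 (represents0 hO))); case: (represents0 hO).
rewrite -(qnorm x pT) pE in kn.
have db : bounded_op (x \- k).
  exact: toeplitz_bounded q0 _ (proj1 (representsB hO (conj pT erefl) (conj kT erefl))).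
have [M HM] := compact_op_tail kc e2; exists M => L a.
set W := window N M L; set S := \sum_(w <- W) Normc.normc (a w) ^+ 2.
pose g := kernel_comb W a.
have S0 : 0 <= S by apply: sumr_ge0 => *; exact: sqr_ge0.
have gn : fnorm g <= Num.sqrt S by exact: fnorm_kernel_comb.
have xl : linear x := npoly_op_linear p.
have xg w : fock_val (x g) w = \sum_(v <- W) fock_val (x (kernel_vec q v)) w * (a v)^*.
  rewrite /g /kernel_comb; elim: W {S S0 g gn} => [|v W' IH].
    rewrite !big_nil; have -> : x 0 = 0 by have := xl (-1) 0 0; rewrite scaleN1r addNr scaleN1r addNr.
    by [].
  rewrite !big_cons -IH xl [X in _ = X + _]mulrC; exact: erefl.
have -> : \sum_(w <- W) \sum_(v <- W) a w * fock_val (x (kernel_vec q v)) w * (a v)^* =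
    \sum_(w <- W) a w * ((fock_val (x g) w)^*)^*.
  apply: eq_bigr => w _; rewrite conjCK xg mulr_sumr.
  by apply: eq_bigr => v _; rewrite mulrA.
apply: (le_trans (normc_sum_mul_conj _ _ _)); rewrite -/S.
have -> : (cnorm (npoly_eval s p) + e) * S =
    Num.sqrt S * ((cnorm (npoly_eval s p) + e) * Num.sqrt S).
  by rewrite mulrCA -expr2 sqr_sqrtr.
apply: ler_wpM2l; first exact: sqrtr_ge0.
under eq_bigr do rewrite normc_conj.
apply: (@le_trans _ _ (Num.sqrt (\sum_(w <- W) Normc.normc (fock_val (x g - k g) w) ^+ 2) +
   Num.sqrt (\sum_(w <- W) Normc.normc (fock_val (k g) w) ^+ 2))).
  apply: sqrt_minkowski => w; rewrite ?normc_ge0//.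
  have -> : fock_val (x g) w = fock_val (x g - k g) w + fock_val (k g) w.
    by rewrite -[k g in X in X + _]scale1r fock_val_subZ mul1r subrK.
  exact: le_normcD.
have B1 : Num.sqrt (\sum_(w <- W) Normc.normc (fock_val (x g - k g) w) ^+ 2) <=
    (cnorm (npoly_eval s p) + e / 2) * Num.sqrt S.
  apply: (@le_trans _ _ (fnorm (x g - k g))).
    rewrite -[leRHS]ger0_norm ?fnorm_ge0// -sqrtr_sqr; apply: ler_wsqrtr.
    exact: sum_window_normsq_le.
  apply: (le_trans (op_normP g db)); apply: ler_pM => //.
  - exact: op_norm_ge0.
  - exact: fnorm_ge0.
  - exact: ltW.
have B2 : Num.sqrt (\sum_(w <- W) Normc.normc (fock_val (k g) w) ^+ 2) <= e / 2 * Num.sqrt S.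
  apply: (@le_trans _ _ (e / 2 * fnorm g)); last by apply: ler_wpM2l => //; exact: ltW.
  have eg : 0 <= e / 2 * fnorm g by rewrite mulr_ge0 ?fnorm_ge0// ltW.
  rewrite -[leRHS]ger0_norm// -sqrtr_sqr; apply: ler_wsqrtr.
  apply: le_trans (HM g (M + L)%N); rewrite /W sum_window /index_iota.
  by rewrite addKn.
apply: (le_trans (lerD B1 B2)); rewrite -mulrDl.
by rewrite -addrA -splitr.
Qed.

(** Over a window of length L, [cnorm_form_le] bounds the weighted sum of the terms; replacing each
    window count by L costs [D], which is independent of L and disappears on division by L. *)
Theorem npoly_eval_bound p : cnorm (npoly_eval b p) <= 2 * cnorm (npoly_eval s p).
Proof.
pose D := \sum_(t <- p) Normc.normc t.1.1 * (size t.1.2 + size t.2)%:R *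
  cnorm (monom_eval b t.1.2 * star (monom_eval b t.2)).
have D0 : 0 <= D.
  by apply: sumr_ge0 => t _; rewrite mulr_ge0 ?cnorm_ge0// mulr_ge0// normc_ge0.
have key e L : 0 < e -> L%:R * cnorm (npoly_eval b p) <=
    2 * (cnorm (npoly_eval s p) + e) * L%:R + D.
  move=> e0; have [M HM] := window_op_bound p e0.
  pose X w (v : word N) := fock_val (npoly_op p (kernel_vec q v)) w.
  have tau0 : 0 <= cnorm (npoly_eval s p) + e by rewrite addr_ge0 ?cnorm_ge0// ltW.
  have H := @cnorm_form_le R B _ (window N M L) X (monom_eval b) _ L%:R
    (uniq_window N M L) tau0 (ler0n _ _) (sum_window_monom_eval b1 M L) (HM L).
  have E : \sum_(w <- window N M L) \sum_(v <- window N M L)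
      X w v *: (monom_eval b w * star (monom_eval b v)) =
      \sum_(t <- p) t.1.1 *: ((window_count R M L t.1.2 t.2)%:C *:
        (monom_eval b t.1.2 * star (monom_eval b t.2))).
    under [RHS]eq_bigr do rewrite -(window_form q0 bq b1).
    under [RHS]eq_bigr => t _ do rewrite scaler_sumr.
    rewrite [RHS]exchange_big; apply: eq_bigr => w _ /=.
    under [RHS]eq_bigr => t _ do rewrite scaler_sumr.
    rewrite [RHS]exchange_big; apply: eq_bigr => v _ /=.
    rewrite /X /npoly_op; under [RHS]eq_bigr do rewrite scalerA.
    rewrite -scaler_suml; congr (_ *: _).
    by elim: p {D D0 HM X tau0 H} => [|t p' IH]; rewrite ?big_nil// !big_cons -IH.
  rewrite E in H.
  have F : L%:R%:C *: npoly_eval b p =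
    \sum_(t <- p) t.1.1 *: ((window_count R M L t.1.2 t.2)%:C *:
        (monom_eval b t.1.2 * star (monom_eval b t.2))) +
    \sum_(t <- p) t.1.1 *: ((L%:R - window_count R M L t.1.2 t.2)%:C *:
        (monom_eval b t.1.2 * star (monom_eval b t.2))).
    rewrite /npoly_eval scaler_sumr -big_split; apply: eq_bigr => t _ /=.
    rewrite -scalerDr -scalerDl -real_complexD addrC subrK.
    by rewrite !scalerA mulrC.
  have -> : L%:R * cnorm (npoly_eval b p) = cnorm (L%:R%:C *: npoly_eval b p).
    by rewrite cnormZr ger0_norm.
  rewrite F; apply: (le_trans (cnormD _ _)); apply: lerD => //.
  apply: (le_trans (cnorm_sum _ _ _)); apply: ler_sum => t _.
  rewrite cnormZ cnormZr -mulrA ler_wpM2l ?normc_ge0// ler_wpM2r ?cnorm_ge0//.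
  rewrite ger0_norm ?subr_ge0 ?window_count_le//.
  by have := window_count_ge R M L t.1.2 t.2; lra.
apply/ler_addgt0Pl => e e0.
have e4 : 0 < e / 4 by rewrite divr_gt0.
have e2 : 0 < e / 2 by rewrite divr_gt0.
(* Window length n0 + 1: the boundary error contributes e/2, and e/4 with the factor 2 contributes
   the rest. *)
have [n0 /(_ n0 (leqnn _)) Hn] := le_inv_small D0 e2.
have := key (e / 4) n0.+1 e4; set y := cnorm _; set z := cnorm _ => H.
have n1 : 0 < n0.+1%:R :> R by rewrite ltr0n.
rewrite -(ler_pM2l n1); apply: (le_trans H).
have Hn' : D <= e / 2 * n0.+1%:R by rewrite -ler_pdivrMr.
move: (n0.+1%:R : R) Hn' => n Hn'; lra.
Qed.

End Bound.
End NormalOrdered.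

(** * The universal property *)

Section Universality.
Variables (R : realType) (N : nat) (q : R).
Hypothesis q0 : 0 < q.
Variables (O : cstarAlgType R) (quo : op N q -> O).
Hypothesis hO : is_cuntz_pimsner quo.
Variables (B : cstarAlgType R) (b : 'I_N -> B).
Variables (c : R[i]) (d : 'I_N -> 'I_N -> R[i]).
Notation s := (fun i => quo (creation q i)).
Hypothesis b1 : \sum_i b i * star (b i) = 1.
Hypothesis bq : forall i j : 'I_N, (i < j)%N -> b i * b j = q%:C *: (b j * b i).
Hypothesis b_neq : forall i j, i != j -> star (b i) * b j = c *: (b j * star (b i)).
Hypothesis b_diag : forall i, star (b i) * b i = \sum_k d i k *: (b k * star (b k)).
Hypothesis s_neq : forall i j, i != j -> star (s i) * s j = c *: (s j * star (s i)).
Hypothesis s_diag : forall i, star (s i) * s i = \sum_k d i k *: (s k * star (s k)).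

(** Pairs the two values of one formal polynomial; that y is determined by x follows only from
    [Gbound]. The coefficients [c] and [d] give both presentations a common shape, so normal
    ordering is done once. *)
Let G (x : O) (y : B) := exists p, x = npoly_eval s p /\ y = npoly_eval b p.

Let GL a x y u v : G x y -> G u v -> G (a *: x + u) (a *: y + v).
Proof.
move=> [p [-> ->]] [r [-> ->]].
exists ([seq (a * t.1.1, t.1.2, t.2) | t <- p] ++ r).
by rewrite /npoly_eval !big_cat !big_map !scaler_sumr /=; split; congr (_ + _);
  apply: eq_bigr => t _; rewrite scalerA.
Qed.

Let G0 : G 0 0.
Proof. by exists [::]; rewrite /npoly_eval !big_nil. Qed.

Let GZ a x y : G x y -> G (a *: x) (a *: y).
Proof. by move=> xy; have := GL a xy G0; rewrite !addr0. Qed.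

Let GD x y u v : G x y -> G u v -> G (x + u) (y + v).
Proof. by move=> xy uv; have := GL 1 xy uv; rewrite !scale1r. Qed.

Let Gsum (I : Type) (r : seq I) (F : I -> O) (F' : I -> B) :
  (forall i, G (F i) (F' i)) -> G (\sum_(i <- r) F i) (\sum_(i <- r) F' i).
Proof.
move=> H; elim: r => [|i r IH]; first by rewrite !big_nil.
by rewrite !big_cons; apply: GD.
Qed.

Let Gterm al be : G (monom_eval s al * star (monom_eval s be))
  (monom_eval b al * star (monom_eval b be)).
Proof. by exists [:: (1, al, be)]; rewrite /npoly_eval !big_seq1 !scale1r. Qed.

Let G1 : G 1 1.
Proof. by have := Gterm [::] [::]; rewrite /= !star1 !mulr1. Qed.

Let Gleft i x y : G x y -> G (s i * x) (b i * y).
Proof.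
move=> [p [-> ->]]; exists [seq (t.1.1, i :: t.1.2, t.2) | t <- p].
by rewrite /npoly_eval !big_map !mulr_sumr; split; apply: eq_bigr => t _ /=;
  rewrite -scalerAr mulrA.
Qed.

(* Induction on al, since the relations move star (s i) past its first letter. *)
Let Gstar_term i al be : G (star (s i) * (monom_eval s al * star (monom_eval s be)))
  (star (b i) * (monom_eval b al * star (monom_eval b be))).
Proof.
elim: al i => [|j al IH] i.
  have := Gterm [::] (rcons be i).
  have E (A : cstarAlgType R) (a : 'I_N -> A) : monom_eval a (rcons be i) = monom_eval a be * a i.
    by rewrite -cats1 monom_eval_cat /= mulr1.
  by rewrite !E /= !mul1r !starM.
set x := monom_eval s al * star (monom_eval s be).
set y := monom_eval b al * star (monom_eval b be).
have -> : star (s i) * (monom_eval s (j :: al) * star (monom_eval s be)) = star (s i) * s j * x.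
  by rewrite /x /= !mulrA.
have -> : star (b i) * (monom_eval b (j :: al) * star (monom_eval b be)) = star (b i) * b j * y.
  by rewrite /y /= !mulrA.
have [->|ij] := eqVneq i j.
  rewrite s_diag b_diag !mulr_suml; apply: Gsum => k.
  by rewrite -!scalerAl -!mulrA; apply: GZ; apply: Gleft; exact: IH.
rewrite s_neq// b_neq// -!scalerAl -!mulrA; apply: GZ; apply: Gleft; exact: IH.
Qed.

Let Gstar i x y : G x y -> G (star (s i) * x) (star (b i) * y).
Proof.
move=> [p [-> ->]]; rewrite /npoly_eval !mulr_sumr; apply: Gsum => t.
by rewrite -!scalerAr; apply: GZ; exact: Gstar_term.
Qed.

Let GM x y u v : G x y -> G u v -> G (x * u) (y * v).
Proof.
move=> [p [-> ->]] uv; rewrite /npoly_eval !mulr_suml; apply: Gsum => t.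
rewrite -!scalerAl -!mulrA; apply: GZ.
have {uv} : G (star (monom_eval s t.2) * u) (star (monom_eval b t.2) * v).
  elim: t.2 u v uv => [|i w IH] u v uv; first by rewrite /= !star1 !mul1r.
  by rewrite /= !starM -!mulrA; apply: IH; exact: Gstar.
move: (star _ * u) (star _ * v) => x' y' xy'.
elim: t.1.2 => [|i w IH]; first by rewrite /= !mul1r.
by rewrite /= -!mulrA; exact: Gleft.
Qed.

Let GS x y : G x y -> G (star x) (star y).
Proof.
move=> [p [-> ->]]; exists [seq ((t.1.1)^*, t.2, t.1.2) | t <- p].
by rewrite /npoly_eval !big_map !star_sum; split; apply: eq_bigr => t _ /=;
  rewrite starZ starM starK.
Qed.

Let Gbound x y : G x y -> cnorm y <= 2 * cnorm x.
Proof. by move=> [p [-> ->]]; exact: npoly_eval_bound. Qed.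

Let Ggen i : G (s i) (b i).
Proof. by have := Gleft i G1; rewrite !mulr1. Qed.

Let Gdense x e : 0 < e -> exists u v, G u v /\ cnorm (x - u) <= e.
Proof.
move: e; have : cstar_generated (range s) x by rewrite (quo_generated q0 hO).
pose D := [set x | forall e : R, 0 < e -> exists u v, G u v /\ cnorm (x - u) <= e].
move=> /(_ D); apply; split; last first.
  by move=> _ [i _ <-] e e0; exists (s i), (b i); rewrite subrr cnorm0 ltW.
split.
- by move=> e e0; exists 1, 1; rewrite subrr cnorm0 ltW.
- move=> a z w zD wD e e0.
  have a1 : 0 < Normc.normc a + 1 by rewrite ltr_wpDl// normc_ge0.
  have [u [u' [uG zu]]] := zD _ (divr_gt0 e0 a1).
  have [v [v' [vG wv]]] := wD _ (divr_gt0 e0 a1).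
  exists (a *: u + v), (a *: u' + v'); split; first exact: GL.
  have -> : a *: z + w - (a *: u + v) = a *: (z - u) + (w - v) by rewrite scalerBr; zmod.
  apply: (le_trans (cnormD _ _)); rewrite cnormZ.
  have -> : e = Normc.normc a * (e / (Normc.normc a + 1)) + e / (Normc.normc a + 1).
    by field; rewrite gt_eqF.
  by apply: lerD => //; apply: ler_wpM2l => //; exact: normc_ge0.
- move=> z w zD wD e e0.
  pose K := cnorm z + cnorm w + 1.
  have K0 : 0 < K by rewrite ltr_wpDl// addr_ge0// cnorm_ge0.
  pose e' := Num.min 1 (e / K).
  have e'0 : 0 < e' by rewrite lt_min ltr01 divr_gt0.
  have e'1 : e' <= 1 by rewrite ge_min lexx.
  have [u [u' [uG zu]]] := zD _ e'0.
  have [v [v' [vG wv]]] := wD _ e'0.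
  exists (u * v), (u' * v'); split; first exact: GM.
  apply: (le_trans (cnorm_sub_mul e'0 e'1 zu wv)); rewrite -/K.
  by rewrite mulrC -ler_pdivlMr// ge_min lexx orbT.
- move=> z zD e e0; have [u [u' [uG zu]]] := zD e e0.
  by exists (star u), (star u'); split; [exact: GS | rewrite -starB cnorm_star].
- move=> z zD e e0; have e2 : 0 < e / 2 by rewrite divr_gt0.
  have [w wD zw] := zD _ e2; have [u [u' [uG wu]]] := wD _ e2.
  exists u, u'; split=> //.
  have -> : z - u = (z - w) + (w - u) by zmod.
  by apply: (le_trans (cnormD _ _)); rewrite [leRHS]splitr; apply: lerD.
Qed.

Lemma universal_hom : exists2 f : {lrmorphism O -> B},
  is_star_hom f /\ (forall i, f (s i) = b i) &
  forall g : {lrmorphism O -> B},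
    is_star_hom g -> (forall i, g (s i) = b i) -> g =1 f.
Proof.
have [f fs fG] := star_hom_extension (ler0n R 2) G1 GL GM GS Gbound Gdense.
exists f; first by split=> // i; apply: fG; exact: Ggen.
move=> g gs gb; apply: (@star_hom_eq _ _ _ _ _ _ s fs gs (quo_generated q0 hO)) => i.
by rewrite gb (fG _ _ (Ggen i)).
Qed.

End Universality.

Section Relations.
Variables (R : realType) (N : nat).
Implicit Types (i j k : 'I_N).

(** Translates the diagonal relation of either presentation into the single weighted sum that
    [universal_hom] expects. *)
Lemma sum_if_pred (A : lmodType R[i]) (a : R[i]) (X : 'I_N -> A)
    (P : pred 'I_N) j : ~~ P j ->
  \sum_k (if k == j then 1 else if P k then a else 0) *: X k =
  X j + a *: \sum_(k | P k) X k.
Proof.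
move=> Pj; rewrite (bigD1 j)//= eqxx scale1r; congr (_ + _).
rewrite scaler_sumr [RHS]big_mkcond [LHS]big_mkcond; apply: eq_bigr => k _ /=.
have [->|kj] := eqVneq k j; first by rewrite (negbTE Pj).
by case: ifP; rewrite // scale0r.
Qed.

Variables (q : R).
Hypothesis q0 : 0 < q.
Variables (O : cstarAlgType R) (quo : op N q -> O).
Hypothesis hO : is_cuntz_pimsner quo.
Notation s := (fun i => quo (creation q i)).

Lemma quo_rel_ge1 : 1 <= q -> cp_rel_ge1 q s.
Proof.
move=> q1; have lim e := @qdecay_ge1 R q q0 e q1.
split=> [||i j ij|i].
- exact: quo_creation_sum.
- exact: quo_creation_swap.
- by rewrite (quo_annih_creation_neq q0 hO lim ij) subr0 mulr1.
rewrite (quo_annih_creation_diag q0 hO lim i) subr0 scale1r.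
have -> : (0 : R)%:C%:A = 0 :> O by rewrite scale0r.
rewrite addr0 -(sum_if_pred _ (fun k => s k * star (s k)) (P := fun k => (i < k)%N)) ?ltnn//.
apply: eq_bigr => k _; congr (_ *: _); rewrite /qweight.
case: eqP => // _; case: ifP => // _.
rewrite -exprVn expr2; exact/esym/(rmorphB (real_complex R)).
Qed.

Lemma quo_rel_le1 : q <= 1 -> cp_rel_le1 q s.
Proof.
move=> q1; have lim e := @qdecay_le1 R q q0 e q1.
have qq : q != 0 by rewrite gt_eqF.
split=> [||i j ij|i].
- exact: quo_creation_sum.
- exact: quo_creation_swap.
- rewrite (quo_annih_creation_neq q0 hO lim ij); congr (_%:C *: _).
  by field.
rewrite (quo_annih_creation_diag q0 hO lim i).
rewrite -(sum_if_pred _ (fun k => s k * star (s k)) (P := fun k => (k < i)%N)) ?ltnn//.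
(* With the unit expanded, the coefficient of s_k s_k^* is q^2 (1 - q^-2) + (1 - q^2) = 0 for k > i,
   q^2 + (1 - q^2) = 1 for k = i, and 1 - q^2 for k < i. *)
rewrite -(quo_creation_sum q0 hO) !scaler_sumr -big_split.
apply: eq_bigr => k _ /=; rewrite scalerA -scalerDl; congr (_ *: _); rewrite /qweight.
have RB (a b : R) : (a - b)%:C = a%:C - b%:C :> R[i] by exact: rmorphB.
case: (ltngtP k i) => [ki|ki|/val_inj ->].
- have -> : (k == i) = false by apply/eqP => e; rewrite e ltnn in ki.
  by rewrite mulr0 add0r.
- have -> : (k == i) = false by apply/eqP => e; rewrite e ltnn in ki.
  rewrite -(RB 1) -real_complexM -real_complexD.
  have -> : (1 - (1 - q ^+ 2)) * (1 - q^-1 * q^-1) + (1 - q ^+ 2) = 0 by field.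
  by [].
- by rewrite eqxx mulr1 -real_complexD subrK.
Qed.

End Relations.

Theorem theorem2p4 (R : realType) (N : nat) (q : R)
    (hN : (2 <= N)%N) (hq : 0 < q)
    (O : cstarAlgType R) (quo : op N q -> O) (hO : is_cuntz_pimsner quo) :
  (1 <= q ->
     is_universal_cstar (@cp_rel_ge1 R N q) (fun i => quo (creation q i))) /\
  (q <= 1 ->
     is_universal_cstar (@cp_rel_le1 R N q) (fun i => quo (creation q i))).
Proof.
split=> q1.
- have [s1 sq sn sd] := quo_rel_ge1 hq hO q1.
  split; [by [] | exact: quo_generated | move=> B b [b1 bq bn bd]].
  apply: (universal_hom hq hO b1 bq bn _ sn) => i.
    by rewrite bd -(sum_if_pred _ _ (P := fun k => (i < k)%N)) ?ltnn.
  by rewrite sd -(sum_if_pred _ _ (P := fun k => (i < k)%N)) ?ltnn.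
- have [s1 sq sn sd] := quo_rel_le1 hq hO q1.
  split; [by [] | exact: quo_generated | move=> B b [b1 bq bn bd]].
  apply: (universal_hom hq hO b1 bq bn _ sn) => i.
    by rewrite bd -(sum_if_pred _ _ (P := fun k => (k < i)%N)) ?ltnn.
  by rewrite sd -(sum_if_pred _ _ (P := fun k => (k < i)%N)) ?ltnn.
Qed.
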